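(* Let $d\in\mathbb{N}$, $\sigma\in(0,1]$ with $\sigma<d/2$ if $d\in\{1,2\}$, and $\alpha_0=\frac{d/2+\sigma}{2}$. Then $w_{\sigma,\alpha}=\kappa_{\sigma-\alpha}/\kappa_{-\alpha}$ is a Hardy weight for $\Delta^\sigma$ on $\mathbb{Z}^d$ for every $\alpha\in(\sigma,d/2)$, and (a) for $\sigma<\alpha<\alpha_0$, $w_{\sigma,\alpha}$ is positive critical; (b) for $\alpha=\alpha_0$, $w_{\sigma,\alpha}$ is null-critical; (c) for $\alpha_0<\alpha<d/2$, $w_{\sigma,\alpha}$ is subcritical.
   Context: For $f:\mathbb{Z}^d\to\mathbb{R}$ let $\Delta f(x)=\sum_{y:|y-x|=1}(f(x)-f(y))$ ($|\cdot|$ Euclidean norm), with heat semigroup $e^{-t\Delta}$ on $\ell^2(\mathbb{Z}^d)$; $1_0$ is the indicator of $\{0\}$. For $\sigma\in(0,1)$, $\Delta^\sigma$ is defined on $\ell^2$ by the spectral theorem, $\Delta^1=\Delta$. For $\beta\in(-d/2,1]$ the Riesz kernel $\kappa_\beta:\mathbb{Z}^d\to[0,\infty)$ is given by $\kappa_0=1_0$, $\kappa_1(x)=1_{\{|x|=1\}}$, $\kappa_\beta(0)=0$ if $\beta\in(0,1)$, and otherwise $\kappa_\beta(x)=\frac{1}{|\Gamma(-\beta)|}\int_0^\infty e^{-t\Delta}1_0(x)\,\frac{dt}{t^{1+\beta}}$. Let $Q^\sigma(f)=\frac12\sum_{x,y}\kappa_\sigma(x-y)(f(x)-f(y))^2$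 (equal to $\langle\Delta^\sigma\varphi,\varphi\rangle$ for finitely supported $\varphi$), and let $\mathcal{D}_0^\sigma$ be the closure of finitely supported functions $C_c(\mathbb{Z}^d)$ under $\|\varphi\|=\sqrt{Q^\sigma(\varphi)+|\varphi(0)|^2}$. A function $w:\mathbb{Z}^d\to[0,\infty)$ is a Hardy weight if $Q^\sigma(\varphi)\ge\sum_xw(x)\varphi(x)^2$ for all $\varphi\in C_c(\mathbb{Z}^d)$ (then also for all $\varphi\in\mathcal{D}_0^\sigma$). A Hardy weight $w$ is subcritical if there is a Hardy weight $w'\ge w$ with $w'\ne w$, and critical otherwise. A critical Hardy weight $w$ is positive critical if there is a nonzero $v\in\mathcal{D}_0^\sigma$ with $Q^\sigma(v)=\sum_xw(x)v(x)^2$, and null-critical otherwise. *)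

(* Defs.v *)
From HB Require Import structures.
From mathcomp Require Import all_boot all_order all_algebra.
From mathcomp Require Import all_classical all_reals all_analysis.
Set Implicit Arguments. Unset Strict Implicit. Unset Printing Implicit Defensive.
Import Order.TTheory GRing.Theory Num.Theory.
Import numFieldNormedType.Exports.
Local Open Scope classical_set_scope.
Local Open Scope ring_scope.

Definition Zd (d : nat) := 'rV[int]_d.

Definition unitv d (i : 'I_d) : Zd d := \row_(j < d) ((i == j)%:R : int).

Definition is_unit_step d (x : Zd d) : bool := (\sum_(i < d) (x ord0 i) ^+ 2 == 1).

Fixpoint nwalks d (n : nat) (x : Zd d) : nat :=
  match n with
  | 0 => (x == 0%R)
  | n'.+1 => \sum_(i < d) (@nwalks d n' (x - unitv i)%R + @nwalks d n' (x + unitv i)%R)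
  end.

(* heat kernel e^{-t Delta} 1_0 (x) = e^{-2dt} sum_n t^n/n! (A^n 1_0)(x),
   A = adjacency operator, Delta = 2d - A *)
Definition heat {R : realType} d (t : R) (x : Zd d) : R :=
  expR (- (2 * d%:R * t)) *
  fine (\sum_(0 <= n <oo) (t ^+ n / (n`!)%:R * (nwalks n x)%:R)%:E)%E.

(* Euler Gamma function: integral for s > 0, Gamma(s) = Gamma(s+1)/s on (-1,0) *)
Definition Gamma_pos {R : realType} (s : R) : R :=
  fine (\int[lebesgue_measure]_(t in `]0%R, +oo[) ((t `^ (s - 1)) * expR (- t))%:E)%E.
Definition Gamma {R : realType} (s : R) : R :=
  if 0 < s then Gamma_pos s else Gamma_pos (s + 1) / s.

Definition kappa {R : realType} d (beta : R) (x : Zd d) : R :=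
  if beta == 0 then (x == 0)%:R
  else if beta == 1 then (is_unit_step x)%:R
  else if (0 < beta) && (beta < 1) && (x == 0) then 0
  else (`|Gamma (- beta)|)^-1 *
       fine (\int[lebesgue_measure]_(t in `]0%R, +oo[)
               ((heat t x) * t `^ (- 1 - beta))%:E)%E.

Definition Qform {R : realType} d (sigma : R) (f : Zd d -> R) : \bar R :=
  ((2^-1)%:E * \esum_(p in [set: Zd d * Zd d])
     (kappa sigma (p.1 - p.2) * (f p.1 - f p.2) ^+ 2)%:E)%E.

Definition wsum {R : realType} d (w : Zd d -> R) (f : Zd d -> R) : \bar R :=
  (\esum_(x in [set: Zd d]) (w x * f x ^+ 2)%:E)%E.

Definition finsupp {R : realType} d (f : Zd d -> R) : Prop :=
  exists s : seq (Zd d), forall x, f x != 0 -> x \in s.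

(* D_0^sigma: closure of C_c under ||phi|| = sqrt(Q^sigma(phi) + |phi(0)|^2) *)
Definition D0 {R : realType} d (sigma : R) (v : Zd d -> R) : Prop :=
  exists phi : nat -> Zd d -> R, (forall n, finsupp (phi n)) /\
    forall eps : R, 0 < eps -> exists N, forall n, (N <= n)%N ->
      (Qform sigma (fun x => (phi n x - v x)%R) + ((phi n 0 - v 0) ^+ 2)%R%:E <= eps%:E)%E.

Definition hardy {R : realType} d (sigma : R) (w : Zd d -> R) : Prop :=
  (forall x, 0 <= w x) /\
  forall phi : Zd d -> R, finsupp phi -> (wsum w phi <= Qform sigma phi)%E.

Definition subcritical {R : realType} d (sigma : R) (w : Zd d -> R) : Prop :=
  hardy sigma w /\
  exists w' : Zd d -> R, hardy sigma w' /\ (forall x, w x <= w' x) /\ w' <> w.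

Definition critical {R : realType} d (sigma : R) (w : Zd d -> R) : Prop :=
  hardy sigma w /\ ~ subcritical sigma w.

Definition positive_critical {R : realType} d (sigma : R) (w : Zd d -> R) : Prop :=
  critical sigma w /\
  exists v : Zd d -> R, D0 sigma v /\ v <> (fun _ => 0) /\ Qform sigma v = wsum w v.

Definition null_critical {R : realType} d (sigma : R) (w : Zd d -> R) : Prop :=
  critical sigma w /\ ~ positive_critical sigma w.

Definition wHardy {R : realType} d (sigma alpha : R) (x : Zd d) : R :=
  kappa (sigma - alpha) x / kappa (- alpha) x.

(* Main.v *)
Require Import Defs.
From HB Require Import structures.
From mathcomp Require Import all_boot all_order all_algebra.
From mathcomp Require Import all_classical all_reals all_analysis.
From mathcomp Require Import measurable_realfun.
From mathcomp Require Import ring lra zify.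
Set Implicit Arguments. Unset Strict Implicit. Unset Printing Implicit Defensive.
Import Order.TTheory GRing.Theory Num.Theory.
Import numFieldNormedType.Exports.
Local Open Scope classical_set_scope.
Local Open Scope ring_scope.

(** Expanding the heat semigroup in powers of the adjacency operator turns the Riesz
    kernels into series [sum_n c_n p_n(x)] in the [n]-step probabilities [p_n] of
    simple random walk, whose coefficients [c_n] are those of powers of [1 - z].  Vandermonde's
    identity then says that [G = kappa_{-alpha}] solves [Delta^sigma G = H] with
    [H = kappa_{sigma-alpha}], and the ground state representation
    [Q(f) = E(f) + sum_x w f^2], with [w = H / G] and
    [E(f) = 1/2 sum_{x,y} kappa_sigma(x-y) G(x) G(y) (f(x)/G(x) - f(y)/G(y))^2],
    gives the Hardy inequality.
    As [p_n = O(n^{-d/2})], the partial sums of the series of [G] have bounded energy [E]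
    when [alpha <= alpha_0]; adding [k] of them, pairwise almost [E]-orthogonal, gives
    functions of size [k] and energy [O(k)], whence criticality.  The sum of [H G] is
    finite exactly when [alpha < alpha_0]: then [G] itself attains equality, whereas at
    [alpha_0] equality forces a multiple of [G], of infinite mass.
    When [alpha > alpha_0], the averages of [f / G] over boxes of doubling size move by
    geometrically small multiples of [E(f)^{1/2}], so that [E(f) >= c f(0)^2]. *)

(** * Binomial coefficients, sums over countable types, lattice walks *)

(** The threshold is an exponent count. The sum of [H G] is the series of (1 - z)^-(2 alpha - sigma)
    paired with p_n(0), which is of order n^(-d/2) at even times: it converges iff 2 alpha - sigma <
    d/2. Dually, the weights K(x,y) G(x) G(y) over a box of side N add up to order N^(4 alpha - 2
    sigma - d), which grows iff alpha > alpha_0. Criticality is usually shown with a null sequence,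
    whose energies tend to 0. The partial sums of G only have bounded energy at alpha_0; k of them
    give k^2 on the side of the weight against O(k), which is enough. Powers n^p appear as
    [expR (p * har n)] or as [rc], whose partial sums are exact. The bound on p_n comes from the
    heat kernel, which factorises over the coordinates as p_n does not, and is carried back by the
    monotonicity of p_2n(0). Lower bounds on the kernels come from restricting the time integral to
    one dyadic interval. Sums take values in [0, +oo], so that rearranging them needs no
    summability; terms are moved across equations instead of subtracted, and finiteness is used only
    to cancel. *)

Section rising_coefficients.
Variable R : realType.
Implicit Types (s a b : R) (n : nat).

(* Taylor coefficients of [(1 - z)^-s]. *)
Definition rc s n : R := \prod_(k < n) ((s + k%:R) / k.+1%:R).

Lemma rc0 s : rc s 0 = 1.
Proof. by rewrite /rc big_ord0. Qed.

Lemma rcS s n : rc s n.+1 = rc s n * ((s + n%:R) / n.+1%:R).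
Proof. by rewrite /rc big_ord_recr. Qed.

Lemma rc_ge0 s n : 0 <= s -> 0 <= rc s n.
Proof.
move=> s0; apply: prodr_ge0 => k _; apply: divr_ge0 => //.
by rewrite addr_ge0.
Qed.

Lemma rc_gt0 s n : 0 < s -> 0 < rc s n.
Proof.
move=> s0; apply: prodr_gt0 => k _; apply: divr_gt0 => //.
by rewrite ltr_wpDr.
Qed.

Lemma rc1 n : rc 1 n = 1.
Proof.
by rewrite /rc big1 // => k _; rewrite -natr1 addrC divff // natr1 pnatr_eq0.
Qed.

Lemma rc_succ s n : n.+1%:R * rc s n.+1 = (s + n%:R) * rc s n.
Proof.
rewrite rcS; have : n.+1%:R != 0 :> R by rewrite pnatr_eq0.
by move=> h; field.
Qed.

(** In coefficients, [rc_succ] is the equation (1 - z) f' = s f of f = (1 - z)^-s; the induction is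
    the product rule for two such functions. *)
Lemma rc_vandermonde a b n :
  \sum_(k < n.+1) rc a k * rc b (n - k) = rc (a + b) n.
Proof.
elim: n => [|n IH]; first by rewrite big_ord1 !rc0 mulr1.
have n1 : n.+1%:R != 0 :> R by rewrite pnatr_eq0.
apply: (mulfI n1); rewrite rc_succ -IH.
(* The factor n+1 is split as k + (n+1-k), one part for each of the two functions. *)
transitivity (\sum_(k < n.+2) (k%:R * rc a k) * rc b (n.+1 - k) +
              \sum_(k < n.+2) rc a k * ((n.+1 - k)%:R * rc b (n.+1 - k))).
  rewrite -big_split /= mulr_sumr; apply: eq_bigr => k _.
  have kn : (k <= n.+1)%N by rewrite -ltnS.
  rewrite natrB //; ring.
rewrite big_ord_recl /= mul0r mul0r add0r.
rewrite [X in _ + X]big_ord_recr /= subnn mul0r mulr0 addr0.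
rewrite -big_split /= mulr_sumr; apply: eq_bigr => k _.
have kn : (k <= n)%N by rewrite -ltnS.
rewrite /bump /= add1n subSS rc_succ subSn // rc_succ natrB //; ring.
Qed.

Lemma rc_sum s n : \sum_(k < n.+1) rc s k = rc (s + 1) n.
Proof. by rewrite -rc_vandermonde; apply: eq_bigr => k _; rewrite rc1 mulr1. Qed.

(* Taylor coefficients of [1 - (1 - z)^s]. *)
Definition bc s n : R := if n is m.+1 then s / n%:R * rc (1 - s) m else 0.

(** The factors in [bc] are visibly nonnegative for 0 <= s <= 1; the form with [rc (- s)] makes
    Vandermonde's identity applicable. *)
Lemma bcE s n : bc s n.+1 = - rc (- s) n.+1.
Proof.
elim: n => [|n IH]; first by rewrite /= rcS !rc0 divr1 addr0 !mul1r mulr1; field.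
rewrite [in RHS]rcS -mulNr -IH /= !rcS.
have h1 : n.+1%:R != 0 :> R by rewrite pnatr_eq0.
have h2 : n.+2%:R != 0 :> R by rewrite pnatr_eq0.
have -> : 1 - s + n%:R = - s + n.+1%:R by rewrite -(natr1 n); ring.
by move: h1 h2; move: n.+1%:R n.+2%:R => x y hx hy; field; rewrite hx hy.
Qed.

Lemma bc_ge0 s n : 0 <= s <= 1 -> 0 <= bc s n.
Proof.
case: n => [|n] //= /andP[s0 s1]; rewrite mulr_ge0 //; first exact: divr_ge0.
by apply: rc_ge0; lra.
Qed.

(** Coefficients of (1 - (1-z)^s) (1-z)^-a = (1-z)^-a - (1-z)^-(a-s). Read through the random walk,
    this becomes the equation satisfied by the ground state. *)
Lemma bc_conv s a n :
  \sum_(k < n.+1) bc s k * rc a (n - k) = rc a n - rc (a - s) n.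
Proof.
have -> : a - s = - s + a by rewrite addrC.
rewrite -rc_vandermonde !big_ord_recl /= rc0 mul0r mul1r subn0 add0r.
rewrite opprD addrA subrr add0r -sumrN; apply: eq_bigr => k _.
by rewrite /bump /= add1n -mulNr -bcE.
Qed.

Lemma bc_sum s n : \sum_(k < n.+1) bc s k = 1 - rc (1 - s) n.
Proof.
rewrite -[X in X - _](rc1 n) -(bc_conv s 1); apply: eq_bigr => k _.
by rewrite rc1 mulr1.
Qed.

(** A discrete logarithm: [expR (har n)] lies between n+1 and e(n+1), so that [expR (p * har n)]
    stands for n^p up to constants. *)
Definition har n : R := \sum_(k < n) k.+1%:R^-1.

Lemma harS n : har n.+1 = har n + n.+1%:R^-1.
Proof. by rewrite /har big_ord_recr. Qed.

Lemma har0 : har 0 = 0.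
Proof. by rewrite /har big_ord0. Qed.

Lemma expR_har_ge n : n.+1%:R <= expR (har n).
Proof.
elim: n => [|n IH]; first by rewrite har0 expR0.
rewrite harS expRD.
have h : 1 + n.+1%:R^-1 <= expR (n.+1%:R^-1 : R) by exact: expR_ge1Dx.
apply: (@le_trans _ _ (n.+1%:R * (1 + n.+1%:R^-1))); last first.
  by apply: ler_pM => //; rewrite addr_ge0 // invr_ge0.
by rewrite mulrDr mulr1 divff ?pnatr_eq0 // natr1.
Qed.

Lemma expR_har_le n : expR (har n) <= expR 1 * n.+1%:R.
Proof.
suff h : expR (har n.+1) <= expR 1 * n.+1%:R.
  by apply: le_trans h; rewrite ler_expR harS lerDl invr_ge0.
elim: n => [|n IH]; first by rewrite harS har0 add0r invr1 mulr1.
rewrite harS expRD.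
have n1 : n.+2%:R != 0 :> R by rewrite pnatr_eq0.
have n0 : 0 < n.+1%:R :> R by [].
have h : 1 - n.+2%:R^-1 <= expR (- n.+2%:R^-1 : R) by exact: expR_ge1Dx.
have e0 : 0 < expR (n.+2%:R^-1 : R) by exact: expR_gt0.
have {}h : n.+1%:R * expR (n.+2%:R^-1) <= n.+2%:R :> R.
  rewrite expRN -[leRHS]mul1r ler_pdivlMr // in h.
  have := ler_wpM2l (ler0n R n.+2) h.
  by rewrite mulrA mulrBr !mulr1 divff // -[X in X - 1]natr1 addrK.
apply: le_trans (ler_wpM2l (expR_ge0 1) h).
by rewrite mulrA ler_pM2r.
Qed.

(** Each factor is (s+k)/(k+1) = 1 + (s-1)/(k+1), to which 1 + y <= e^y applies. *)
Lemma rc_le_exp s n : 0 <= s -> rc s n <= expR ((s - 1) * har n).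
Proof.
move=> s0; elim: n => [|n IH]; first by rewrite rc0 har0 mulr0 expR0.
rewrite rcS harS mulrDr expRD; apply: ler_pM => //.
- exact: rc_ge0.
- by rewrite divr_ge0 // addr_ge0.
- apply: le_trans (expR_ge1Dx _).
  have : n.+1%:R != 0 :> R by rewrite pnatr_eq0.
  move=> h; rewrite le_eqVlt; apply/orP; left; apply/eqP.
  by rewrite -(natr1 n) in h *; field.
Qed.

Lemma rc_cvg0 s : 0 < s <= 1 -> rc (1 - s) n @[n --> \oo] --> 0.
Proof.
move=> /andP[s0 s1]; apply/cvgrPdist_le => e e0.
pose A := - ln e / s.
exists (Num.truncn (expR A)).+1 => // n /= An.
have h : rc (1 - s) n <= expR (- s * har n).
  by apply: le_trans (rc_le_exp n _) _; [lra|rewrite addrC addKr].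
rewrite sub0r normrN ger0_norm; last by apply: rc_ge0; lra.
apply: le_trans h _; rewrite -[leRHS](@lnK R e) // ler_expR.
have : A <= har n.
  rewrite -ler_expR; apply: le_trans (expR_har_ge n); apply: ltW.
  apply: lt_le_trans (truncnS_gt _) _; rewrite ler_nat; exact: ltnW.
by rewrite /A ler_pdivrMr //; lra.
Qed.

End rising_coefficients.

(** * Unordered sums of nonnegative extended reals *)

Section total_sums.
Variable R : realType.
Local Open Scope ereal_scope.
Implicit Types T : choiceType.

Definition tsum T (f : T -> \bar R) := \esum_(x in [set: T]) f x.

Lemma tsum_ge0 T (f : T -> \bar R) : (forall x, 0 <= f x) -> 0 <= tsum f.
Proof. by move=> f0; apply: esum_ge0. Qed.

Lemma eq_tsum T (f g : T -> \bar R) : f =1 g -> tsum f = tsum g.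
Proof. by move=> fg; apply: eq_esum => x _. Qed.

Lemma le_tsum T (f g : T -> \bar R) : (forall x, f x <= g x) -> tsum f <= tsum g.
Proof. by move=> fg; apply: le_esum => x _. Qed.

Lemma tsumD T (f g : T -> \bar R) : (forall x, 0 <= f x) -> (forall x, 0 <= g x) ->
  tsum (fun x => f x + g x) = tsum f + tsum g.
Proof. by move=> f0 g0; apply: esumD. Qed.

Lemma tsum_eq0 T (f : T -> \bar R) : (forall x, f x = 0) -> tsum f = 0.
Proof. by move=> f0; apply: esum1. Qed.

Lemma tsum_ge_seq T (s : seq T) (f : T -> \bar R) :
  (forall x, 0 <= f x) -> uniq s -> \sum_(x <- s) f x <= tsum f.
Proof.
move=> f0 us; apply: esum_ge; exists [set` s]; first by split.
by rewrite -fsbig_seq.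
Qed.

Lemma tsum_le_seq T (f : T -> \bar R) C :
  (forall s : seq T, uniq s -> \sum_(x <- s) f x <= C) -> tsum f <= C.
Proof.
move=> h; apply: ge_ereal_sup => _ [X [finX _]] <-.
by rewrite fsbig_finite //; apply: h; exact: finmap.fset_uniq.
Qed.

Lemma tsum_ge1 T (f : T -> \bar R) x : (forall x, 0 <= f x) -> f x <= tsum f.
Proof.
move=> f0; apply: le_trans (tsum_ge_seq (s := [:: x]) f0 _) => //.
by rewrite big_seq1.
Qed.

Lemma tsumZ_le T (c : R) (f : T -> \bar R) : (0 < c)%R -> (forall x, 0 <= f x) ->
  tsum (fun x => c%:E * f x) <= c%:E * tsum f.
Proof.
move=> c0 f0; apply: tsum_le_seq => s us.
rewrite -ge0_sume_distrr //.
by rewrite lee_pmul2l //; exact: tsum_ge_seq.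
Qed.

(** The converse of [tsumZ_le] is [tsumZ_le] itself for the factor c^-1. *)
Lemma tsumZ T (c : R) (f : T -> \bar R) : (0 <= c)%R -> (forall x, 0 <= f x) ->
  tsum (fun x => c%:E * f x) = c%:E * tsum f.
Proof.
rewrite le_eqVlt => /predU1P[<- f0|c0 f0].
  by rewrite mul0e tsum_eq0 // => x; rewrite mul0e.
apply/eqP; rewrite eq_le tsumZ_le //=.
have ci : (0 < c^-1)%R by rewrite invr_gt0.
have h := @tsumZ_le T _ (fun x => c%:E * f x) ci
  (fun x => mule_ge0 (ltW c0 : 0 <= c%:E) (f0 x)).
have := lee_wpmul2l (ltW c0 : 0 <= c%:E) h.
rewrite muleA -EFinM divff ?gt_eqF // mul1e; apply: le_trans.
rewrite lee_pmul2l //; apply: le_tsum => x.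
by rewrite muleA -EFinM mulVf ?gt_eqF // mul1e.
Qed.

Lemma tsum_sum T (I : choiceType) (r : seq I) (f : T -> I -> \bar R) :
  (forall x i, 0 <= f x i) ->
  tsum (fun x => \sum_(i <- r) f x i) = \sum_(i <- r) tsum (f ^~ i).
Proof. by move=> f0; apply: esum_sum. Qed.

Lemma tsum_pair T1 T2 (f : T1 -> T2 -> \bar R) : (forall x y, 0 <= f x y) ->
  tsum (fun x => tsum (f x)) = tsum (fun p : T1 * T2 => f p.1 p.2).
Proof.
move=> f0; rewrite /tsum (esum_esum (J := fun _ => [set: T2])) //.
by congr esum; apply/seteqP; split.
Qed.

Lemma tsum_bij T1 T2 (e : T1 -> T2) (f : T2 -> \bar R) : bijective e ->
  tsum f = tsum (fun x => f (e x)).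
Proof.
by move=> e_bij; apply: reindex_esum; rewrite setTT_bijective.
Qed.

Lemma tsum_exchange T1 T2 (f : T1 -> T2 -> \bar R) : (forall x y, 0 <= f x y) ->
  tsum (fun x => tsum (f x)) = tsum (fun y => tsum (f ^~ y)).
Proof.
move=> f0; rewrite tsum_pair // (@tsum_pair _ _ (fun y x => f x y)) //.
rewrite (tsum_bij (e := fun p : T2 * T1 => (p.2, p.1))) //.
by exists (fun p => (p.2, p.1)); case.
Qed.

Lemma tsum_seq T (s : seq T) (f : T -> \bar R) : (forall x, 0 <= f x) ->
  uniq s -> (forall x, x \notin s -> f x = 0) -> tsum f = \sum_(x <- s) f x.
Proof.
move=> f0 us fs; apply/eqP; rewrite eq_le tsum_ge_seq // andbT.
apply: tsum_le_seq => r ur.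
rewrite (bigID (mem s)) /= [X in _ + X]big1 ?adde0; last by move=> x /fs.
rewrite -[leLHS]big_filter.
have h : perm_eq [seq x <- r | x \in s] [seq x <- s | x \in r].
  apply: uniq_perm; rewrite ?filter_uniq // => x.
  by rewrite !mem_filter andbC.
rewrite (perm_big _ h) /= big_filter [leRHS](bigID (mem r)) /=.
by rewrite leeDl // sume_ge0.
Qed.

Lemma tsum_single T x (f : T -> \bar R) : (forall y, 0 <= f y) ->
  (forall y, y != x -> f y = 0) -> tsum f = f x.
Proof.
move=> f0 fx; rewrite (tsum_seq (s := [:: x])) ?big_seq1 // => y.
by rewrite inE; exact: fx.
Qed.

Lemma tsum_seq_fin T (s : seq T) (f : T -> \bar R) : (forall x, 0 <= f x) ->
  (forall x, x \notin s -> f x = 0) -> (forall x, f x \is a fin_num) ->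
  tsum f \is a fin_num.
Proof.
move=> f0 fs ffin; rewrite (tsum_seq (s := undup s)) ?undup_uniq //.
  by apply/sum_fin_numP.
by move=> x; rewrite mem_undup; exact: fs.
Qed.

(** Fatou's lemma for sums: every finite partial sum passes to the limit. *)
Lemma tsum_lsc T (u : nat -> T -> R) (f : T -> R) (C : \bar R) :
  (forall n x, (0 <= u n x)%R) ->
  (forall x, u n x @[n --> \oo] --> f x) ->
  (\forall n \near \oo, tsum (fun x => (u n x)%:E) <= C) ->
  tsum (fun x => (f x)%:E) <= C.
Proof.
move=> u0 uf uC; apply: tsum_le_seq => s us.
have hc : (\sum_(x <- s) u n x)%R @[n --> \oo] --> (\sum_(x <- s) f x)%R.
  elim: s {us} => [|x s IH].
    rewrite big_nil; under eq_fun do rewrite big_nil; exact: cvg_cst.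
  rewrite big_cons; under eq_fun do rewrite big_cons.
  by apply: cvgD => //; exact: uf.
rewrite sumEFin.
have h : (\sum_(x <- s) u n x)%:E @[n --> \oo] --> (\sum_(x <- s) f x)%:E.
  by apply: cvg_EFin => //; apply: nearW.
apply: (cvge_to_le h); near=> n.
rewrite -sumEFin; apply: le_trans (tsum_ge_seq _ us) _.
  by move=> x; rewrite lee_fin.
by near: n.
Unshelve. all: end_near. Qed.

Lemma tsum_nat (f : nat -> \bar R) : (forall n, 0 <= f n) ->
  \sum_(0 <= n <oo) f n = tsum f.
Proof. by move=> f0; rewrite nneseries_esumT. Qed.

Lemma tsum_nat_le (f : nat -> \bar R) C : (forall n, 0 <= f n) ->
  (forall N, \sum_(k < N) f k <= C) -> tsum f <= C.
Proof.
move=> f0 h; rewrite -tsum_nat //; apply: lime_le.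
  by apply: is_cvg_nneseries.
by apply: nearW => N; rewrite big_mkord.
Qed.

Lemma tsum_nat_ge (f : nat -> \bar R) N : (forall n, 0 <= f n) ->
  \sum_(k < N) f k <= tsum f.
Proof.
by move=> f0; rewrite -tsum_nat // -(big_mkord xpredT) nneseries_lim_ge.
Qed.

(** The Cauchy product: row m is shifted by m, and exchanging the two sums leaves, for each n, the
    finitely many m <= n. *)
Lemma tsum_diag (f : nat -> nat -> \bar R) : (forall m n, 0 <= f m n) ->
  tsum (fun m => tsum (f m)) = tsum (fun n => \sum_(k < n.+1) f k (n - k)%N).
Proof.
move=> f0.
transitivity (tsum (fun m => tsum (fun n => if (m <= n)%N then f m (n - m)%N else 0))).
  apply: eq_tsum => m; rewrite /tsum [RHS](_ : _ =
    \esum_(n in [set: nat]) (if n \in [set n | (m <= n)%N] then f m (n - m)%N else 0)).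
    rewrite -esum_mkcond; symmetry.
    rewrite (@reindex_esum R nat nat [set: nat] _ (addn m)).
      by apply: eq_esum => n _; rewrite addKn.
    split => //.
    - by move=> n _ /=; rewrite leq_addr.
    - by move=> x y _ _; apply: addnI.
    - by move=> n /= mn; exists (n - m)%N => //; rewrite subnKC.
  by apply: eq_esum => n _; congr (if _ then _ else _); apply/idP/idP; rewrite inE.
rewrite tsum_exchange; last by move=> m n; case: ifP.
apply: eq_tsum => n.
rewrite (tsum_seq (s := iota 0 n.+1)) ?iota_uniq //; first last.
- by move=> m; rewrite mem_iota /= add0n ltnS => /negbTE ->.
- by move=> m; case: ifP.
rewrite -[X in iota _ X]subn0 -/(index_iota 0 n.+1) big_mkord.
by apply: eq_bigr => k _; rewrite -ltnS ltn_ord.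
Qed.

End total_sums.

(** * The lattice and its walk counts *)

Lemma ltr_norm_pred (z : int) : 0 < z -> `|z - 1| < `|z|.
Proof. by move=> z0; rewrite ger0_norm ?gtr0_norm //; lia. Qed.

Lemma ltr_norm_succ (z : int) : z < 0 -> `|z + 1| < `|z|.
Proof. by move=> z0; rewrite ler0_norm ?ltr0_norm //; lia. Qed.

Section lattice.
Variable d : nat.
Implicit Types (x y : Zd d) (n m : nat).

(** Connectedness of the lattice as an induction principle: the sum of the absolute values of the
    coordinates drops when a nonzero coordinate moves towards 0. *)
Lemma Zd_ind (P : Zd d -> Prop) : P 0 ->
  (forall x i, P x -> P (x + unitv i)) -> (forall x i, P x -> P (x - unitv i)) ->
  forall x, P x.
Proof.
move=> P0 Pp Pm x; have [n] := ubnP (\sum_(i < d) `|x ord0 i|%N).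
elim: n x => // n IH x hx.
have [x0|/eqP x0] := boolP [forall i, x ord0 i == 0].
  suff -> : x = 0 by [].
  by apply/rowP => i; rewrite mxE; apply/eqP; exact: (forallP x0).
have {x0}/existsP[i xi] : [exists i, x ord0 i != 0].
  by move/eqP : x0; rewrite negb_forall.
have hs (y : Zd d) : `|y ord0 i| < `|x ord0 i| ->
    (forall j, j != i -> y ord0 j = x ord0 j) ->
    (\sum_(i < d) `|y ord0 i|%N < n)%N.
  move=> yi yj; rewrite -ltnS; apply: leq_trans _ hx.
  rewrite ltnS (bigD1 i) //= [ltnRHS](bigD1 i) //= -addSn.
  apply: leq_add; first by rewrite -ltz_nat !abszE.
  by apply: leq_sum => j ji; rewrite yj.
have ui (j : 'I_d) : @unitv d i ord0 j = (i == j)%:R by rewrite mxE.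
have [xp|xn] : 0 < x ord0 i \/ x ord0 i < 0 by lia.
- rewrite -(subrK (unitv i) x); apply: Pp; apply: IH; apply: hs.
    by rewrite !mxE eqxx; exact: ltr_norm_pred.
  by move=> j ji; rewrite !mxE eq_sym (negbTE ji) subr0.
- rewrite -(addrK (unitv i) x); apply: Pm; apply: IH; apply: hs.
    by rewrite !mxE eqxx; exact: ltr_norm_succ.
  by move=> j ji; rewrite !mxE eq_sym (negbTE ji) addr0.
Qed.

Lemma nwalksS n x :
  nwalks n.+1 x = \sum_(i < d) (nwalks n (x - unitv i) + nwalks n (x + unitv i)).
Proof. by []. Qed.

Lemma nwalksN n x : nwalks n (- x) = nwalks n x.
Proof.
elim: n x => [|n IH] x; first by rewrite /= oppr_eq0.
rewrite !nwalksS; apply: eq_bigr => i _.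
rewrite -(IH (- x - _)) -(IH (- x + _)) opprB opprD !opprK.
by rewrite addrC [unitv i + x]addrC.
Qed.

Lemma nwalks_gt0 x : exists n, (0 < nwalks n x)%N.
Proof.
elim/Zd_ind : x => [|x i [n hn]|x i [n hn]]; first by exists 0%N; rewrite /= eqxx.
  exists n.+1; rewrite nwalksS (bigD1 i) //= addrK.
  by rewrite -addrA; apply: ltn_addr.
exists n.+1; rewrite nwalksS (bigD1 i) //= subrK.
by rewrite lt0n !addn_eq0 !negb_and -!lt0n hn !orbT.
Qed.

Lemma nwalks_finsupp n : exists s : seq (Zd d), forall x, nwalks n x != 0%N -> x \in s.
Proof.
elim: n => [|n [s hs]].
  by exists [:: 0] => x /=; rewrite inE; case: (x == 0).
exists (flatten [seq flatten [seq [:: y + unitv i; y - unitv i] | y <- s] | i <- enum 'I_d]).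
move=> x; rewrite nwalksS sum_nat_eq0 negb_forall => /existsP[i].
rewrite negb_imply /= addn_eq0 negb_and => h.
apply/flattenP; exists (flatten [seq [:: y + unitv i; y - unitv i] | y <- s]).
  by apply/mapP; exists i => //; rewrite mem_enum.
case/orP : h => /hs h; apply/flattenP.
- exists [:: x - unitv i + unitv i; x - unitv i - unitv i].
    by apply/mapP; exists (x - unitv i).
  by rewrite subrK mem_head.
- exists [:: x + unitv i + unitv i; x + unitv i - unitv i].
    by apply/mapP; exists (x + unitv i).
  by rewrite addrK !inE eqxx orbT.
Qed.

Lemma nwalks1 i : nwalks 1 (unitv i : Zd d) = 1%N.
Proof.
rewrite nwalksS (bigD1 i) //= subrr eqxx big1 ?addn0; last first.
  move=> j ji; apply/eqP; rewrite addn_eq0 !eqb0; apply/andP; split.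
    apply/eqP => /rowP/(_ i); rewrite !mxE eqxx (negbTE ji) => /eqP.
    by rewrite subr0 oner_eq0.
  apply/eqP => /rowP/(_ i); rewrite !mxE eqxx (negbTE ji) => /eqP.
  by rewrite addr0 oner_eq0.
suff -> : (unitv i + unitv i == 0 :> Zd d) = false by [].
by apply/eqP => /rowP/(_ i); rewrite !mxE eqxx.
Qed.

Lemma is_unit_stepP x :
  reflect (exists i, x = unitv i \/ x = - unitv i) (is_unit_step x).
Proof.
apply: (iffP idP); last first.
  move=> [i hi]; rewrite /is_unit_step (bigD1 i) //= big1 ?addr0.
    by case: hi => ->; rewrite !mxE eqxx ?sqrrN expr1n.
  by move=> j /negbTE ji; case: hi => ->; rewrite !mxE eq_sym ji ?oppr0 expr0n.
move=> /eqP h.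
have /existsP[i xi] : [exists i, x ord0 i != 0].
  apply: contraT; rewrite negb_exists => /forallP x0.
  move: h; rewrite big1 // => i _; have := x0 i; rewrite negbK => /eqP ->.
  by rewrite expr0n.
move: h; rewrite (bigD1 i) //=.
set S := (X in _ + X); have S0 : 0 <= S by apply: sumr_ge0 => j _; rewrite sqr_ge0.
have xi1 : 1 <= x ord0 i ^+ 2 by rewrite expr2; nia.
move=> h; have {h} [hx hS] : x ord0 i ^+ 2 = 1 /\ S = 0 by lia.
have xj j : j != i -> x ord0 j = 0.
  move=> ji; apply/eqP; rewrite -sqrf_eq0.
  move/eqP : hS; rewrite psumr_eq0 => [/allP/(_ j)|k _]; last exact: sqr_ge0.
  by rewrite mem_index_enum ji => /(_ isT).
exists i; have [e|e] : x ord0 i = 1 \/ x ord0 i = -1 by rewrite expr2 in hx; nia.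
- left; apply/rowP => j; rewrite mxE; have [->|ji] := eqVneq j i.
    exact: e.
  exact: xj.
- right; apply/rowP => j; rewrite !mxE; have [->|ji] := eqVneq j i.
    exact: e.
  by rewrite oppr0; exact: xj.
Qed.

Lemma nwalks1_unit_step x : nwalks 1 x = is_unit_step x.
Proof.
case: is_unit_stepP => [[i [|] ->]|h]; first exact: nwalks1.
  by rewrite nwalksN nwalks1.
rewrite nwalksS big1 // => i _ /=; rewrite subr_eq0 addr_eq0.
have [/eqP e|_] := boolP (x == unitv i); first by case: h; exists i; left.
by have [/eqP e|_] := boolP (x == - unitv i); first by case: h; exists i; right.
Qed.

End lattice.

(** * Simple random walk: convolution and bounds by the diagonal *)

Section walk_probabilities.
Variables (R : realType) (d : nat).
Hypothesis d0 : (0 < d)%N.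
Implicit Types (x y : Zd d) (n m : nat).

(** Locked, so that simplification keeps the number of neighbours as one symbol; [degE] opens it. *)
Definition deg : R := locked (2 * d%:R).
Local Notation lam := deg.

(** The probability p_n(x) that simple random walk started at 0 is at x after n steps. *)
Definition wk n x : R := (nwalks n x)%:R / lam ^+ n.

Lemma wkE n x : wk n x = (nwalks n x)%:R / lam ^+ n. Proof. by []. Qed.

Lemma degE : lam = 2 * d%:R.
Proof. by rewrite /deg -lock. Qed.

Lemma lam_gt0 : 0 < lam.
Proof. by rewrite degE mulr_gt0 // ltr0n. Qed.

Lemma wk_ge0 n x : 0 <= wk n x.
Proof. by rewrite divr_ge0 // exprn_ge0 // ltW // lam_gt0. Qed.

Lemma wk_ge0e n x : (0 <= (wk n x)%:E)%E.
Proof. by rewrite lee_fin wk_ge0. Qed.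

Lemma wk0 x : wk 0 x = (x == 0)%:R.
Proof. by rewrite /wk expr0 divr1. Qed.

Lemma wkN n x : wk n (- x) = wk n x.
Proof. by rewrite /wk nwalksN. Qed.

Lemma wkS n x :
  wk n.+1 x = lam^-1 * \sum_(i < d) (wk n (x - unitv i) + wk n (x + unitv i)).
Proof.
rewrite /wk nwalksS natr_sum exprS mulr_suml mulr_sumr; apply: eq_bigr => i _.
by rewrite natrD -mulrDl invfM mulrCA mulrA mulrAC mulrC.
Qed.

Lemma wk_finsupp n : finsupp (wk n).
Proof.
have [s hs] := nwalks_finsupp d n; exists s => x h; apply: hs.
by apply: contra_neq h => e; rewrite /wk e mul0r.
Qed.

Lemma wk_gt0 x : exists n, 0 < wk n x.
Proof.
have [n hn] := nwalks_gt0 x; exists n.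
by rewrite divr_gt0 ?ltr0n // exprn_gt0 // lam_gt0.
Qed.

Lemma wkS_le n x (C : R) : (forall y, wk n y <= C) -> wk n.+1 x <= C.
Proof.
move=> h; rewrite wkS ler_pdivrMl ?lam_gt0 //.
apply: le_trans (ler_sum _ (fun i _ => lerD (h _) (h _))) _.
by rewrite sumr_const card_ord -mulr_natl le_eqVlt; apply/orP; left; apply/eqP; rewrite degE; ring.
Qed.

Local Open Scope ereal_scope.

Lemma tsum_shift (f : Zd d -> \bar R) c : tsum (fun x => f (x + c)%R) = tsum f.
Proof.
rewrite [RHS](tsum_bij (e := fun x => x + c)%R) //.
by exists (fun x => x - c)%R => x; rewrite ?addrK ?subrK.
Qed.

Lemma tsum_subl (f : Zd d -> \bar R) c : tsum (fun x => f (c - x)%R) = tsum f.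
Proof.
rewrite [RHS](tsum_bij (e := fun x => c - x)%R) //.
by exists (fun x => c - x)%R => x; rewrite subKr.
Qed.

(** Self-adjointness of a single step: the last step of the walk is transferred to f. *)
Lemma tsum_wkS n (f : Zd d -> R) : (forall x, 0 <= f x)%R ->
  tsum (fun x => (wk n.+1 x * f x)%:E) =
  (lam^-1)%:E * \sum_(i < d) (tsum (fun x => (wk n x * f (x + unitv i))%:E) +
                              tsum (fun x => (wk n x * f (x - unitv i))%:E)).
Proof.
move=> f0.
transitivity (tsum (fun x => (lam^-1)%:E *
   \sum_(i < d) ((wk n (x - unitv i) * f x)%:E + (wk n (x + unitv i) * f x)%:E))).
  apply: eq_tsum => x; rewrite wkS -mulrA EFinM; congr (_ * _).
  rewrite mulr_suml -sumEFin; apply: eq_bigr => i _.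
  by rewrite mulrDl EFinD.
have h0 n' x y : 0 <= (wk n' x * f y)%:E by rewrite lee_fin mulr_ge0 // wk_ge0.
rewrite tsumZ; last 2 first.
- by rewrite invr_ge0 ltW // lam_gt0.
- by move=> x; apply: sume_ge0 => i _; rewrite adde_ge0.
congr (_ * _); rewrite tsum_sum; last by move=> x i; rewrite adde_ge0.
apply: eq_bigr => i _; rewrite tsumD //; congr (_ + _).
- rewrite -(tsum_shift _ (unitv i)); apply: eq_tsum => x.
  by rewrite addrK.
- rewrite -(tsum_shift _ (- unitv i)%R); apply: eq_tsum => x.
  by rewrite subrK.
Qed.

Lemma tsum_wk n : tsum (fun x => (wk n x)%:E) = 1.
Proof.
elim: n => [|n IH].
  rewrite (tsum_single (x := 0%R)) => [|y|y /negbTE y0].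
  - by rewrite wk0 eqxx.
  - exact: wk_ge0e.
  - by rewrite wk0 y0.
have := @tsum_wkS n (fun=> 1%R) (fun=> ler01).
under eq_tsum do rewrite mulr1; move=> ->.
under eq_bigr do (under eq_tsum do rewrite mulr1); rewrite IH.
rewrite -[1 + 1]EFinD sumEFin -EFinM sumr_const card_ord -mulr_natl.
congr EFin; have : lam != 0%R by rewrite gt_eqF // lam_gt0.
by move=> h; rewrite [X in (_ * X)%R]mulrC -[X in (_ * X)%R]/(2 * d%:R)%R -degE mulVf.
Qed.

(** The Chapman-Kolmogorov equation; the induction on m transfers one step at a time by
    [tsum_wkS]. *)
Lemma wk_conv m n x :
  tsum (fun y => (wk m (x - y) * wk n y)%:E) = (wk (m + n) x)%:E.
Proof.
elim: m x => [|m IH] x.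
  rewrite (tsum_single (x := x)) => [|y|y yx].
  - by rewrite subrr wk0 eqxx mul1r.
  - by rewrite lee_fin mulr_ge0 // wk_ge0.
  - by rewrite wk0 subr_eq0 eq_sym (negbTE yx) mul0r.
rewrite -(tsum_subl _ x) addSn wkS.
under eq_tsum do rewrite subKr.
rewrite tsum_wkS; last by move=> y; exact: wk_ge0.
rewrite EFinM -sumEFin; congr (_ * _); apply: eq_bigr => i _.
rewrite EFinD -!IH; congr (_ + _).
- rewrite -[RHS](tsum_subl _ (x - unitv i)%R); apply: eq_tsum => y.
  by rewrite subKr; congr (_ * _)%:E; congr wk; rewrite opprD addrA addrAC.
- rewrite -[RHS](tsum_subl _ (x + unitv i)%R); apply: eq_tsum => y.
  by rewrite subKr; congr (_ * _)%:E; congr wk; rewrite opprB addrA addrAC.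
Qed.

(** The walk is split at half time; 2ab <= a^2 + b^2 and translation invariance bound the resulting
    sum by its value at x = 0, where by symmetry the two factors agree. *)
Lemma wk_double_le m x : (wk (m + m) x <= wk (m + m) 0)%R.
Proof.
rewrite -lee_fin -!wk_conv.
have h0 n' y : 0 <= (wk n' y ^+ 2)%:E by rewrite lee_fin sqr_ge0.
have e0 : tsum (fun y => (wk m (0 - y) * wk m y)%:E) = tsum (fun y => (wk m y ^+ 2)%:E).
  by apply: eq_tsum => y; rewrite sub0r wkN expr2.
have e1 : tsum (fun y => (wk m (x - y) ^+ 2)%:E) = tsum (fun y => (wk m y ^+ 2)%:E).
  by rewrite -[RHS](tsum_subl _ x).
rewrite e0.
apply: (@le_trans _ _ (tsum (fun y => (2^-1)%:E * ((wk m (x - y) ^+ 2)%:E + (wk m y ^+ 2)%:E)))).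
  apply: le_tsum => y; rewrite -EFinD -EFinM lee_fin.
  by have := sqr_ge0 (wk m (x - y) - wk m y)%R; rewrite sqrrB; lra.
rewrite tsumZ //; last by move=> y; rewrite adde_ge0.
rewrite tsumD // e1 -e0 wk_conv -EFinD -EFinM lee_fin; lra.
Qed.

Lemma wk_le_double m x : (wk (m + m).+1 x <= wk (m + m) 0)%R.
Proof. by apply: wkS_le => y; exact: wk_double_le. Qed.

End walk_probabilities.

(** * The Riesz kernels as series of walk probabilities *)

Section gamma_integrals.
Variable R : realType.
Implicit Types (s lam x t a b c : R).
Local Notation mu := lebesgue_measure.

Lemma is_derive_expRZ lam x :
  is_derive x 1 (fun t => expR (- (lam * t))) (- lam * expR (- (lam * x))).
Proof.
have h : is_derive x 1 (fun t => - (lam * t)) (- lam).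
  have -> : (fun t => - (lam * t)) = (fun t => (- lam) *: (id t : R^o)).
    by apply/funext => t; rewrite /GRing.scale /= mulNr.
  by apply: is_derive_eq; rewrite /GRing.scale /= mulr1.
have h2 := is_derive1_comp (f := expR) (g := fun t => - (lam * t)) (x := x)
  (is_derive_expR _) h.
by apply: is_derive_eq h2 _; rewrite mulrC.
Qed.

Lemma is_derive_continuous (f : R -> R) x df : is_derive x 1 f df ->
  {for x, continuous f}.
Proof.
by move=> h; apply: differentiable_continuous; apply/derivable1_diffP.
Qed.

Definition gint lam s t : R := t `^ (s - 1) * expR (- (lam * t)).

Lemma gint_ge0 lam s t : 0 <= gint lam s t.
Proof. by rewrite mulr_ge0 ?powR_ge0 // expR_ge0. Qed.

Lemma continuous_gint lam s x : 0 < x -> {for x, continuous (gint lam s)}.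
Proof.
move=> x0; apply: continuousM.
  exact: is_derive_continuous (is_derive1_powR _ x0).
exact: is_derive_continuous (is_derive_expRZ _ _).
Qed.

Lemma measurable_gint lam s (D : set R) : measurable_fun D (gint lam s).
Proof.
apply: measurable_funTS.
apply: measurable_funM; first exact: measurable_powR.
by apply: measurableT_comp => //; apply: measurableT_comp => //.
Qed.

Definition gamma_int lam s : \bar R :=
  (\int[mu]_(t in `]0%R, +oo[) (gint lam s t)%:E)%E.

(** Compact intervals away from 0, where t^(s-1) may be singular, on which substitution and
    integration by parts are available. The free factor c absorbs a rescaling, and n+2 keeps the
    intervals nondegenerate. *)
Lemma bigcup_itv_pos c : 0 < c ->
  \bigcup_n [set` `[c * n.+2%:R^-1, c * n.+2%:R]] = [set` `](0 : R), +oo[].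
Proof.
move=> c0; apply/seteqP; split => x /=.
  move=> [n _] /=; rewrite !in_itv /= => /andP[h _]; rewrite andbT.
  by apply: lt_le_trans h; rewrite mulr_gt0 // invr_gt0.
rewrite in_itv /= andbT => x0.
pose n := Num.truncn (Num.max (x / c) (c / x)).
have hn : Num.max (x / c) (c / x) < n.+2%:R.
  by apply: lt_trans (truncnS_gt _) _; rewrite ltr_nat.
exists n => //=; rewrite in_itv /=; apply/andP; split.
  rewrite ler_pdivrMr // mulrC -ler_pdivrMr //.
  by apply: le_trans (ltW hn); rewrite le_max lexx orbT.
rewrite mulrC -ler_pdivrMr //.
by apply: le_trans (ltW hn); rewrite le_max lexx.
Qed.

Lemma cvg_integral_itv_pos (f : R -> R) c : 0 < c ->
  measurable_fun `](0 : R), +oo[ f -> (forall x, 0 < x -> 0 <= f x) ->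
  (\int[mu]_(x in `[(c * n.+2%:R^-1)%R, (c * n.+2%:R)%R]) (f x)%:E)%E @[n --> \oo] -->
  (\int[mu]_(x in `]0%R, +oo[) (f x)%:E)%E.
Proof.
move=> c0 mf f0; rewrite -(bigcup_itv_pos c0).
have sub n : [set` `[c * n.+2%:R^-1, c * n.+2%:R]] `<=` [set` `](0 : R), +oo[].
  by rewrite -(bigcup_itv_pos c0) => x hx; exists n.
apply: ge0_nondecreasing_set_cvg_integral.
- move=> n m nm; apply/subsetPset => x /=; rewrite !in_itv /= => /andP[h1 h2].
  apply/andP; split.
    by apply: le_trans h1; rewrite ler_pM2l // lef_pV2 ?posrE // ler_nat !ltnS.
  by apply: le_trans h2 _; rewrite ler_pM2l // ler_nat.
- by move=> n; exact: measurable_itv.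
- by move=> n; apply/measurable_EFinP; apply: measurable_funS mf.
- by move=> n x /sub /=; rewrite in_itv /= andbT lee_fin; exact: f0.
Qed.

(** The substitution of lam t for t turns the exhaustion with c = 1 into the one with c = lam, so
    that both sides are limits of one sequence. *)
Lemma gamma_int_scale lam s : 0 < lam ->
  gamma_int lam s = ((lam `^ (- s))%:E * gamma_int 1 s)%E.
Proof.
move=> l0.
pose h n := (\int[mu]_(x in `[(1 * n.+2%:R^-1)%R, (1 * n.+2%:R)%R]) (gint lam s x)%:E)%E.
have h1 : h n @[n --> \oo] --> gamma_int lam s.
  apply: cvg_integral_itv_pos => //; first exact: measurable_gint.
  by move=> x _; exact: gint_ge0.
have h2 : h n @[n --> \oo] --> ((lam `^ (- s))%:E * gamma_int 1 s)%E.
  have -> : h = fun n => ((lam `^ (- s))%:E *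
     (\int[mu]_(x in `[(lam * n.+2%:R^-1)%R, (lam * n.+2%:R)%R]) (gint 1 s x)%:E))%E.
    apply/funext => n.
    have dF x : is_derive x 1 ( *%R lam) lam.
      have -> : *%R lam = (fun t => lam *: (id t : R^o)) by [].
      by apply: is_derive_eq; rewrite /GRing.scale /= mulr1.
    have dF1 : ( *%R lam)^`()%classic = cst lam.
      by apply/funext => x; rewrite derive1E; apply: derive_val.
    have cF x : {for x, continuous ( *%R lam)} by exact: is_derive_continuous (dF x).
    have pn : 0 < n.+2%:R :> R by [].
    have pn' : 0 < n.+2%:R^-1 :> R by rewrite invr_gt0.
    have in1 : n.+2%:R^-1 <= n.+2%:R :> R.
      rewrite -[leLHS]mul1r ler_pdivrMr // -natrM ler1n.
      by [].
    rewrite -[(lam * n.+2%:R^-1)%R]/( *%R lam n.+2%:R^-1).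
    rewrite -[(lam * n.+2%:R)%R]/( *%R lam n.+2%:R).
    rewrite (@integration_by_substitution_increasing R ( *%R lam) (gint 1 s)) //.
    + rewrite dF1 -ge0_integralZl //; last 3 first.
      * apply/measurable_EFinP; apply: measurable_funTS.
        apply: measurable_funM => //.
        apply: measurableT_comp; first by apply: measurable_gint.
        exact: measurable_funM.
      * move=> x; rewrite /= in_itv /= => /andP[x1 x2].
        by rewrite lee_fin mulr_ge0 ?gint_ge0 // ltW.
      * by rewrite lee_fin powR_ge0.
      rewrite /h !mul1r; apply: eq_integral => x; rewrite inE /= in_itv /= => /andP[x1 _].
      have x0 : 0 < x by apply: lt_le_trans x1.
      have -> : ((gint 1 s \o *%R lam) * cst lam) x = gint 1 s (lam * x) * lam by [].
      rewrite -EFinM /gint !mul1r powRM ?(ltW x0) ?(ltW l0) //; congr EFin.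
      have q0 : lam != 0 by rewrite gt_eqF.
      have p0 : lam `^ s != 0 by rewrite gt_eqF // powR_gt0.
      rewrite powRN (@powRB _ lam s 1) ?q0 ?implybT // powRr1 ?ltW //.
      by field; rewrite p0 q0.
    + by move=> x y _ _ xy; rewrite ltr_pM2l.
    + by rewrite dF1 => x _; exact: cvg_cst.
    + by rewrite dF1; apply: is_cvg_cst.
    + by rewrite dF1; apply: is_cvg_cst.
    + split.
      * by move=> x _; apply: ex_derive.
      * by apply: cvg_at_right_filter; exact: cF.
      * by apply: cvg_at_left_filter; exact: cF.
    + apply: continuous_subspace_itv => x; rewrite in_itv /= => /andP[x1 _].
      by apply: continuous_gint; apply: lt_le_trans x1; rewrite mulr_gt0.
  apply: cvgeZl => //.
  apply: cvg_integral_itv_pos => //; first exact: measurable_gint.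
  by move=> x _; exact: gint_ge0.
exact: cvg_unique h1 h2.
Qed.

Lemma powR_le_exp s c : 0 < s -> 0 < c ->
  exists2 C, 0 < C & forall x, 0 < x -> x `^ s <= C * expR (c * x).
Proof.
move=> s0 c0; pose k := c / s.
have k0 : 0 < k by rewrite divr_gt0.
(* The constant is k^-s: from ln y <= y at y = k x one gets s ln(k x) <= s k x = c x. *)
exists (expR (- (s * ln k))); first exact: expR_gt0.
move=> x x0; rewrite /powR gt_eqF // -expRD ler_expR.
have : ln (k * x) <= k * x.
  have := @le_ln1Dx R (k * x - 1).
  rewrite addrCA subrr addr0 => h; apply: le_trans (h _) _.
    by rewrite ltrBrDr addNr mulr_gt0.
  by rewrite lerBlDr lerDl.
rewrite lnM ?posrE // => h.
have : s * (ln k + ln x) <= s * (k * x) by rewrite ler_pM2l.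
have -> : s * (k * x) = c * x by rewrite /k; field; rewrite gt_eqF.
rewrite mulrDr; lra.
Qed.

Lemma integral_expR_lt_pinfty c : 0 < c ->
  (\int[mu]_(t in `]0%R, +oo[) (expR (- (c * t)) : R)%:E < +oo)%E.
Proof.
move=> c0.
have cF x : {for x, continuous (fun t => - c^-1 * expR (- (c * t)))}.
  apply: continuousM; first exact: cvg_cst.
  exact: is_derive_continuous (is_derive_expRZ _ _).
have dF x : is_derive x 1 (fun t => - c^-1 * expR (- (c * t))) (expR (- (c * x))).
  have h := is_derive_expRZ c x.
  have h2 : is_derive x 1 (fun t => (- c^-1) *: (expR (- (c * t)) : R^o)) (expR (- (c * x))).
    apply: is_derive_eq; rewrite /GRing.scale /= mulrA mulrNN mulVf ?mul1r //.
    by rewrite gt_eqF.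
  exact: h2.
apply: (@le_lt_trans _ _ (\int[mu]_(t in `[0%R, +oo[) (expR (- (c * t)) : R)%:E)%E).
  apply: ge0_subset_integral => //.
  - apply/measurable_EFinP; apply: measurable_funTS.
    by apply: measurableT_comp => //; apply: measurableT_comp => //.
  - by move=> x /=; rewrite !in_itv /= !andbT; exact: ltW.
rewrite (@ge0_continuous_FTC2y _ _ (fun t => - c^-1 * expR (- (c * t))) _ 0).
- by rewrite -EFinB ltry.
- by move=> x _; exact: expR_ge0.
- apply: continuous_subspaceT => x.
  exact: is_derive_continuous (is_derive_expRZ _ _).
- rewrite -(mulr0 (- c^-1)); apply: cvgM; first exact: cvg_cst.
  exact: (cvg_comp _ _ (gt0_cvgMry c0 cvg_id) (@cvgr_expR R)).
- by move=> x _; apply: ex_derive.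
- by apply: cvg_at_right_filter; exact: cF.
- by move=> x _; rewrite derive1E; apply: derive_val.
Qed.

Lemma gamma_int_by_parts lam s n : 0 < lam -> 0 < s ->
  let a := n.+2%:R^-1 : R in let b := n.+2%:R : R in
  (\int[mu]_(x in `[a, b]) (gint lam (s + 1) x)%:E =
   (lam^-1 * (a `^ s * expR (- (lam * a)) - b `^ s * expR (- (lam * b))))%:E +
   (s / lam)%:E * \int[mu]_(x in `[a, b]) (gint lam s x)%:E)%E.
Proof.
move=> l0 s0 a b.
have a0 : 0 < a by rewrite invr_gt0.
have ab : a < b.
  apply: (@lt_trans _ _ 1); first by rewrite invf_lt1 // ltr1n.
  by rewrite ltr1n.
pose G x := - lam^-1 * expR (- (lam * x)).
have dG x : is_derive x 1 G (expR (- (lam * x))).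
  have h := is_derive_expRZ lam x.
  have h2 : is_derive x 1 (fun t => (- lam^-1) *: (expR (- (lam * t)) : R^o)) (expR (- (lam * x))).
    apply: is_derive_eq; rewrite /GRing.scale /= mulrA mulrNN mulVf ?mul1r //.
    by rewrite gt_eqF.
  exact: h2.
have gt0 x : x \in `[a, b] -> 0 < x.
  by rewrite in_itv /= => /andP[ax _]; apply: lt_le_trans ax.
have gt0' x : x \in `]a, b[ -> 0 < x.
  by rewrite in_itv /= => /andP[ax _]; apply: lt_trans ax.
have b0 : 0 < b by apply: lt_trans ab.
transitivity (\int[mu]_(x in `[a, b]) ((x `^ s) * expR (- (lam * x)))%:E)%E.
  by apply: eq_integral => x _; rewrite /gint addrK.
rewrite (@integration_by_parts R (@powR R ^~ s) G (fun x => s * x `^ (s - 1))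
  (fun x => expR (- (lam * x)))) //.
- congr (_ + _)%E; first by congr EFin; rewrite /G; ring.
  rewrite -ge0_integralZl //.
  + rewrite -[RHS]oppeK; congr (- _)%E; rewrite -integral_ge0N.
      apply: eq_integral => x _; rewrite -EFinM -EFinN; congr EFin.
      by rewrite /G /gint; field; rewrite gt_eqF.
    by move=> x _; rewrite mule_ge0 ?lee_fin ?gint_ge0 // divr_ge0 // ltW.
  + by apply/measurable_EFinP; exact: measurable_gint.
  + by move=> x _; rewrite lee_fin gint_ge0.
  + by rewrite lee_fin divr_ge0 // ltW.
- apply: continuous_subspace_itv => x /gt0 x0.
  apply: (@continuousM _ _ (fun=> s) (@powR R ^~ (s - 1))); first exact: cvg_cst.
  exact: is_derive_continuous (is_derive1_powR _ x0).
- split.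
  + by move=> x /gt0' x0; have := is_derive1_powR s x0; move=> h; apply: ex_derive.
  + apply: cvg_at_right_filter; exact: is_derive_continuous (is_derive1_powR _ a0).
  + apply: cvg_at_left_filter; exact: is_derive_continuous (is_derive1_powR _ b0).
- move=> x /gt0' x0; rewrite derive1E; have := is_derive1_powR s x0.
  by move=> h; apply: derive_val.
- apply: continuous_subspaceT => x.
  exact: is_derive_continuous (is_derive_expRZ _ _).
- split.
  + by move=> x _; apply: ex_derive.
  + by apply: cvg_at_right_filter; exact: is_derive_continuous (dG _).
  + by apply: cvg_at_left_filter; exact: is_derive_continuous (dG _).
- by move=> x _; rewrite derive1E; apply: derive_val.
Qed.

Lemma boundary_cvg0 lam s : 0 < lam -> 0 < s ->
  lam^-1 * (n.+2%:R^-1 `^ s * expR (- (lam * n.+2%:R^-1)) -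
            n.+2%:R `^ s * expR (- (lam * n.+2%:R))) @[n --> \oo] --> (0 : R).
Proof.
move=> l0 s0.
have l2 : 0 < lam / 2 by rewrite divr_gt0.
have [C C0 hC] := powR_le_exp s0 l2.
apply/cvgrPdist_le => e e0.
pose e1 := lam * e / 2.
have e10 : 0 < e1 by rewrite divr_gt0 // mulr_gt0.
(* The first threshold makes the power at the small endpoint at most [e1]. The second serves the
   large endpoint, where half of the exponent absorbs the power and e^y >= 1 + y does the rest. *)
exists (Num.truncn (Num.max (e1 `^ (- s^-1)) (C / (lam / 2) / e1))).+1 => // n /= hn.
have {}hn : Num.max (e1 `^ (- s^-1)) (C / (lam / 2) / e1) <= n.+2%:R.
  apply: ltW; apply: lt_le_trans (truncnS_gt _) _.
  by rewrite ler_nat; apply: leq_trans hn _; rewrite -addn2 leq_addr.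
move: hn; rewrite ge_max => /andP[hn1 hn2].
have h1 : n.+2%:R^-1 `^ s <= e1.
  have -> : e1 = (e1 `^ s^-1) `^ s.
    by rewrite -powRrM mulVf ?powRr1 ?ltW // gt_eqF.
  apply: ge0_ler_powR; first exact: ltW.
  - by rewrite nnegrE invr_ge0.
  - by rewrite nnegrE powR_ge0.
  - by rewrite -[leRHS]invrK lef_pV2 ?posrE ?invr_gt0 ?powR_gt0 // -powRN.
have h2 : n.+2%:R `^ s * expR (- (lam * n.+2%:R)) <= e1.
  apply: (@le_trans _ _ (C * expR (- (lam / 2 * n.+2%:R)))).
    have -> : - (lam / 2 * n.+2%:R) = lam / 2 * n.+2%:R - lam * n.+2%:R by lra.
    by rewrite expRD mulrA ler_pM2r ?expR_gt0 //; exact: hC.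
  rewrite expRN ler_pdivrMr ?expR_gt0 // -ler_pdivrMl //.
  apply: le_trans (expR_ge1Dx _).
  move: hn2; rewrite ler_pdivrMr // ler_pdivrMr // => hn2.
  rewrite ler_pdivrMl //; have := mulr_gt0 e10 l2; nra.
have h3 : 0 <= n.+2%:R `^ s * expR (- (lam * n.+2%:R)).
  by rewrite mulr_ge0 ?powR_ge0 ?expR_ge0.
have h4 : 0 <= n.+2%:R^-1 `^ s * expR (- (lam * n.+2%:R^-1)) <= e1.
  rewrite mulr_ge0 ?powR_ge0 ?expR_ge0 //=.
  apply: le_trans h1; rewrite ler_piMr ?powR_ge0 // -expR0 ler_expR.
  by rewrite oppr_le0 mulr_ge0 // ?invr_ge0 // ltW.
move/andP: h4 => [h4 h5].
rewrite sub0r normrN normrM gtr0_norm ?invr_gt0 // ler_pdivrMl //.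
by rewrite ler_norml; apply/andP; split; rewrite /e1 in h2 h5; lra.
Qed.

Lemma gamma_int_succ lam s : 0 < lam -> 0 < s ->
  gamma_int lam (s + 1) = ((s / lam)%:E * gamma_int lam s)%E.
Proof.
move=> l0 s0.
pose h r n := (\int[mu]_(x in `[(1 * n.+2%:R^-1)%R, (1 * n.+2%:R)%R]) (gint lam r x)%:E)%E.
have hc r : h r n @[n --> \oo] --> gamma_int lam r.
  apply: cvg_integral_itv_pos => //; first exact: measurable_gint.
  by move=> x _; exact: gint_ge0.
have h1 := hc (s + 1).
pose B n : R := lam^-1 * (n.+2%:R^-1 `^ s * expR (- (lam * n.+2%:R^-1)) -
                          n.+2%:R `^ s * expR (- (lam * n.+2%:R))).
have hB : B n @[n --> \oo] --> 0 by exact: boundary_cvg0.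
have h2 : h (s + 1) n @[n --> \oo] --> (0%:E + (s / lam)%:E * gamma_int lam s)%E.
  have -> : (fun n => h (s + 1) n) = (fun n => (B n)%:E + (s / lam)%:E * h s n)%E.
    by apply/funext => n; rewrite /h !mul1r gamma_int_by_parts.
  apply: cvgeD => //.
  - by apply: cvg_EFin => //; apply: nearW.
  - by apply: cvgeZl.
by rewrite (cvg_unique _ h1 h2) // add0e.
Qed.

Lemma gamma_int_ge0 lam s : (0 <= gamma_int lam s)%E.
Proof. by apply: integral_ge0 => x _; rewrite lee_fin gint_ge0. Qed.

(** For s < 1 the integrand is unbounded at 0. The exponent s + 1 is treated instead, where t^s is
    dominated by an exponential, and the functional equation brings finiteness down to s. *)
Lemma gamma_int_fin lam s : 0 < lam -> 0 < s -> gamma_int lam s \is a fin_num.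
Proof.
move=> l0 s0; rewrite ge0_fin_numE ?gamma_int_ge0 //.
have l2 : 0 < lam / 2 by rewrite divr_gt0.
have [C C0 hC] := powR_le_exp s0 l2.
have h : (gamma_int lam (s + 1) < +oo)%E.
  apply: (@le_lt_trans _ _ (C%:E * \int[mu]_(t in `]0%R, +oo[) (expR (- (lam / 2 * t)) : R)%:E)%E).
    have me : measurable_fun [set` `](0 : R), +oo[] (fun t : R => expR (- (lam / 2 * t))).
      apply: measurable_funTS.
      by apply: measurableT_comp => //; apply: measurableT_comp => //.
    rewrite -ge0_integralZl //.
    + apply: ge0_le_integral => //.
      * by move=> x _; rewrite lee_fin gint_ge0.
      * by apply/measurable_EFinP; exact: measurable_gint.
      * by apply/measurable_EFinP; apply: measurable_funM.
      * move=> x; rewrite /= in_itv /= andbT => x0.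
        rewrite -EFinM lee_fin /gint addrK.
        have -> : - (lam / 2 * x) = lam / 2 * x - lam * x by lra.
        rewrite expRD mulrA ler_pM2r ?expR_gt0 //; exact: hC.
    + by apply/measurable_EFinP.
    + by rewrite lee_fin ltW.
  by rewrite lte_mul_pinfty ?lee_fin ?(ltW C0) // integral_expR_lt_pinfty.
rewrite gamma_int_succ // in h.
case: (gamma_int lam s) (gamma_int_ge0 lam s) h => [r||] //.
  by move=> _ _; rewrite ltry.
by move=> _; rewrite gt0_muley // lte_fin divr_gt0.
Qed.

Lemma gamma_int_gt0 lam s : 0 < lam -> 0 < s -> (0 < gamma_int lam s)%E.
Proof.
move=> l0 s0.
have h : (0 < gamma_int lam (s + 1))%E.
  have mi : measurable `[(1 : R), 2] by exact: measurable_itv.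
  apply: (@lt_le_trans _ _ (\int[mu]_(t in `[1%R, 2%R]) (expR (- (lam * 2)) : R)%:E)%E).
    rewrite integral_cst //= lebesgue_measure_itv /= lte_fin ltr1n /=.
    by rewrite -EFinB -EFinM lte_fin mulr_gt0 ?expR_gt0 // subr_gt0 ltr1n.
  apply: (@le_trans _ _ (\int[mu]_(t in `[1%R, 2%R]) (gint lam (s + 1) t)%:E)%E).
    apply: ge0_le_integral => //.
    - by apply/measurable_EFinP; exact: measurable_gint.
    - move=> x; rewrite /= in_itv /= => /andP[x1 x2]; rewrite lee_fin /gint addrK.
      rewrite -[leLHS]mul1r; apply: ler_pM => //; rewrite ?expR_ge0 //.
        rewrite -(powRr0 x); apply: ler_powR => //.
        exact: ltW.
      by rewrite ler_expR lerN2 ler_pM2l.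
  apply: ge0_subset_integral => //.
  - by apply/measurable_EFinP; exact: measurable_gint.
  - by move=> x _; rewrite lee_fin gint_ge0.
  - move=> x /=; rewrite !in_itv /= andbT => /andP[x1 _]; exact: lt_le_trans x1.
move: h; rewrite gamma_int_succ //.
by rewrite pmule_rgt0 // lte_fin divr_gt0.
Qed.

End gamma_integrals.

(** * The Riesz kernels by termwise integration of the heat series *)

Section heat_series.
Variables (R : realType) (d : nat).
Hypothesis d0 : (0 < d)%N.
Implicit Types (x : Zd d) (s t : R) (n m : nat).
Local Notation lam := (@deg R d).
Local Notation mu := lebesgue_measure.
Local Notation wk := (@wk R d).

Lemma tsum_natS (f : nat -> \bar R) : (forall n, 0 <= f n)%E -> f 0%N = 0 ->
  tsum f = tsum (fun n => f n.+1).
Proof.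
move=> f0 f00; apply/eqP; rewrite eq_le; apply/andP; split.
  apply: tsum_nat_le => // -[|N]; first by rewrite big_ord0 tsum_ge0.
  rewrite big_ord_recl f00 add0e; exact: (tsum_nat_ge (f := fun n => f n.+1)).
apply: tsum_nat_le => // N; apply: le_trans (tsum_nat_ge N.+1 f0).
by rewrite big_ord_recl f00 add0e.
Qed.

Lemma tsum_expR (y : R) : 0 <= y ->
  tsum (fun n => (y ^+ n / n`!%:R)%:E) = (expR y)%:E.
Proof.
move=> y0; rewrite -tsum_nat; last by move=> n; rewrite lee_fin divr_ge0 // exprn_ge0.
apply: cvg_lim => //=.
have -> : (fun n => (\sum_(0 <= k < n) (y ^+ k / k`!%:R)%:E)%E) =
          EFin \o series (exp_coeff y).
  by apply/funext => n; rewrite sumEFin.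
by apply: cvg_EFin; [apply: nearW|exact: is_cvg_series_exp_coeff].
Qed.

Lemma wk_le1 n x : wk n x <= 1.
Proof.
rewrite -lee_fin -(tsum_wk R d0 n); apply: (tsum_ge1 (f := fun x => (wk n x)%:E)) => y.
exact: wk_ge0e.
Qed.

Lemma nwalksE n x : (nwalks n x)%:R = lam ^+ n * wk n x.
Proof. by rewrite wkE mulrC divfK // expf_neq0 // gt_eqF // lam_gt0. Qed.

(** Since [heat] takes [fine] of its series, finiteness has to be known: the walk probabilities are
    at most 1, so the series is dominated by that of e^(lam t). *)
Lemma heat_series t x : 0 <= t -> (heat t x)%:E =
  tsum (fun n => (expR (- (lam * t)) * (t ^+ n / n`!%:R * (nwalks n x)%:R))%:E).
Proof.
move=> t0; have l0 := lam_gt0 R d0.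
have h0 n : (0 <= (t ^+ n / n`!%:R * (nwalks n x)%:R)%:E)%E.
  by rewrite lee_fin mulr_ge0 // divr_ge0 // exprn_ge0.
rewrite /heat -degE tsum_nat //.
have fin : tsum (fun n => (t ^+ n / n`!%:R * (nwalks n x)%:R)%:E) \is a fin_num.
  rewrite ge0_fin_numE ?tsum_ge0 //.
  apply: (@le_lt_trans _ _ (expR (lam * t))%:E); last by rewrite ltry.
  rewrite -tsum_expR; last by rewrite mulr_ge0 // ltW.
  apply: le_tsum => n; rewrite lee_fin nwalksE [(lam * t) ^+ n]exprMn.
  rewrite (_ : t ^+ n / _ * _ = lam ^+ n * t ^+ n / n`!%:R * wk n x); last by ring.
  rewrite ler_piMr ?wk_le1 // divr_ge0 // mulr_ge0 // exprn_ge0 // ltW //.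
by rewrite EFinM fineK // -tsumZ // expR_ge0.
Qed.

Lemma heat_ge0 t x : 0 <= t -> 0 <= heat t x.
Proof.
move=> t0; rewrite -lee_fin heat_series //; apply: tsum_ge0 => n.
by rewrite lee_fin mulr_ge0 ?expR_ge0 // mulr_ge0 // divr_ge0 // exprn_ge0.
Qed.

(** The product of [rc s n] with the factorial of n is s(s+1)...(s+n-1), which n uses of the
    functional equation accumulate. *)
Lemma gamma_int_addn s n : 0 < s ->
  gamma_int lam (s + n%:R) = ((rc s n * n`!%:R / lam ^+ n)%:E * gamma_int lam s)%E.
Proof.
move=> s0; elim: n => [|n IH].
  by rewrite addr0 rc0 fact0 expr0 divr1 mulr1 mul1e.
have -> : s + n.+1%:R = s + n%:R + 1 by rewrite -(natr1 n) addrA.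
rewrite gamma_int_succ; last 2 first.
- exact: lam_gt0.
- by rewrite ltr_wpDr.
rewrite IH muleA -EFinM; congr (_%:E * _)%E.
rewrite rcS factS natrM exprS.
have h1 : n.+1%:R != 0 :> R by rewrite pnatr_eq0.
have h2 : lam != 0 by rewrite gt_eqF // lam_gt0.
have h3 : lam ^+ n != 0 by rewrite expf_neq0.
move: (n`!%:R) (s + n%:R) (rc s n) (n.+1%:R) h1 (lam) h2 (lam ^+ n) h3.
by move=> a b c u hu y hy z hz; field; rewrite ?hu ?hy ?hz.
Qed.

(** Termwise integration by monotone convergence, common to the kernels of negative and of positive
    order. *)
Lemma integral_heat_series (u : nat -> R) (c : R -> R) s x :
  0 < s -> (forall n, 0 <= u n) ->
  (forall t, 0 < t -> (c t)%:E = tsum (fun n => (u n * gint lam (s + n%:R) t)%:E)) ->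
  (\int[mu]_(t in `]0%R, +oo[) (c t)%:E =
   gamma_int lam s * tsum (fun n => (u n * (rc s n * n`!%:R / lam ^+ n))%:E))%E.
Proof.
move=> s0 u0 hc.
have ug n t : (0 <= (u n * gint lam (s + n%:R) t)%:E)%E.
  by rewrite lee_fin mulr_ge0 // gint_ge0.
transitivity (\int[mu]_(t in `]0%R, +oo[) (\sum_(0 <= n <oo) (u n * gint lam (s + n%:R) t)%:E))%E.
  apply: eq_integral => t; rewrite inE /= in_itv /= andbT => t0.
  by rewrite hc // tsum_nat.
rewrite integral_nneseries //; last first.
  by move=> n; apply/measurable_EFinP; apply: measurable_funM => //; exact: measurable_gint.
rewrite tsum_nat; last by move=> n; apply: integral_ge0.
have ge n : 0 <= u n * (rc s n * n`!%:R / lam ^+ n).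
  rewrite mulr_ge0 // divr_ge0 ?mulr_ge0 ?rc_ge0 ?ltW //.
  by rewrite exprn_gt0 // lam_gt0.
have gf : gamma_int lam s \is a fin_num by apply: gamma_int_fin => //; exact: lam_gt0.
rewrite -[gamma_int lam s](fineK gf) -tsumZ; last 2 first.
- by rewrite fine_ge0 // gamma_int_ge0.
- by move=> n; rewrite lee_fin.
apply: eq_tsum => n; rewrite (fineK gf).
under eq_integral do rewrite EFinM.
rewrite ge0_integralZl //.
- by rewrite -/(gamma_int lam (s + n%:R)) gamma_int_addn // muleA -EFinM muleC.
- by apply/measurable_EFinP; exact: measurable_gint.
- by move=> t _; rewrite lee_fin gint_ge0.
- by rewrite lee_fin.
Qed.

(** With P the transition operator of the walk, this is (1 - P)^-s applied to the indicator of 0;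
    [kappa_neg] identifies it with the Riesz kernel of order -s up to a power of [lam]. *)
Definition Gser s x : \bar R := tsum (fun n => (rc s n * wk n x)%:E).

Lemma gintDn s n t : 0 < t -> gint lam (s + n%:R) t = t ^+ n * t `^ (s - 1) * expR (- (lam * t)).
Proof.
move=> t0; rewrite /gint -powR_mulrn; last exact: ltW.
rewrite -powRD; last by rewrite (gt_eqF t0) implybT.
by congr (_ `^ _ * _); ring.
Qed.

Lemma integral_heat s x : 0 < s ->
  (\int[mu]_(t in `]0%R, +oo[) (heat t x * t `^ (s - 1))%:E =
   gamma_int lam s * Gser s x)%E.
Proof.
move=> s0; rewrite (@integral_heat_series (fun n => (nwalks n x)%:R / n`!%:R) _ s) //.
- congr (_ * _)%E; apply: eq_tsum => n; rewrite nwalksE; congr EFin.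
  have h2 : lam ^+ n != 0 by rewrite expf_neq0 // gt_eqF // lam_gt0.
  have h3 : n`!%:R != 0 :> R by rewrite pnatr_eq0 -lt0n fact_gt0.
  by field; rewrite h3 h2.
- move=> t t0; rewrite EFinM heat_series ?ltW // muleC -tsumZ ?powR_ge0 //.
  + apply: eq_tsum => n; rewrite -EFinM gintDn //; congr EFin; ring.
  + move=> n; rewrite lee_fin mulr_ge0 ?expR_ge0 // mulr_ge0 // divr_ge0 //.
    by rewrite exprn_ge0 // ltW.
Qed.

Lemma Gamma_posE s : 0 < s -> (Gamma_pos s)%:E = gamma_int 1 s.
Proof.
move=> s0; rewrite -[RHS]fineK ?gamma_int_fin //; congr (fine _)%:E.
by apply: eq_integral => t _; rewrite /gint mul1r.
Qed.

Lemma Gamma_pos_gt0 s : 0 < s -> 0 < Gamma_pos s.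
Proof. by move=> s0; rewrite -lte_fin Gamma_posE // gamma_int_gt0. Qed.

Lemma kappa_neg s x : 0 < s -> kappa (- s) x = lam `^ (- s) * fine (Gser s x).
Proof.
move=> s0; rewrite /kappa.
rewrite ifF; last by apply/eqP; lra.
rewrite ifF; last by apply/eqP; lra.
rewrite ifF; last by apply/negbTE; rewrite !negb_and -!leNgt; apply/orP; left; apply/orP; left; lra.
rewrite opprK /Gamma s0.
rewrite [-1 + s]addrC.
have g0 := Gamma_pos_gt0 s0.
rewrite integral_heat // gamma_int_scale ?lam_gt0 // -Gamma_posE // gtr0_norm //.
rewrite -EFinM.
have : (0 <= Gser s x)%E.
  by apply: tsum_ge0 => n; rewrite lee_fin mulr_ge0 ?rc_ge0 ?wk_ge0 // ltW.
have c0 : 0 < lam `^ (- s) * Gamma_pos s by rewrite mulr_gt0 // powR_gt0 // lam_gt0.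
case: (Gser s x) => [r||] //= _.
  by field; rewrite gt_eqF.
(* If the series diverges, both sides are 0, since [fine] sends +oo to 0. *)
by rewrite gt0_muley ?lte_fin //= !mulr0.
Qed.

(** The kernel of 1 - (1 - P)^s, hence off the origin that of -(1 - P)^s: up to a power of [lam],
    the jump kernel of the fractional Laplacian. *)
Definition Kser s x : \bar R := tsum (fun n => (bc s n * wk n x)%:E).

(** Off the origin the term n = 0 is absent, and shifting the index gains a power of t, which makes
    t^(-1-s) integrable at 0. *)
Lemma integral_heat_neg s x : 0 < s < 1 -> x != 0 ->
  (\int[mu]_(t in `]0%R, +oo[) (heat t x * t `^ (- 1 - s))%:E =
   gamma_int lam (1 - s) * ((lam / s)%:E * Kser s x))%E.
Proof.
move=> /andP[s0 s1] x0; have l0 := lam_gt0 R d0.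
have wx0 : wk 0 x = 0 by rewrite wk0 (negbTE x0).
have s1' : 0 < 1 - s by rewrite subr_gt0.
rewrite (@integral_heat_series (fun n => (nwalks n.+1 x)%:R / n.+1`!%:R) _ (1 - s)) //.
- congr (_ * _)%E.
  rewrite /Kser [in RHS]tsum_natS; last 2 first.
  + by move=> n; rewrite lee_fin mulr_ge0 ?wk_ge0 // bc_ge0 // !ltW.
  + by rewrite mul0r.
  rewrite -tsumZ; last 2 first.
  + by rewrite divr_ge0 // ltW.
  + by move=> n; rewrite lee_fin mulr_ge0 ?wk_ge0 // bc_ge0 // !ltW.
  apply: eq_tsum => n; rewrite -EFinM nwalksE exprS factS natrM /=; congr EFin.
  have h1 : n.+1%:R != 0 :> R by rewrite pnatr_eq0.
  have h2 : lam != 0 by rewrite gt_eqF.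
  have h3 : lam ^+ n != 0 by rewrite expf_neq0.
  have h4 : n`!%:R != 0 :> R by rewrite pnatr_eq0 -lt0n fact_gt0.
  have h5 : s != 0 by rewrite gt_eqF.
  move: (n`!%:R) h4 (n.+1%:R) h1 (lam) h2 (lam ^+ n) h3 => v hv u hu z hz y hy.
  by field; rewrite ?h5 ?hu ?hy ?hv.
- move=> t t0.
  have nw0 : nwalks 0 x = 0%N by rewrite /= (negbTE x0).
  rewrite EFinM heat_series ?ltW // tsum_natS; last 2 first.
  + move=> n; rewrite lee_fin mulr_ge0 ?expR_ge0 // mulr_ge0 // divr_ge0 //.
    by rewrite exprn_ge0 // ltW.
  + by rewrite nw0 mulr0 mulr0.
  rewrite muleC -tsumZ ?powR_ge0 //.
  + apply: eq_tsum => n; rewrite -EFinM gintDn // exprS; congr EFin.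
    have -> : t `^ (1 - s - 1) = t * t `^ (-1 - s).
      rewrite -[X in _ = X * _]powRr1 ?ltW // -powRD ?(gt_eqF t0) ?implybT //.
      by congr (_ `^ _); ring.
    by ring.
  + by move=> n; rewrite lee_fin mulr_ge0 ?expR_ge0 // mulr_ge0 // divr_ge0 // exprn_ge0 // ltW.
Qed.

Lemma kappa_pos s x : 0 < s <= 1 -> x != 0 ->
  kappa s x = lam `^ s * fine (Kser s x).
Proof.
move=> /andP[s0 s1] x0; rewrite /kappa gt_eqF //.
have l0 := lam_gt0 R d0.
have [->|sn1] := eqVneq s 1.
  (* For s = 1 all coefficients but that of n = 1 vanish, which leaves a single step of the walk. *)
  rewrite powRr1 ?ltW // /Kser (tsum_single (x := 1%N)).
  - by rewrite /= subrr rc0 invr1 !mul1r -nwalks1_unit_step nwalksE expr1.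
  - by move=> n; rewrite lee_fin mulr_ge0 ?wk_ge0 // bc_ge0 // ler01 lexx.
  - move=> [|[|n]] // _; first by rewrite mul0r.
    by rewrite /= subrr /rc big_ord_recl /= addr0 mul0r mul0r mulr0 mul0r.
have {}s1 : s < 1 by rewrite lt_neqAle sn1.
rewrite s0 s1 (negbTE x0) /=.
have s1' : 0 < 1 - s by rewrite subr_gt0.
have g0 := Gamma_pos_gt0 s1'.
have -> : Gamma (- s) = - (Gamma_pos (1 - s) / s).
  rewrite /Gamma ifF; last by apply/negbTE; rewrite -leNgt; lra.
  by rewrite [- s + 1]addrC; field; rewrite gt_eqF.
rewrite normrN gtr0_norm ?divr_gt0 // integral_heat_neg ?s0 //.
have : (0 <= Kser s x)%E.
  by apply: tsum_ge0 => n; rewrite lee_fin mulr_ge0 ?wk_ge0 // bc_ge0 // !ltW.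
have -> : lam `^ s = lam `^ (- (1 - s)) * lam.
  rewrite -[X in _ = _ * X]powRr1 ?ltW // -powRD ?(gt_eqF l0) ?implybT //.
  by congr (_ `^ _); ring.
rewrite gamma_int_scale // -Gamma_posE // muleA -!EFinM.
have p0 : 0 < lam `^ (- (1 - s)) by rewrite powR_gt0.
have c0 : 0 < lam `^ (- (1 - s)) * Gamma_pos (1 - s) * (lam / s).
  by rewrite mulr_gt0 ?divr_gt0 // mulr_gt0.
case: (Kser s x) => [r||] // _.
  by rewrite -EFinM /=; field; rewrite ?gt_eqF.
by rewrite gt0_muley ?lte_fin //= !mulr0.
Qed.

Lemma measurable_heat x : measurable_fun `](0 : R), +oo[ (fun t : R => (heat t x)%:E).
Proof.
pose f n t := (expR (- (lam * t)) * (t ^+ n / n`!%:R * (nwalks n x)%:R))%:E.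
apply: (@eq_measurable_fun _ _ _ _ _ (fun t => (\sum_(0 <= n <oo | n \in predT) f n t)%E)).
  move=> t; rewrite inE /= in_itv /= andbT => t0.
  rewrite heat_series ?(ltW t0) // -tsum_nat //.
  by move=> n; rewrite lee_fin mulr_ge0 ?expR_ge0 // mulr_ge0 // divr_ge0 // exprn_ge0 // ltW.
apply: ge0_emeasurable_sum => [n t|n _].
  rewrite /= in_itv /= andbT => t0 _.
  by rewrite lee_fin mulr_ge0 ?expR_ge0 // mulr_ge0 // divr_ge0 // exprn_ge0 // ltW.
apply/measurable_EFinP; apply: measurable_funM.
  apply: measurableT_comp => //; apply: measurable_funN; exact: measurable_funM.
apply: measurable_funM => //; apply: measurable_funM => //; exact: measurable_funX.
Qed.

End heat_series.

(** * Ground state representation and criticality *)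

Section sum_complements.
Variable R : realType.
Local Open Scope ereal_scope.

Lemma tsum_sumtype (T1 T2 : choiceType) (f : T1 + T2 -> \bar R) :
  (forall x, 0 <= f x) ->
  tsum f = tsum (fun x => f (inl x)) + tsum (fun y => f (inr y)).
Proof.
move=> f0; rewrite /tsum (esumID (range inl)); last by move=> x _; exact: f0.
congr (_ + _).
  rewrite setTI esum_image //; by move=> x y _ _ [].
rewrite setTI (_ : ~` range inl = range inr); last first.
  apply/seteqP; split => [[x|y]|] //=.
  - by move=> h; case: h; exists x.
  - by exists y.
  - by move=> _ [y _ <-] [x _].
by rewrite esum_image // => x y _ _ [].
Qed.

(** Only the total of the two series is bounded; merging them into one series over the disjoint
    union reduces the claim to [tsum_lsc]. *)
Lemma tsum_lsc2 (T1 T2 : choiceType) (u : nat -> T1 -> R) (v : nat -> T2 -> R)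
    (f : T1 -> R) (g : T2 -> R) (C : \bar R) :
  (forall n x, (0 <= u n x)%R) -> (forall n x, (0 <= v n x)%R) ->
  (forall x, u n x @[n --> \oo] --> f x) ->
  (forall x, v n x @[n --> \oo] --> g x) ->
  (\forall n \near \oo, tsum (fun x => (u n x)%:E) + tsum (fun x => (v n x)%:E) <= C) ->
  tsum (fun x => (f x)%:E) + tsum (fun x => (g x)%:E) <= C.
Proof.
move=> u0 v0 uf vg uC.
have lim_ge0 T (z : nat -> T -> R) h x : (forall n x, 0 <= z n x)%R ->
    (forall x, z n x @[n --> \oo] --> h x) -> (0 <= h x)%R.
  move=> z0 zh; rewrite -(cvg_lim (@Rhausdorff R) (zh x)).
  apply: limr_ge; last by apply: nearW.
  by apply/cvg_ex; exists (h x); exact: zh.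
pose z n (p : T1 + T2) := match p with inl x => u n x | inr y => v n y end.
pose h (p : T1 + T2) := match p with inl x => f x | inr y => g y end.
have h0 p : 0 <= (h p)%:E.
  by rewrite lee_fin; case: p => x /=; apply: lim_ge0; eauto.
have := tsum_sumtype h0 => /= <-.
apply: (@tsum_lsc _ _ z).
- by move=> n [x|y] /=.
- by move=> [x|y] /=.
- near=> n; rewrite (@tsum_sumtype _ _ (fun p => (z n p)%:E)) /=.
    by near: n.
  by move=> [x|y]; rewrite lee_fin /=.
Unshelve. all: end_near. Qed.

Lemma tsum_split (T : choiceType) (f : T -> \bar R) (s : seq T) :
  (forall x, 0 <= f x) -> uniq s ->
  tsum f = \sum_(x <- s) f x + tsum (fun x => if x \in s then 0 else f x).
Proof.
move=> f0 us.
have h0 x : 0 <= if x \in s then 0 else f x by case: ifP.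
have h1 x : 0 <= if x \in s then f x else 0 by case: ifP.
rewrite [X in X + _](_ : _ = tsum (fun x => if x \in s then f x else 0)).
  rewrite -tsumD //; apply: eq_tsum => x.
  by case: ifP; rewrite ?adde0 ?add0e.
rewrite (@tsum_seq _ _ s) //.
  by apply: eq_big_seq => x ->.
by move=> x /negbTE ->.
Qed.

(** A finite set carries all but e/2 of the dominating sum, and on it only finitely many limits are
    involved. *)
Lemma tsum_dominated (T : choiceType) (u : nat -> T -> R) (f : T -> R) :
  (forall n x, (0 <= u n x <= f x)%R) ->
  (forall x, u n x @[n --> \oo] --> (0 : R)%R) ->
  tsum (fun x => (f x)%:E) < +oo ->
  forall e : R, (0 < e)%R -> \forall n \near \oo, tsum (fun x => (u n x)%:E) <= e%:E.
Proof.
move=> uf u0 fin e e0.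
have f0 x : 0 <= (f x)%:E.
  by rewrite lee_fin; have /andP[h1 h2] := uf 0%N x; exact: le_trans h1 h2.
have un0 n x : 0 <= (u n x)%:E by rewrite lee_fin; case/andP: (uf n x).
have e2 : (0 < e / 2)%R by rewrite divr_gt0.
have fn : tsum (fun x => (f x)%:E) \is a fin_num.
  by rewrite ge0_fin_numE // tsum_ge0.
have [s us hs] : exists2 s : seq T, uniq s &
    tsum (fun x => (f x)%:E) <= \sum_(x <- s) (f x)%:E + (e / 2)%:E.
  apply: contrapT => /forall2NP h.
  have : tsum (fun x => (f x)%:E) <= tsum (fun x => (f x)%:E) - (e / 2)%:E.
    apply: tsum_le_seq => s us; have [//|/negP] := h s.
    by rewrite -ltNge leeBrDr // => /ltW.
  by rewrite -(fineK fn) -EFinB lee_fin; lra.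
have tail : tsum (fun x => if x \in s then 0 else (f x)%:E) <= (e / 2)%:E.
  move: hs; rewrite (tsum_split f0 us) leeD2lE //.
  by rewrite sumEFin.
have hc : (\sum_(x <- s) u n x)%R @[n --> \oo] --> (0 : R)%R.
  rewrite [X in _ --> X](_ : _ = \sum_(x <- s) (0 : R))%R; last by rewrite big1.
  elim: (s) => [|x r IH].
    rewrite big_nil; under eq_fun do rewrite big_nil; exact: cvg_cst.
  rewrite big_cons; under eq_fun do rewrite big_cons.
  by apply: cvgD => //; exact: u0.
have hc' : \forall n \near \oo, (\sum_(x <- s) u n x <= e / 2)%R.
  have /cvgrPdist_le/(_ _ e2) := hc; apply: filterS => n /=.
  by rewrite sub0r normrN => /(le_trans (ler_norm _)).
near=> n.
rewrite (tsum_split (un0 n) us) (_ : e = e / 2 + e / 2)%R; last by lra.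
rewrite EFinD; apply: leeD.
  by rewrite sumEFin lee_fin; near: n.
apply: le_trans tail; apply: le_tsum => x; case: ifP => // _.
by rewrite lee_fin; case/andP: (uf n x).
Unshelve. all: end_near. Qed.

End sum_complements.

(** * Energy forms of an abstract symmetric kernel with a positive supersolution *)

Section ground_state.
Variables (R : realType) (T : choiceType).
Variables (K : T -> T -> R) (G H : T -> R) (S : R).
Hypothesis K0 : forall x y, 0 <= K x y.
Hypothesis KC : forall x y, K x y = K y x.
Hypothesis G0 : forall x, 0 < G x.
Hypothesis H0 : forall x, 0 <= H x.
Hypothesis S0 : 0 <= S.
Local Open Scope ereal_scope.
Hypothesis KS : forall x, tsum (fun y => (K x y)%:E) = S%:E.
(** The equation (S - K) G = H with the subtraction moved across: it makes sense for extended reals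
    and contains the finiteness of K G. *)
Hypothesis KG : forall x, tsum (fun y => (K x y * G y)%:E) + (H x)%:E = (S * G x)%:E.
Implicit Types (f g v phi : T -> R).

Definition Qen f := (2^-1)%:E * tsum (fun p => (K p.1 p.2 * (f p.1 - f p.2) ^+ 2)%:E).
Definition Een f := (2^-1)%:E * tsum (fun p =>
  (K p.1 p.2 * (G p.1 * G p.2) * (f p.1 / G p.1 - f p.2 / G p.2) ^+ 2)%:E).
Definition Wen f := tsum (fun x => (H x / G x * f x ^+ 2)%:E).
Definition KK f g := tsum (fun p => (K p.1 p.2 * (f p.1 * g p.2))%:E).

Lemma Gneq0 x : G x != 0%R. Proof. by rewrite gt_eqF. Qed.

Lemma Gge0 x : (0 <= G x)%R. Proof. exact: ltW. Qed.

Lemma half_ge0 : 0 <= (2^-1 : R)%:E. Proof. by rewrite lee_fin invr_ge0. Qed.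

Lemma Qterm_ge0 f p : 0 <= (K p.1 p.2 * (f p.1 - f p.2) ^+ 2)%:E.
Proof. by rewrite lee_fin mulr_ge0 // sqr_ge0. Qed.

Lemma Eterm_ge0 f p : 0 <=
  (K p.1 p.2 * (G p.1 * G p.2) * (f p.1 / G p.1 - f p.2 / G p.2) ^+ 2)%:E.
Proof. by rewrite lee_fin mulr_ge0 ?sqr_ge0 // mulr_ge0 // mulr_ge0 // ltW. Qed.

Lemma Wterm_ge0 f x : 0 <= (H x / G x * f x ^+ 2)%:E.
Proof. by rewrite lee_fin mulr_ge0 ?sqr_ge0 // divr_ge0 // ltW. Qed.

Lemma Qen_ge0 f : 0 <= Qen f.
Proof. by rewrite mule_ge0 ?half_ge0 // tsum_ge0 //; exact: Qterm_ge0. Qed.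

Lemma Een_ge0 f : 0 <= Een f.
Proof. by rewrite mule_ge0 ?half_ge0 // tsum_ge0 //; exact: Eterm_ge0. Qed.

Lemma Wen_ge0 f : 0 <= Wen f.
Proof. by rewrite tsum_ge0 //; exact: Wterm_ge0. Qed.

Lemma tsum_row (F : T -> T -> R) f : (forall x y, (0 <= F x y)%R) ->
  (forall x, (0 <= f x)%R) -> (forall x, tsum (fun y => (F x y)%:E) \is a fin_num) ->
  tsum (fun p => (F p.1 p.2 * f p.1)%:E) =
  tsum (fun x => (f x * fine (tsum (fun y => (F x y)%:E)))%:E).
Proof.
move=> F0 f0 fin.
rewrite -(@tsum_pair _ _ _ (fun x y => (F x y * f x)%:E)); last first.
  by move=> x y; rewrite lee_fin mulr_ge0.
apply: eq_tsum => x; rewrite EFinM fineK // -tsumZ //.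
  by apply: eq_tsum => y; rewrite -EFinM mulrC.
by move=> y; rewrite lee_fin.
Qed.

Lemma tsum_swap (F : T -> T -> R) :
  tsum (fun p => (F p.1 p.2)%:E) = tsum (fun p => (F p.2 p.1)%:E).
Proof.
rewrite (tsum_bij (e := fun p : T * T => (p.2, p.1))) //.
by exists (fun p => (p.2, p.1)); case.
Qed.

Lemma KG_fin x : tsum (fun y => (K x y * G y)%:E) \is a fin_num.
Proof.
rewrite ge0_fin_numE; last by apply: tsum_ge0 => y; rewrite lee_fin mulr_ge0 // ltW.
apply: (@le_lt_trans _ _ (S * G x)%:E); last by rewrite ltry.
by rewrite -KG leeDl // lee_fin.
Qed.

Lemma fine_KG x : (fine (tsum (fun y => (K x y * G y)%:E)) = S * G x - H x)%R.
Proof. by apply: EFin_inj; rewrite fineK ?KG_fin // EFinB -KG addeK. Qed.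

Lemma tsum_Kf2 f : tsum (fun p => (K p.1 p.2 * f p.1 ^+ 2)%:E) =
  S%:E * tsum (fun x => (f x ^+ 2)%:E).
Proof.
rewrite (@tsum_row K (fun x => f x ^+ 2)%R) //; last 2 first.
- by move=> x; rewrite sqr_ge0.
- by move=> x; rewrite KS.
rewrite -tsumZ //; last by move=> x; rewrite lee_fin sqr_ge0.
by apply: eq_tsum => x; rewrite KS /= mulrC.
Qed.

Lemma tsum_Kf2' f : tsum (fun p => (K p.1 p.2 * f p.2 ^+ 2)%:E) =
  S%:E * tsum (fun x => (f x ^+ 2)%:E).
Proof.
rewrite (@tsum_swap (fun x y => K x y * f y ^+ 2)%R) /= -tsum_Kf2.
by apply: eq_tsum => p; rewrite KC.
Qed.

(* All the terms of the expansion of [K (f x - f y)^2] are moved to the side where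
   they are nonnegative, so that the sums may be split without integrability. *)
Lemma ground_state_representation f : tsum (fun x => (f x ^+ 2)%:E) < +oo ->
  Qen f = Een f + Wen f.
Proof.
move=> f2.
pose A := tsum (fun p => (K p.1 p.2 * G p.2 * (f p.1 ^+ 2 / G p.1))%:E).
have A0 p : 0 <= (K p.1 p.2 * G p.2 * (f p.1 ^+ 2 / G p.1))%:E.
  rewrite lee_fin; apply: mulr_ge0; first by rewrite mulr_ge0 ?Gge0.
  by rewrite divr_ge0 ?sqr_ge0 ?Gge0.
have AE : A = tsum (fun x => (f x ^+ 2 / G x * (S * G x - H x))%:E).
  rewrite /A (@tsum_row (fun x y => K x y * G y)%R (fun x => f x ^+ 2 / G x)%R).
  - by apply: eq_tsum => x; rewrite fine_KG.
  - by move=> x y; rewrite mulr_ge0 // ltW.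
  - by move=> x; rewrite mulr_ge0 ?sqr_ge0 // invr_ge0 ltW.
  - exact: KG_fin.
have WA : Wen f + A = S%:E * tsum (fun x => (f x ^+ 2)%:E).
  rewrite /Wen AE -tsumD; last 2 first.
  - exact: Wterm_ge0.
  - move=> x; rewrite lee_fin mulr_ge0 //.
      by rewrite mulr_ge0 ?sqr_ge0 // invr_ge0 ltW.
    rewrite -fine_KG fine_ge0 // tsum_ge0 // => y.
    by rewrite lee_fin mulr_ge0 // ltW.
  rewrite -tsumZ //; last by move=> x; rewrite lee_fin sqr_ge0.
  apply: eq_tsum => x; rewrite -EFinD -EFinM; congr EFin.
  by have := Gneq0 x; move=> h; field.
have A'E : tsum (fun p => (K p.1 p.2 * G p.1 * (f p.2 ^+ 2 / G p.2))%:E) = A.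
  rewrite (@tsum_swap (fun x y => K x y * G x * (f y ^+ 2 / G y))%R) /A /=.
  by apply: eq_tsum => p; rewrite KC.
have A'0 p : 0 <= (K p.1 p.2 * G p.1 * (f p.2 ^+ 2 / G p.2))%:E.
  rewrite lee_fin; apply: mulr_ge0; first by rewrite mulr_ge0 ?Gge0.
  by rewrite divr_ge0 ?sqr_ge0 ?Gge0.
have Kf0 (x : T * T) y : 0 <= (K x.1 x.2 * f y ^+ 2)%:E.
  by rewrite lee_fin mulr_ge0 // sqr_ge0.
have N0 : 0 <= tsum (fun x => (f x ^+ 2)%:E).
  by apply: tsum_ge0 => x; rewrite lee_fin sqr_ge0.
have key : tsum (fun p => (K p.1 p.2 * (f p.1 - f p.2) ^+ 2)%:E) + (A + A) =
   tsum (fun p => (K p.1 p.2 * (G p.1 * G p.2) * (f p.1 / G p.1 - f p.2 / G p.2) ^+ 2)%:E) +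
   (S%:E * tsum (fun x => (f x ^+ 2)%:E) + S%:E * tsum (fun x => (f x ^+ 2)%:E)).
  rewrite -[X in _ + (_ + X) = _]A'E -[X in _ = _ + (X + _)]tsum_Kf2 -tsum_Kf2'.
  rewrite /A -!tsumD; last first.
  all: try by move=> p; rewrite ?adde_ge0 ?Qterm_ge0 ?Eterm_ge0 ?Kf0 ?A0 ?A'0.
  apply: eq_tsum => p; rewrite -!EFinD; congr EFin.
  have := Gneq0 p.1; have := Gneq0 p.2; move: (G p.1) (G p.2) => a b hb ha.
  by field; rewrite ha hb.
(* Square summability makes [A] and [Wen f] finite, so that they can be cancelled from [key]. *)
have Nfin : S%:E * tsum (fun x => (f x ^+ 2)%:E) < +oo.
  by rewrite lte_mul_pinfty // ?lee_fin.
have A00 : 0 <= A by exact: tsum_ge0.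
have W00 := Wen_ge0 f.
have Afin : A \is a fin_num.
  by rewrite ge0_fin_numE //; apply: le_lt_trans Nfin; rewrite -WA leeDr.
have Wfin : Wen f \is a fin_num.
  by rewrite ge0_fin_numE //; apply: le_lt_trans Nfin; rewrite -WA leeDl.
move: key; rewrite /Qen /Een -WA.
have := tsum_ge0 (Qterm_ge0 f); have := tsum_ge0 (Eterm_ge0 f).
move: (tsum _) (tsum _) => e q.
rewrite -(fineK Afin) -(fineK Wfin).
case: e => [e||] //; case: q => [q||] // _ _.
  by rewrite -!EFinD => -[h]; congr EFin; lra.
by rewrite !gt0_muley ?lte_fin ?invr_gt0.
Qed.

Lemma hardy_l2 f : tsum (fun x => (f x ^+ 2)%:E) < +oo -> Wen f <= Qen f.
Proof. by move=> h; rewrite ground_state_representation // leeDr // Een_ge0. Qed.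

Definition fsupp (f : T -> R) := exists s : seq T, forall x, f x != 0%R -> x \in s.

Lemma fsuppD f g : fsupp f -> fsupp g -> fsupp (fun x => f x + g x)%R.
Proof.
move=> [s hs] [r hr]; exists (s ++ r) => x; rewrite mem_cat.
have [->|/hs -> //] := eqVneq (f x) 0%R.
by rewrite add0r => /hr ->; rewrite orbT.
Qed.

Lemma fsupp_l2 f : fsupp f -> tsum (fun x => (f x ^+ 2)%:E) < +oo.
Proof.
move=> [s hs]; have h : tsum (fun x => (f x ^+ 2)%:E) \is a fin_num.
  apply: (tsum_seq_fin (s := s)) => //.
    by move=> x; rewrite lee_fin sqr_ge0.
  move=> x; apply: contraNeq => h; apply: hs; apply: contra_neq h => ->.
  by rewrite expr0n.
by move: h; rewrite fin_numElt => /andP[].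
Qed.

Lemma fsupp_fin f (F : T -> R) : fsupp f -> (forall x, (0 <= F x)%R) ->
  (forall x, f x = 0%R -> F x = 0%R) -> tsum (fun x => (F x)%:E) \is a fin_num.
Proof.
move=> [s hs] F0 fF; apply: (tsum_seq_fin (s := s)) => //.
move=> x xs; rewrite fF //; apply/eqP; apply: contraNT xs; exact: hs.
Qed.

Lemma Wen_fin f : fsupp f -> Wen f \is a fin_num.
Proof.
move=> hf; apply: (fsupp_fin hf).
  by move=> x; rewrite -lee_fin; exact: Wterm_ge0.
by move=> x ->; rewrite expr0n mulr0.
Qed.

Lemma norm2_fin f : fsupp f -> tsum (fun x => (f x ^+ 2)%:E) \is a fin_num.
Proof.
move=> hf; apply: (fsupp_fin hf); first by move=> x; rewrite sqr_ge0.
by move=> x ->; rewrite expr0n.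
Qed.

Lemma Qen_le f : Qen f <= (2 * S)%:E * tsum (fun x => (f x ^+ 2)%:E).
Proof.
have N0 : 0 <= tsum (fun x => (f x ^+ 2)%:E).
  by apply: tsum_ge0 => x; rewrite lee_fin sqr_ge0.
have -> : (2 * S)%:E * tsum (fun x => (f x ^+ 2)%:E) = (2^-1)%:E *
  (2%:E * (S%:E * tsum (fun x => (f x ^+ 2)%:E) + S%:E * tsum (fun x => (f x ^+ 2)%:E))).
  have SN : 0 <= S%:E * tsum (fun x => (f x ^+ 2)%:E) by rewrite mule_ge0.
  rewrite !muleA -EFinM mulVf // mul1e EFinM -muleA.
  by rewrite -[2%R]/(1 + 1)%R EFinD ge0_muleDl // mul1e.
rewrite /Qen; apply: lee_wpmul2l; first exact: half_ge0.
have Kf0 (x : T * T) y : 0 <= (K x.1 x.2 * f y ^+ 2)%:E.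
  by rewrite lee_fin mulr_ge0 // sqr_ge0.
rewrite -{1}tsum_Kf2 -tsum_Kf2' -tsumD // -tsumZ //; last by move=> p; rewrite adde_ge0.
apply: le_tsum => p; rewrite -EFinD -EFinM lee_fin -mulrDr [leRHS]mulrCA ler_wpM2l //.
by have := sqr_ge0 (f p.1 + f p.2)%R; rewrite sqrrB sqrrD; lra.
Qed.

Lemma Qen_fin f : fsupp f -> Qen f \is a fin_num.
Proof.
move=> hf; rewrite ge0_fin_numE ?Qen_ge0 //; apply: le_lt_trans (Qen_le f) _.
by rewrite lte_mul_pinfty // ?lee_fin ?mulr_ge0 // fsupp_l2.
Qed.

Lemma Een_fin f : fsupp f -> Een f \is a fin_num.
Proof.
move=> hf; have := Qen_fin hf; rewrite ground_state_representation ?fsupp_l2 //.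
by rewrite fin_numD => /andP[].
Qed.

Lemma KK_ge0 f g : (forall x, 0 <= f x)%R -> (forall x, 0 <= g x)%R -> 0 <= KK f g.
Proof. by move=> f0 g0; apply: tsum_ge0 => p; rewrite lee_fin !mulr_ge0. Qed.

Lemma Qen_KK f : (forall x, 0 <= f x)%R -> fsupp f ->
  Qen f + KK f f = S%:E * tsum (fun x => (f x ^+ 2)%:E).
Proof.
move=> f0 hf.
have Kf0 (x : T * T) y : 0 <= (K x.1 x.2 * f y ^+ 2)%:E.
  by rewrite lee_fin mulr_ge0 // sqr_ge0.
have KKt p : 0 <= (K p.1 p.2 * (f p.1 * f p.2))%:E by rewrite lee_fin !mulr_ge0.
have key : tsum (fun p => (K p.1 p.2 * (f p.1 - f p.2) ^+ 2)%:E) + (KK f f + KK f f) =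
   (S%:E * tsum (fun x => (f x ^+ 2)%:E) + S%:E * tsum (fun x => (f x ^+ 2)%:E)).
  rewrite -[X in _ = X + _]tsum_Kf2 -tsum_Kf2' /KK -!tsumD //; last 2 first.
  - by move=> p; exact: Qterm_ge0.
  - by move=> p; rewrite adde_ge0.
  apply: eq_tsum => p; rewrite -!EFinD; congr EFin; ring.
have := Qen_fin hf; rewrite /Qen; move: key.
have Nf : S%:E * tsum (fun x => (f x ^+ 2)%:E) \is a fin_num.
  by rewrite fin_numM // norm2_fin.
rewrite -(fineK Nf).
have := tsum_ge0 (Qterm_ge0 f); have := KK_ge0 f0 f0.
move: (tsum _) (KK f f) => q [k||] //; case: q => [q||] // _ _.
by move=> + _; rewrite -!EFinD => -[h]; congr EFin; lra.
Qed.

Lemma tsum_fKg f g : (forall x, 0 <= f x)%R -> (forall x, 0 <= g x)%R ->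
  KK f g = tsum (fun x => (f x)%:E * tsum (fun y => (K x y * g y)%:E)).
Proof.
move=> f0 g0; rewrite /KK.
rewrite -(@tsum_pair _ _ _ (fun x y => (K x y * (f x * g y))%:E)); last first.
  by move=> x y; rewrite lee_fin !mulr_ge0.
apply: eq_tsum => x; rewrite -tsumZ //; last by move=> y; rewrite lee_fin mulr_ge0.
by apply: eq_tsum => y; rewrite -EFinM mulrCA.
Qed.

Lemma KKC f g : KK f g = KK g f.
Proof.
rewrite /KK (@tsum_swap (fun x y => K x y * (f x * g y))%R) /=.
by apply: eq_tsum => p; rewrite KC [X in (_ * X)%R]mulrC.
Qed.

(** * Truncated ground states, criticality, and the finite-mass case *)

Section truncations.
Variables (u Hu : nat -> T -> R).
Hypothesis u0 : forall n x, 0 <= (u n x)%:E.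
Hypothesis uG : forall n x, (u n x <= G x)%R.
Hypothesis Hu0 : forall n x, (0 <= Hu n x)%R.
Hypothesis HuH : forall n x, (Hu n x <= H x)%R.
Hypothesis u_fsupp : forall n, fsupp (u n).
Hypothesis u_cvg : forall x, u n x @[n --> \oo] --> G x.
Hypothesis u_nd : forall m n x, (m <= n)%N -> (u m x <= u n x)%R.
(** The truncated form of (S - K) G = H, as the inequality (S - K) u_n <= Hu_n. *)
Hypothesis Ku : forall n x,
  (S * u n x)%:E <= tsum (fun y => (K x y * u n y)%:E) + (Hu n x)%:E.

Lemma u_ge0 n x : (0 <= u n x)%R. Proof. by rewrite -lee_fin. Qed.

(** By [Ku], Q(u) is at most the sum of u Hu; as u <= G and Hu <= H, the term u Hu exceeds the
    weight term (H/G) u^2 by at most (G - u) Hu. The truncated [Hu] matters: with H in its place the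
    bound is infinite whenever the sum of H G diverges. *)
Lemma Een_truncation n : Een (u n) <= tsum (fun x => ((G x - u n x) * Hu n x)%:E).
Proof.
have hu := u_fsupp n; have un0 := u_ge0 n.
have t1 x : (0 <= u n x * Hu n x)%R by rewrite mulr_ge0.
have t2 x : (0 <= (G x - u n x) * Hu n x)%R by rewrite mulr_ge0 // subr_ge0.
have h1 : Qen (u n) <= tsum (fun x => (u n x * Hu n x)%:E).
  have KKf : KK (u n) (u n) \is a fin_num.
    have : Qen (u n) + KK (u n) (u n) \is a fin_num.
      by rewrite Qen_KK // fin_numM // norm2_fin.
    by rewrite fin_numD => /andP[].
  rewrite -(leeD2rE _ _ KKf) Qen_KK // tsum_fKg // -tsumD; last 2 first.
  - by move=> x; rewrite lee_fin.
  - move=> x; rewrite mule_ge0 ?lee_fin // tsum_ge0 // => y.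
    by rewrite lee_fin mulr_ge0.
  rewrite -tsumZ //; last by move=> x; rewrite lee_fin sqr_ge0.
  apply: le_tsum => x; rewrite addeC [(u n x * Hu n x)%:E]EFinM -ge0_muleDr; last 2 first.
  - by apply: tsum_ge0 => y; rewrite lee_fin mulr_ge0.
  - by rewrite lee_fin.
  apply: le_trans (lee_wpmul2l (u0 n x) (Ku n x)).
  by rewrite -!EFinM lee_fin le_eqVlt; apply/orP; left; apply/eqP; ring.
have h2 : tsum (fun x => (u n x * Hu n x)%:E) <=
    Wen (u n) + tsum (fun x => ((G x - u n x) * Hu n x)%:E).
  rewrite /Wen -tsumD; last 2 first.
  - exact: Wterm_ge0.
  - by move=> x; rewrite lee_fin.
  apply: le_tsum => x; rewrite -EFinD lee_fin.
  have g0 := Gneq0 x; have gp := G0 x.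
  have -> : (H x / G x * u n x ^+ 2 = (u n x / G x) * (u n x * H x))%R by field.
  apply: (@le_trans _ _ ((u n x / G x) * (u n x * Hu n x) + (u n x / G x) * ((G x - u n x) * Hu n x))%R).
    by rewrite le_eqVlt; apply/orP; left; apply/eqP; field.
  apply: lerD.
    by rewrite ler_wpM2l ?divr_ge0 ?Gge0 // ler_wpM2l.
  by rewrite ler_piMl // ler_pdivrMr // mul1r.
have := le_trans h1 h2.
rewrite ground_state_representation ?fsupp_l2 // addrC leeD2lE //.
exact: Wen_fin.
Qed.

Lemma tsum_pair_fin f (F : T -> R) : fsupp f -> (forall x, (0 <= F x)%R) ->
  (forall x, (0 <= f x)%R) -> tsum (fun x => (f x * F x)%:E) \is a fin_num.
Proof.
move=> hf F0 f0; apply: (fsupp_fin hf) => x; first by rewrite mulr_ge0.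
by move=> ->; rewrite mul0r.
Qed.

Lemma KK_fin f g : (forall x, 0 <= f x)%R -> (forall x, 0 <= g x)%R ->
  fsupp f -> fsupp g -> KK f g \is a fin_num.
Proof.
move=> f0 g0 hf hg; rewrite tsum_fKg //.
have h x : tsum (fun y => (K x y * g y)%:E) \is a fin_num.
  apply: (fsupp_fin hg) => y; first by rewrite mulr_ge0.
  by move=> ->; rewrite mulr0.
under eq_tsum do rewrite -(fineK (h _)) -EFinM.
apply: tsum_pair_fin => // x; rewrite fine_ge0 // tsum_ge0 // => y.
by rewrite lee_fin mulr_ge0.
Qed.

Definition Wpair f g := tsum (fun x => (H x / G x * (f x * g x))%:E).

Lemma Wpair_fin f g : (forall x, 0 <= f x)%R -> (forall x, 0 <= g x)%R ->
  fsupp f -> Wpair f g \is a fin_num.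
Proof.
move=> f0 g0 hf; rewrite /Wpair.
under eq_tsum do rewrite mulrCA.
by apply: tsum_pair_fin => // x; rewrite mulr_ge0 // divr_ge0 // Gge0.
Qed.

Lemma Een_KK f : (forall x, 0 <= f x)%R -> fsupp f ->
  Een f + (Wpair f f + KK f f) = S%:E * tsum (fun x => (f x * f x)%:E).
Proof. by move=> f0 hf; rewrite -[RHS]Qen_KK // ground_state_representation ?fsupp_l2 // addeA. Qed.

(** The mixed energy of f and u_n is the sum of f ((S - K) u_n - (H/G) u_n), whose bracket is at
    most H (G - u_n)/G by [Ku]. *)
Lemma Een_add_truncation f n : (forall x, 0 <= f x)%R -> fsupp f ->
  Een (fun x => f x + u n x)%R <= Een f + Een (u n) +
    2%:E * tsum (fun x => (f x * (H x * (G x - u n x) / G x))%:E).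
Proof.
move=> f0 hf; have hu := u_fsupp n; have un0 := u_ge0 n.
have d0 x : (0 <= H x * (G x - u n x) / G x)%R.
  by rewrite divr_ge0 ?Gge0 // mulr_ge0 // subr_ge0.
pose v x := (f x + u n x)%R.
have v0 x : (0 <= v x)%R by rewrite addr_ge0.
have hv : fsupp v by exact: fsuppD.
have Wadd : Wpair v v = Wpair f f + (Wpair f (u n) + Wpair f (u n)) + Wpair (u n) (u n).
  have t g h x : (forall x, 0 <= g x)%R -> (forall x, 0 <= h x)%R ->
      0 <= (H x / G x * (g x * h x))%:E.
    by move=> g0 h0; rewrite lee_fin mulr_ge0 ?divr_ge0 ?Gge0 // mulr_ge0.
  rewrite /Wpair -!tsumD; last first.
  all: try by move=> x; rewrite ?adde_ge0 ?t.
  by apply: eq_tsum => x; rewrite -!EFinD; congr EFin; rewrite /v; ring.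
have Kadd : KK v v = KK f f + (KK f (u n) + KK f (u n)) + KK (u n) (u n).
  have t g h p : (forall x, 0 <= g x)%R -> (forall x, 0 <= h x)%R ->
      0 <= (K p.1 p.2 * (g p.1 * h p.2))%:E.
    by move=> g0 h0; rewrite lee_fin mulr_ge0 // mulr_ge0.
  rewrite -[X in _ + (_ + X)]KKC /KK -!tsumD; last first.
  all: try by move=> x; rewrite ?adde_ge0 ?t.
  by apply: eq_tsum => x; rewrite -!EFinD; congr EFin; rewrite /v; ring.
have N0 g h : (forall x, 0 <= g x)%R -> (forall x, 0 <= h x)%R ->
    forall x, 0 <= (g x * h x)%:E.
  by move=> g0 h0 x; rewrite lee_fin mulr_ge0.
have Nadd : tsum (fun x => (v x * v x)%:E) = tsum (fun x => (f x * f x)%:E) +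
  (tsum (fun x => (f x * u n x)%:E) + tsum (fun x => (f x * u n x)%:E)) +
   tsum (fun x => (u n x * u n x)%:E).
  rewrite -!tsumD; last first.
  all: try by move=> x; rewrite ?adde_ge0 ?N0.
  by apply: eq_tsum => x; rewrite -!EFinD; congr EFin; rewrite /v; ring.
have cross : S%:E * tsum (fun x => (f x * u n x)%:E) <= KK f (u n) + Wpair f (u n) +
    tsum (fun x => (f x * (H x * (G x - u n x) / G x))%:E).
  have Ku0 x : 0 <= tsum (fun y => (K x y * u n y)%:E).
    by apply: tsum_ge0 => y; rewrite lee_fin mulr_ge0.
  rewrite tsum_fKg // /Wpair -!tsumD; last first.
  - by move=> x; rewrite lee_fin mulr_ge0 ?divr_ge0 ?Gge0 // mulr_ge0.
  - by move=> x; rewrite mule_ge0 // lee_fin.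
  - by move=> x; rewrite lee_fin mulr_ge0.
  - move=> x; rewrite adde_ge0 ?mule_ge0 ?lee_fin //.
    by rewrite mulr_ge0 ?divr_ge0 ?Gge0 // mulr_ge0.
  rewrite -tsumZ //; last by move=> x; rewrite lee_fin mulr_ge0.
  apply: le_tsum => x.
  have := lee_wpmul2l (_ : 0 <= (f x)%:E) (Ku n x); rewrite lee_fin => /(_ (f0 x)) h.
  rewrite -EFinM mulrCA EFinM; apply: le_trans h _.
  rewrite ge0_muleDr ?lee_fin // -addeA leeD2l // -EFinD -EFinM lee_fin.
  rewrite (_ : _ + _ = f x * H x)%R; first by rewrite ler_wpM2l.
  by have := Gneq0 x; move=> h'; field.
have Ev := Een_KK v0 hv; have Ef := Een_KK f0 hf; have Eu := Een_KK un0 hu.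
move: Ev; rewrite Wadd Kadd Nadd.
have Nfin g h : (forall x, 0 <= g x)%R -> (forall x, 0 <= h x)%R -> fsupp g ->
  tsum (fun x => (g x * h x)%:E) \is a fin_num by move=> *; apply: tsum_pair_fin.
have D0 := tsum_pair_fin hf d0 f0.
move: Ef Eu cross.
rewrite -(fineK (Een_fin hv)) -(fineK (Een_fin hf)) -(fineK (Een_fin hu)).
rewrite -(fineK (Nfin _ _ f0 f0 hf)) -(fineK (Nfin _ _ f0 un0 hf)) -(fineK (Nfin _ _ un0 un0 hu)).
rewrite -(fineK (Wpair_fin f0 f0 hf)) -(fineK (Wpair_fin f0 un0 hf)) -(fineK (Wpair_fin un0 un0 hu)).
rewrite -(fineK (KK_fin f0 f0 hf hf)) -(fineK (KK_fin f0 un0 hf hu)) -(fineK (KK_fin un0 un0 hu hu)).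
rewrite -(fineK D0) -!(EFinD, EFinM) !lee_fin => -[e1] [e2] e3 [e4].
move: (S) e1 e2 e3 e4 => s; rewrite !mulrDr; lra.
Qed.

Lemma u_defect_cvg0 x : (G x - u n x)%R @[n --> \oo] --> (0 : R)%R.
Proof.
have h : (G x - u n x)%R @[n --> \oo] --> (G x - G x)%R.
  by apply: cvgB; [exact: cvg_cst|exact: u_cvg].
by rewrite subrr in h.
Qed.

(** With f fixed, the terms tend to 0 pointwise and are dominated by f H, summable because f has
    finite support. *)
Lemma near_null (f : T -> R) : (forall x, 0 <= f x)%R -> fsupp f ->
  \forall n \near \oo,
    tsum (fun x => (f x * (H x * (G x - u n x) / G x))%:E) <= (2^-1)%:E.
Proof.
move=> f0 hf; apply: (@tsum_dominated _ _ _ (fun x => f x * H x)%R).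
- move=> n x; apply/andP; split.
    by rewrite mulr_ge0 // divr_ge0 ?Gge0 // mulr_ge0 // subr_ge0.
  rewrite ler_wpM2l // ler_pdivrMr // ler_wpM2l // gerBl; exact: u_ge0.
- move=> x; rewrite -(mulr0 (f x)); apply: cvgM; first exact: cvg_cst.
  rewrite -(mul0r (G x)^-1%R); apply: cvgM; last exact: cvg_cst.
  rewrite -(mulr0 (H x)); apply: cvgM; first exact: cvg_cst.
  exact: u_defect_cvg0.
- have : tsum (fun x => (f x * H x)%:E) \is a fin_num by exact: tsum_pair_fin.
  by rewrite fin_numElt => /andP[].
- by rewrite invr_gt0.
Qed.

(* Adding truncations one by one, each far enough from the previous ones for the
   cross terms to be bounded, the energy grows linearly and not quadratically. *)
Lemma linear_energy_growth (C : R) x0 (k : nat) : (forall n, Een (u n) <= C%:E) ->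
  exists f, [/\ forall x, (0 <= f x)%R, fsupp f,
    (k%:R * (G x0 / 2) <= f x0)%R & Een f <= (k%:R * (C + 1))%:E].
Proof.
move=> uC; elim: k => [|k [f [f0 hf fk fE]]].
  exists (fun=> 0%R); split => //.
  - by exists [::] => x; rewrite eqxx.
  - by rewrite mul0r.
  - rewrite mul0r /Een tsum_eq0 ?mule0 // => p.
    by rewrite !mul0r subrr expr0n mulr0.
have G2 : (0 < G x0 / 2)%R by rewrite divr_gt0.
have nu : \forall n \near \oo, (G x0 / 2 <= u n x0)%R.
  have := @u_cvg x0; move/cvgrPdist_le => /(_ _ G2); apply: filterS => n /=.
  by move=> /(le_trans (ler_norm _)); lra.
have [n hn1 hn2] : exists2 n, (G x0 / 2 <= u n x0)%R &
    tsum (fun x => (f x * (H x * (G x - u n x) / G x))%:E) <= (2^-1)%:E.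
  have /filter_ex[n [h1 h2]] : \forall n \near \oo, (G x0 / 2 <= u n x0)%R /\
      tsum (fun x => (f x * (H x * (G x - u n x) / G x))%:E) <= (2^-1)%:E.
    by apply: filterI => //; exact: near_null.
  by exists n.
exists (fun x => f x + u n x)%R; split.
- by move=> x; rewrite addr_ge0 // u_ge0.
- exact: fsuppD.
- by rewrite -natr1 mulrDl mul1r lerD.
- apply: le_trans (Een_add_truncation n f0 hf) _.
  have -> : (k.+1%:R * (C + 1) = k%:R * (C + 1) + (C + 1) :> R)%R.
    by rewrite -(natr1 k) mulrDl mul1r.
  rewrite [leRHS]EFinD -addeA; apply: leeD => //.
  rewrite [leRHS]EFinD; apply: leeD => //.
  (* The mixed term is at most 1/2 and counts twice, whence the 1 added to [C] at each stage. *)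
  apply: (@le_trans _ _ (2%:E * (2^-1)%:E)); first by apply: lee_wpmul2l.
  by rewrite -EFinM mulfV.
Qed.

Lemma ground_state_critical (C : R) (w : T -> R) : (forall n, Een (u n) <= C%:E) ->
  (forall f, fsupp f -> tsum (fun x => (w x * f x ^+ 2)%:E) <= Qen f) ->
  (forall x, (H x / G x <= w x)%R) -> forall x, w x = (H x / G x)%R.
Proof.
move=> uC wQ Hw x0; apply/eqP; rewrite eq_le Hw andbT leNgt; apply/negP => lt.
pose del := (w x0 - H x0 / G x0)%R.
have del0 : (0 < del)%R by rewrite subr_gt0.
have G2 : (0 < G x0 / 2)%R by rewrite divr_gt0.
have C0 : (0 <= C)%R by rewrite -lee_fin; exact: le_trans (Een_ge0 _) (uC 0%N).
pose a := (del * (G x0 / 2) ^+ 2)%R.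
have a0 : (0 < a)%R by rewrite mulr_gt0 // exprn_gt0.
(* Then k a > C + 1, so that the gain of at least a k^2 at [x0] exceeds the energy, at most k (C +
   1). *)
pose k := (Num.truncn ((C + 1) / a)).+1.
have hk : ((C + 1) / a < k%:R)%R by exact: truncnS_gt.
have [f [f0 hf fk fE]] := linear_energy_growth x0 k uC.
have := wQ f hf; rewrite ground_state_representation ?fsupp_l2 // => h.
have h2 : (del * f x0 ^+ 2)%:E + Wen f <= Een f + Wen f.
  apply: le_trans h.
  have -> : (del * f x0 ^+ 2)%:E = tsum (fun x => if x == x0 then (del * f x0 ^+ 2)%:E else 0).
    rewrite (tsum_single (x := x0)) ?eqxx // => y.
      by case: ifP => // _; rewrite lee_fin mulr_ge0 ?sqr_ge0 // ltW.
    by move=> /negbTE ->.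
  rewrite /Wen -tsumD; last 2 first.
  - by move=> y; case: ifP => // _; rewrite lee_fin mulr_ge0 ?sqr_ge0 // ltW.
  - exact: Wterm_ge0.
  apply: le_tsum => x; case: eqP => [->|_].
    by rewrite -EFinD lee_fin /del le_eqVlt; apply/orP; left; apply/eqP; ring.
  by rewrite add0e lee_fin ler_wpM2r ?sqr_ge0.
move: h2; rewrite leeD2rE ?Wen_fin // => h2.
have {h2} := le_trans h2 fE; rewrite lee_fin leNgt => /negP; apply.
have k0 : (0 < k%:R :> R)%R by [].
apply: (@lt_le_trans _ _ (del * (k%:R * (G x0 / 2)) ^+ 2)%R).
  rewrite exprMn mulrCA -/a mulrA expr2 -!mulrA ltr_pM2l //.
  by move: hk; rewrite ltr_pdivrMr.
rewrite ler_pM2l // lerXn2r // nnegrE //.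
by rewrite mulr_ge0 // ltW.
Qed.

Hypothesis HG_fin : tsum (fun x => (H x * G x)%:E) < +oo.

Lemma HG_defect (e : R) : (0 < e)%R ->
  \forall n \near \oo, tsum (fun x => (H x * (G x - u n x))%:E) <= e%:E.
Proof.
move=> e0; apply: (@tsum_dominated _ _ _ (fun x => H x * G x)%R) => //.
  move=> n x; apply/andP; split; first by rewrite mulr_ge0 // subr_ge0.
  by rewrite ler_wpM2l // gerBl; exact: u_ge0.
move=> x; rewrite -(mulr0 (H x)); apply: cvgM; first exact: cvg_cst.
exact: u_defect_cvg0.
Qed.

Lemma Een_truncation_HG n :
  Een (u n) <= tsum (fun x => (H x * (G x - u n x))%:E).
Proof.
apply: le_trans (Een_truncation n) _; apply: le_tsum => x.
by rewrite lee_fin mulrC ler_wpM2r ?subr_ge0.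
Qed.

Lemma Een_sub_le f g : Een (fun x => f x - g x)%R <= 2%:E * (Een f + Een g).
Proof.
rewrite /Een -ge0_muleDr ?tsum_ge0 //; last 2 first.
- exact: Eterm_ge0.
- exact: Eterm_ge0.
rewrite muleCA; apply: lee_wpmul2l; first exact: half_ge0.
rewrite -tsumD; last 2 first.
- exact: Eterm_ge0.
- exact: Eterm_ge0.
rewrite -tsumZ //; last by move=> p; rewrite adde_ge0 ?Eterm_ge0.
apply: le_tsum => p; rewrite -EFinD -EFinM lee_fin -mulrDr [leRHS]mulrCA ler_wpM2l //.
  by rewrite mulr_ge0 // mulr_ge0 // Gge0.
rewrite !mulrBl; set a := (f p.1 / _)%R; set b := (g p.1 / _)%R.
set c := (f p.2 / _)%R; set e := (g p.2 / _)%R.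
have := sqr_ge0 ((a - c) + (b - e))%R; nra.
Qed.

Lemma fsuppB f g : fsupp f -> fsupp g -> fsupp (fun x => f x - g x)%R.
Proof.
move=> hf [s hs]; apply: fsuppD => //; exists s => x; rewrite oppr_eq0; exact: hs.
Qed.

Lemma Qen_lsc (v : nat -> T -> R) f (C : \bar R) :
  (forall x, v n x @[n --> \oo] --> f x) ->
  (\forall n \near \oo, Qen (v n) <= C) -> Qen f <= C.
Proof.
move=> vf vC.
have h2 : tsum (fun p => (K p.1 p.2 * (f p.1 - f p.2) ^+ 2)%:E) <= 2%:E * C.
  apply: (@tsum_lsc _ _ (fun n p => K p.1 p.2 * (v n p.1 - v n p.2) ^+ 2)%R).
  - by move=> n p; rewrite mulr_ge0 ?sqr_ge0.
  - move=> p; apply: cvgM; first exact: cvg_cst.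
    by rewrite expr2; under eq_fun do rewrite expr2; apply: cvgM; apply: cvgB.
  - apply: filterS vC => n h; have := lee_wpmul2l (_ : 0 <= 2%:E) h.
    by rewrite lee_fin => /(_ (ler0n _ 2)); rewrite /Qen muleA -EFinM mulfV // mul1e.
have := lee_wpmul2l half_ge0 h2.
by rewrite muleA -EFinM mulVf // mul1e.
Qed.

(** As [G] need not be square summable, the representation is applied to the finitely supported u_n
    - u_m, and m is sent to infinity by lower semicontinuity. The five parts of e are two energies,
    each doubled, and one weight term. *)
Lemma Qen_defect (e : R) : (0 < e)%R ->
  \forall n \near \oo, Qen (fun x => u n x - G x)%R <= e%:E.
Proof.
move=> e0; have e5 : (0 < e / 5)%R by rewrite divr_gt0.
have near5 := HG_defect e5.
near=> n.
have hn : tsum (fun x => (H x * (G x - u n x))%:E) <= (e / 5)%:E by near: n.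
apply: (@Qen_lsc (fun m x => u n x - u m x)%R).
  by move=> x; apply: cvgB; [exact: cvg_cst|exact: u_cvg].
near=> m.
have hm : tsum (fun x => (H x * (G x - u m x))%:E) <= (e / 5)%:E by near: m.
have nm : (n <= m)%N by near: m; exact: nbhs_infty_ge.
rewrite ground_state_representation; last by apply: fsupp_l2; exact: fsuppB.
rewrite (_ : e = 2 * (e / 5 + e / 5) + e / 5)%R; last by field.
rewrite EFinD; apply: leeD.
  apply: le_trans (Een_sub_le _ _) _.
  rewrite [(2 * _)%:E]EFinM [(e / 5 + e / 5)%:E]EFinD.
  apply: lee_wpmul2l => //; apply: leeD.
    exact: le_trans (Een_truncation_HG _) hn.
  exact: le_trans (Een_truncation_HG _) hm.
apply: le_trans hn; apply: le_tsum => x; rewrite lee_fin.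
rewrite -mulrA ler_wpM2l // ler_pdivrMl //.
have h1 := u_nd x nm; have h2 := uG m x; have h3 := u_ge0 n x.
have h4 := uG n x; have -> : (u n x - u m x = - (u m x - u n x))%R by ring.
by rewrite sqrrN expr2; apply: ler_pM; rewrite ?subr_ge0 //; lra.
Unshelve. all: end_near. Qed.

Lemma Qen_G_le : Qen G <= Wen G.
Proof.
have WG : Wen G = tsum (fun x => (H x * G x)%:E).
  apply: eq_tsum => x; congr EFin; have := Gneq0 x; move=> h; field; exact: h.
apply/lee_addgt0Pr => e e0; apply: (Qen_lsc u_cvg).
have := HG_defect e0; apply: filterS => n hn.
rewrite ground_state_representation ?fsupp_l2 // addeC; apply: leeD.
  apply: le_tsum => x; rewrite lee_fin ler_wpM2l ?divr_ge0 ?Gge0 //.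
  by rewrite lerXn2r ?nnegrE ?Gge0 // u_ge0.
exact: le_trans (Een_truncation_HG _) hn.
Qed.

End truncations.

(** Each phi_n satisfies the representation with equality and Q(phi_n) is eventually at most Q(v) +
    e; lower semicontinuity then keeps one inequality, which is enough to force E(v) = 0 when Q(v) =
    W(v) is finite. *)
Lemma Qen_energy_space (phi : nat -> T -> R) v :
  (forall n, fsupp (phi n)) -> (forall x, phi n x @[n --> \oo] --> v x) ->
  (forall e : R, (0 < e)%R ->
     \forall n \near \oo, Qen (fun x => phi n x - v x)%R <= e%:E) ->
  Een v + Wen v <= Qen v.
Proof.
move=> hphi phiv Qphi.
have [Qfin|] := boolP (Qen v \is a fin_num); last first.
  by rewrite ge0_fin_numE ?Qen_ge0 // -leNgt leye_eq => /eqP ->; rewrite leey.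
apply/lee_addgt0Pr => e e0.
pose q := fine (Qen v).
have q0 : (0 <= q)%R by rewrite fine_ge0 // Qen_ge0.
(* In (a + b)^2 <= (1 + del) a^2 + (1 + 1/del) b^2 this choice costs at most e/2 on Q(v); the 1
   added to q covers q = 0. *)
pose del := (e / (2 * (q + 1)))%R.
have del0 : (0 < del)%R by rewrite divr_gt0 // mulr_gt0 // ltr_wpDl.
have c0 : (0 < 1 + del^-1)%R by rewrite ltr_wpDr // invr_ge0 ltW.
pose e' := (e / (2 * (1 + del^-1)))%R.
have e'0 : (0 < e')%R by rewrite divr_gt0 // mulr_gt0.
have near_le : \forall n \near \oo, Qen (phi n) <= Qen v + e%:E.
  have := Qphi _ e'0; apply: filterS => n hn.
  have h : Qen (phi n) <= (1 + del)%:E * Qen v +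
      (1 + del^-1)%:E * Qen (fun x => phi n x - v x)%R.
    have CA (c : R) z : c%:E * ((2^-1)%:E * z) = (2^-1)%:E * (c%:E * z) by exact: muleCA.
    have Qd := @Qterm_ge0 (fun x => phi n x - v x)%R; have Qv := Qterm_ge0 v.
    have d1 : (0 <= 1 + del)%R by rewrite ltW // ltr_wpDr // ltW.
    have d2 : (0 <= 1 + del^-1)%R by exact: ltW.
    rewrite /Qen !CA -ge0_muleDr; [|by rewrite mule_ge0 ?tsum_ge0..].
    apply: lee_wpmul2l; first exact: half_ge0.
    rewrite -!tsumZ // -tsumD; [|by move=> p; rewrite mule_ge0..].
    apply: le_tsum => p; rewrite -!EFinM -EFinD lee_fin ![(_ * (K _ _ * _))%R]mulrCA.
    rewrite -mulrDr ler_wpM2l //.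
    set a := (v p.1 - v p.2)%R; set b := (phi n p.1 - v p.1 - (phi n p.2 - v p.2))%R.
    have -> : (phi n p.1 - phi n p.2 = a + b)%R by rewrite /a /b; ring.
    have d00 : del != 0%R by rewrite gt_eqF.
    have := sqr_ge0 (del * a - b)%R.
    rewrite -subr_ge0 => h.
    have -> : ((1 + del) * a ^+ 2 + (1 + del^-1) * b ^+ 2 - (a + b) ^+ 2 =
       del^-1 * ((del * a - b) ^+ 2))%R by field.
    by rewrite mulr_ge0 ?sqr_ge0 // invr_ge0 ltW.
  apply: le_trans h _.
  apply: (@le_trans _ _ ((1 + del)%:E * Qen v + (1 + del^-1)%:E * e'%:E)).
    by rewrite leeD2l // lee_wpmul2l // lee_fin ltW.
  rewrite -(fineK Qfin) -/q -!EFinM -!EFinD lee_fin.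
  have -> : ((1 + del^-1) * e' = e / 2)%R.
    have cn : (1 + del^-1 != 0)%R by rewrite gt_eqF.
    by rewrite /e'; move: (1 + del^-1)%R cn => c cn; field.
  have h1 : (del * q <= e / 2)%R.
    rewrite /del mulrAC ler_pdivrMr; last by rewrite mulr_gt0 // ltr_wpDl.
    by have := mulr_gt0 e0 ltr01; nra.
  lra.
pose gE (f : T -> R) p := (2^-1 * (K p.1 p.2 * (G p.1 * G p.2) *
   (f p.1 / G p.1 - f p.2 / G p.2) ^+ 2))%R.
have EE f : Een f = tsum (fun p => (gE f p)%:E).
  by rewrite /Een -tsumZ //; last exact: Eterm_ge0.
rewrite EE.
have sqc (z : nat -> R) (l : R) : z n @[n --> \oo] --> l -> (z n ^+ 2)%R @[n --> \oo] --> (l ^+ 2)%R.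
  by move=> zl; rewrite expr2; under eq_fun do rewrite expr2; apply: cvgM.
apply: (@tsum_lsc2 _ _ _ (fun n p => gE (phi n) p) (fun n x => H x / G x * phi n x ^+ 2)%R).
- move=> n p; rewrite mulr_ge0 ?invr_ge0 // -lee_fin; exact: Eterm_ge0.
- by move=> n x; rewrite -lee_fin; exact: Wterm_ge0.
- move=> p; apply: cvgM; first exact: cvg_cst.
  apply: cvgM; first exact: cvg_cst.
  apply: sqc; apply: cvgB; apply: cvgM; first exact: phiv.
  + exact: cvg_cst.
  + exact: phiv.
  + exact: cvg_cst.
- move=> x; apply: cvgM; first exact: cvg_cst.
  by apply: sqc; exact: phiv.
- apply: filterS near_le => n; rewrite ground_state_representation ?fsupp_l2 //.
  by rewrite EE.
Qed.

Lemma Een_eq0 v x y : Een v = 0 -> (0 < K x y)%R -> (v x / G x = v y / G y)%R.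
Proof.
move=> h kxy.
have t0 : tsum (fun p => (K p.1 p.2 * (G p.1 * G p.2) *
   (v p.1 / G p.1 - v p.2 / G p.2) ^+ 2)%:E) = 0.
  move/eqP : h; rewrite /Een mule_eq0 => /orP[|/eqP //].
  by rewrite eqe invr_eq0 pnatr_eq0.
have := tsum_ge1 (x, y) (Eterm_ge0 v); rewrite t0 /= lee_fin => hle.
have c0 : (0 < K x y * (G x * G y))%R by rewrite mulr_gt0 // mulr_gt0.
move: hle; rewrite pmulr_rle0 // => hle.
have : ((v x / G x - v y / G y) ^+ 2 == 0)%R by rewrite eq_le hle sqr_ge0.
by rewrite sqrf_eq0 subr_eq0 => /eqP.
Qed.

End ground_state.

(** * Heat kernel bounds *)

Lemma nwalks0 d (x : Zd d) : nwalks 0 x = (x == 0).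
Proof. by []. Qed.

(** * Factorisation of the heat kernel over a product of lattices *)

Section product_walks.
Arguments nwalks : simpl never.
Variables d1 d2 : nat.

Lemma unitv_lshift i : unitv (lshift d2 i) = row_mx (unitv i : Zd d1) 0.
Proof.
apply/rowP => j; rewrite !mxE; case: splitP => k jk; rewrite !mxE.
  by rewrite (_ : j = lshift d2 k) ?(inj_eq (@lshift_inj _ _)) //; apply: val_inj.
rewrite (_ : j = rshift d1 k); last by apply: val_inj.
by rewrite eq_lrshift.
Qed.

Lemma unitv_rshift i : unitv (rshift d1 i) = row_mx 0 (unitv i : Zd d2).
Proof.
apply/rowP => j; rewrite !mxE; case: splitP => k jk; rewrite !mxE.
  rewrite (_ : j = lshift d2 k); last by apply: val_inj.
  by rewrite eq_rlshift.
by rewrite (_ : j = rshift d1 k) ?(inj_eq (@rshift_inj _ _)) //; apply: val_inj.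
Qed.

(** The binomial coefficient counts the choices of the j steps made in the first block; the
    induction is Pascal's rule. *)
Lemma nwalks_row n (a : Zd d1) (b : Zd d2) :
  nwalks n (row_mx a b) = (\sum_(j < n.+1) 'C(n, j) * (nwalks j a * nwalks (n - j) b))%N.
Proof.
elim: n a b => [|n IH] a b.
  rewrite big_ord1 bin0 mul1n /= !nwalks0 -[in LHS](row_mx0 int 1 d1 d2).
  suff -> : (row_mx a b == row_mx 0 0) = (a == 0) && (b == 0) by case: (a == 0); case: (b == 0).
  by apply/eqP/andP => [/eq_row_mx[-> ->]|[/eqP -> /eqP ->]].
rewrite nwalksS big_split_ord /=.
transitivity ((\sum_(j < n.+1) 'C(n, j) * (nwalks j.+1 a * nwalks (n - j) b)) +
              (\sum_(j < n.+1) 'C(n, j) * (nwalks j a * nwalks (n.+1 - j) b)))%N.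
  congr (_ + _)%N.
    transitivity (\sum_(i < d1) \sum_(j < n.+1) 'C(n, j) *
        ((nwalks j (a - unitv i)%R + nwalks j (a + unitv i)%R) * nwalks (n - j) b))%N.
      apply: eq_bigr => i _; rewrite unitv_lshift opp_row_mx !add_row_mx oppr0 addr0 !IH.
      by rewrite -big_split /=; apply: eq_bigr => j _; rewrite mulnDl mulnDr.
    rewrite exchange_big /=; apply: eq_bigr => j _.
    by rewrite -big_distrr /= -big_distrl.
  transitivity (\sum_(i < d2) \sum_(j < n.+1) 'C(n, j) *
      (nwalks j a * (nwalks (n - j) (b - unitv i)%R + nwalks (n - j) (b + unitv i)%R)))%N.
    apply: eq_bigr => i _; rewrite unitv_rshift opp_row_mx !add_row_mx oppr0 addr0 !IH.
    by rewrite -big_split /=; apply: eq_bigr => j _; rewrite mulnDr mulnDr.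
  rewrite exchange_big /=; apply: eq_bigr => j _.
  rewrite -big_distrr /= -big_distrr /=; congr (_ * (_ * _))%N.
  by rewrite subSn // -ltnS.
rewrite [RHS]big_ord_recl /= bin0 mul1n subn0.
under [in RHS]eq_bigr => i _ do rewrite /bump /= add1n binS subSS mulnDl.
rewrite big_split /= [X in (_ = _ + X)%N]addnC addnCA; congr (_ + _)%N.
rewrite big_ord_recl /= bin0 mul1n subn0; congr (_ + _)%N.
rewrite [RHS]big_ord_recr /= bin_small // mul0n addn0.
by apply: eq_bigr => i _; rewrite /bump /= add1n.
Qed.

End product_walks.

Section product_heat.
Variables (R : realType) (d1 d2 : nat).
Hypothesis d10 : (0 < d1)%N.
Hypothesis d20 : (0 < d2)%N.

(** A binomial convolution of counts is a product of exponential generating functions, and the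
    normalising exponentials multiply as [deg] is additive in the dimension. *)
Lemma heat_row (t : R) (a : Zd d1) (b : Zd d2) : 0 <= t ->
  heat t (row_mx a b : Zd (d1 + d2)) = heat t a * heat t b.
Proof.
move=> t0; apply: EFin_inj.
have d0 : (0 < d1 + d2)%N by rewrite addn_gt0 d10.
have ge0 d (x : Zd d) n : (0 <= (expR (- (@deg R d * t)) * (t ^+ n / n`!%:R * (nwalks n x)%:R))%:E)%E.
  by rewrite lee_fin mulr_ge0 ?expR_ge0 // mulr_ge0 // divr_ge0 // exprn_ge0.
have H2 := heat_series d20 b t0.
rewrite [(heat t a * heat t b)%:E]EFinM (heat_series d10 a t0).
transitivity (tsum (fun m => tsum (fun n =>
   (expR (- (@deg R d1 * t)) * (t ^+ m / m`!%:R * (nwalks m a)%:R) *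
    (expR (- (@deg R d2 * t)) * (t ^+ n / n`!%:R * (nwalks n b)%:R)))%:E))).
  rewrite tsum_diag; last by move=> m n; rewrite EFinM mule_ge0.
  rewrite heat_series //; apply: eq_tsum => n.
  rewrite nwalks_row natr_sum sumEFin; congr EFin.
  have -> : expR (- (@deg R (d1 + d2) * t)) = expR (- (@deg R d1 * t)) * expR (- (@deg R d2 * t)).
    by rewrite -expRD !degE natrD; congr expR; ring.
  rewrite mulr_sumr mulr_sumr; apply: eq_bigr => j _.
  have jn : (j <= n)%N by rewrite -ltnS.
  rewrite !natrM -(bin_fact jn) !natrM.
  rewrite -{1}(subnKC jn) exprD.
  have h1 : j`!%:R != 0 :> R by rewrite pnatr_eq0 -lt0n fact_gt0.
  have h2 : (n - j)`!%:R != 0 :> R by rewrite pnatr_eq0 -lt0n fact_gt0.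
  have h3 : 'C(n, j)%:R != 0 :> R by rewrite pnatr_eq0 -lt0n bin_gt0.
  by field; rewrite h1 h2 h3.
under eq_tsum => m.
  under eq_tsum do rewrite EFinM.
  rewrite tsumZ //; last by rewrite -lee_fin.
  rewrite -H2 muleC.
  over.
rewrite tsumZ ?heat_ge0 //.
by rewrite muleC.
Qed.

End product_heat.

(** * Two-sided heat kernel bounds in dimension one *)

Section one_dimensional_heat.
Arguments nwalks : simpl never.
Variable R : realType.
Implicit Types (x y : Zd 1) (t : R) (n j k m : nat).

(** The index i counts the steps to the right, so that x = 2i - n. *)
Lemma nwalks_dim1 n x :
  nwalks n x = (\sum_(i < n.+1) 'C(n, i) * (x ord0 ord0 + n%:Z == (i.*2)%:Z)%R)%N.
Proof.
elim: n x => [|n IH] x.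
  rewrite big_ord1 bin0 mul1n /= nwalks0 addr0; congr nat_of_bool.
  apply/eqP/eqP => [->|x0]; first by rewrite mxE.
  by apply/rowP => i; rewrite (ord1 i) mxE.
rewrite nwalksS big_ord1 !IH.
have e1 i : ((x - unitv ord0) ord0 ord0 + n%:Z == (i.*2)%:Z)%R =
            (x ord0 ord0 + n.+1%:Z == (i.+1.*2)%:Z)%R.
  have -> : (x - unitv ord0) ord0 ord0 = x ord0 ord0 - 1 by rewrite !mxE eqxx.
  by apply/eqP/eqP; lia.
have e2 i : ((x + unitv ord0) ord0 ord0 + n%:Z == (i.*2)%:Z)%R =
            (x ord0 ord0 + n.+1%:Z == (i.*2)%:Z)%R.
  have -> : (x + unitv ord0) ord0 ord0 = x ord0 ord0 + 1 by rewrite !mxE eqxx.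
  by apply/eqP/eqP; lia.
under eq_bigr do rewrite e1.
under [X in (_ + X)%R]eq_bigr do rewrite e2.
rewrite [RHS]big_ord_recl /= bin0.
under [in RHS]eq_bigr => i _ do rewrite /bump /= add1n binS mulnDl.
rewrite big_split /= [X in (_ = _ + X)%N]addnC addnCA; congr (_ + _)%N.
rewrite [LHS]big_ord_recl /= bin0; congr (_ + _)%N.
rewrite [RHS]big_ord_recr /= bin_small // mul0n addn0.
by apply: eq_bigr => i _; rewrite /bump /= add1n.
Qed.

(** The terms of the modified Bessel function I_k(2t). *)
Definition bess t k j : R := t ^+ (j.*2 + k) / (j`!%:R * (j + k)`!%:R).

Lemma bess_ge0 t k j : 0 <= t -> 0 <= bess t k j.
Proof. by move=> t0; rewrite divr_ge0 ?exprn_ge0 // mulr_ge0. Qed.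

Lemma tsum_inj (e : nat -> nat) (f : nat -> \bar R) : injective e ->
  (forall n, 0 <= f n)%E -> (forall n, (forall j, n <> e j) -> f n = 0) ->
  tsum f = tsum (fun j => f (e j)).
Proof.
move=> einj f0 fe; rewrite /tsum (esumID (range e)); last by move=> n _; exact: f0.
rewrite setTI esum_image; last by move=> i j _ _; exact: einj.
rewrite [X in (_ + X)%E]esum1 ?adde0 // => n [_ h]; apply: fe => j nj; apply: h.
by exists j.
Qed.

Lemma tsum_inj_le (e : nat -> nat) (f : nat -> \bar R) : injective e ->
  (forall n, 0 <= f n)%E -> (tsum (fun j => f (e j)) <= tsum f)%E.
Proof.
move=> einj f0; rewrite [leRHS]/tsum (esumID (range e)); last by move=> n _; exact: f0.
rewrite setTI esum_image; last by move=> i j _ _; exact: einj.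
by rewrite leeDl // esum_ge0.
Qed.

Lemma heat_bess t k x : 0 <= t -> x ord0 ord0 = k%:Z ->
  (heat t x)%:E = ((expR (- (2 * t)))%:E * tsum (fun j => (bess t k j)%:E))%E.
Proof.
move=> t0 xk; rewrite heat_series // degE mulr1.
have inj : injective (fun j => (j.*2 + k)%N).
  by move=> i j /addIn /double_inj.
rewrite (@tsum_inj (fun j => (j.*2 + k)%N)) //; last 2 first.
- by move=> n; rewrite lee_fin mulr_ge0 ?expR_ge0 // mulr_ge0 // divr_ge0 // exprn_ge0.
- move=> n hn; rewrite nwalks_dim1 big1 ?mulr0 //= => i _.
  case: eqP => [h|]; last by rewrite muln0.
  have [i0|i0] := ltnP i k.
    have : (n < i)%N by move: h; rewrite xk; lia.
    by move=> ni; have := ltn_ord i; rewrite ltnS leqNgt ni.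
  case: (hn (i - k)%N); move: h; rewrite xk; lia.
rewrite -tsumZ ?expR_ge0 //; last by move=> j; rewrite lee_fin bess_ge0.
apply: eq_tsum => j; rewrite -EFinM; congr (_ * _)%:E.
have hj : (j + k < (j.*2 + k).+1)%N by rewrite ltnS leq_add2r -addnn leq_addr.
rewrite nwalks_dim1 (bigD1 (Ordinal hj)) //= big1 ?addn0; last first.
  move=> i /eqP ij; case: eqP => [h|]; last by rewrite muln0.
  by case: ij; apply: val_inj => /=; move: h; rewrite xk; lia.
rewrite (_ : (_ == _)%R = true) ?muln1; last by apply/eqP; rewrite xk; lia.
have hle : (j + k <= j.*2 + k)%N by rewrite -ltnS.
rewrite -(bin_fact hle) natrM natrM /bess.
have -> : (j.*2 + k - (j + k) = j)%N by lia.
have h1 : j`!%:R != 0 :> R by rewrite pnatr_eq0 -lt0n fact_gt0.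
have h2 : (j + k)`!%:R != 0 :> R by rewrite pnatr_eq0 -lt0n fact_gt0.
have h3 : 'C(j.*2 + k, j + k)%:R != 0 :> R by rewrite pnatr_eq0 -lt0n bin_gt0.
by field; rewrite h1 h2 h3.
Qed.

(* Termwise, by AM-GM: the middle one of three consecutive terms. *)
Lemma bess_amgm t k j : 0 < t -> bess t k.+1 j <= 2^-1 * (bess t k j + bess t k j.+1).
Proof.
move=> t0; rewrite /bess doubleS !addnS !addSn !factS !natrM !exprS.
set T := t ^+ _; set a := j.+1%:R; set b := (j + k).+1%:R.
have a0 : 0 < a :> R by rewrite ltr0n.
have ab : a <= b by rewrite ler_nat ltnS leq_addr.
have b0 : 0 < b by exact: lt_le_trans ab.
have h1 : 0 < j`!%:R :> R by rewrite ltr0n fact_gt0.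
have h2 : 0 < (j + k)`!%:R :> R by rewrite ltr0n fact_gt0.
have T0 : 0 < T by rewrite exprn_gt0.
move: (j`!%:R) ((j + k)`!%:R) h1 h2 => u v u0 v0.
rewrite -subr_ge0.
have -> : 2^-1 * (T / (u * v) + t * (t * T) / (a * u * (b * v))) - t * T / (u * (b * v)) =
   T / (u * v) * 2^-1 * (1 - 2 * (t / b) + t ^+ 2 / (a * b)).
  by field; rewrite ?gt_eqF.
apply: mulr_ge0.
  by rewrite mulr_ge0 ?invr_ge0 // divr_ge0 ?ltW // mulr_gt0.
have h : (t / b) ^+ 2 <= t ^+ 2 / (a * b).
  rewrite expr_div_n ler_pM2l ?exprn_gt0 // lef_pV2 ?posrE ?mulr_gt0 ?exprn_gt0 //.
  by rewrite expr2 ler_pM2r.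
move: (t / b) (t ^+ 2 / (a * b)) h => z w h.
by have := sqr_ge0 (1 - z); rewrite sqrrB expr1n mul1r mulr2n; lra.
Qed.

Lemma bess_nonincr t k : 0 < t ->
  (tsum (fun j => (bess t k.+1 j)%:E) <= tsum (fun j => (bess t k j)%:E))%E.
Proof.
move=> t0.
have B0 n j : (0 <= (bess t n j)%:E)%E by rewrite lee_fin bess_ge0 // ltW.
apply: (@le_trans _ _ (tsum (fun j => (2^-1)%:E * ((bess t k j)%:E + (bess t k j.+1)%:E))%E)).
  by apply: le_tsum => j; rewrite -EFinD -EFinM lee_fin bess_amgm.
rewrite tsumZ ?invr_ge0 //; last by move=> j; rewrite adde_ge0.
rewrite tsumD //.
have h : (tsum (fun j => (bess t k j.+1)%:E) <= tsum (fun j => (bess t k j)%:E))%E.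
  exact: (@tsum_inj_le S (fun j => (bess t k j)%:E) succn_inj).
apply: (@le_trans _ _ ((2^-1)%:E * (tsum (fun j => (bess t k j)%:E) + tsum (fun j => (bess t k j)%:E)))%E).
  apply: lee_wpmul2l; first by rewrite lee_fin invr_ge0.
  by rewrite leeD2l.
have : (0 <= tsum (fun j => (bess t k j)%:E))%E by exact: tsum_ge0.
case: (tsum _) => [r _|_|//]; last by rewrite leey.
by rewrite -EFinD -EFinM !lee_fin; lra.
Qed.

Lemma heatN d (t : R) (y : Zd d) : heat t (- y) = heat t y.
Proof. by rewrite /heat; under eq_eseriesr do rewrite nwalksN. Qed.

Lemma heat1_abs t x y : `|x ord0 ord0| = `|y ord0 ord0| -> heat t x = heat t y.
Proof.
move=> h; have [e|e] : x = y \/ x = - y; last 2 first.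
- by rewrite e.
- by rewrite e heatN.
have [e|e] : x ord0 ord0 = y ord0 ord0 \/ x ord0 ord0 = - y ord0 ord0 by lia.
- by left; apply/rowP => i; rewrite (ord1 i).
- by right; apply/rowP => i; rewrite (ord1 i) mxE.
Qed.

Lemma heat1_nonincr t x y : 0 < t -> `|x ord0 ord0| <= `|y ord0 ord0| ->
  heat t y <= heat t x.
Proof.
move=> t0 h; pose c (k : nat) : Zd 1 := const_mx k%:Z.
have c00 k : c k ord0 ord0 = k%:Z by rewrite mxE.
have nn : {homo (fun k => heat t (c k)) : m n / (m <= n)%N >-> n <= m}.
  apply: homo_leq => [//|a b e ba eb|k]; first exact: le_trans eb ba.
  rewrite -lee_fin !(heat_bess (ltW t0) (c00 _)).
  by apply: lee_wpmul2l; [rewrite lee_fin expR_ge0|exact: bess_nonincr].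
have ex : heat t x = heat t (c `|x ord0 ord0|%N) by apply: heat1_abs; rewrite c00; lia.
have ey : heat t y = heat t (c `|y ord0 ord0|%N) by apply: heat1_abs; rewrite c00; lia.
by rewrite ex ey; apply: (nn `|x ord0 ord0|%N `|y ord0 ord0|%N); lia.
Qed.

(** The induction step is 4(2j+1)(2j+3) <= 16(j+1)^2. In integers, this is the bound (2j+1)^(-1/2)
    on the probability that a walk of 2j steps returns. *)
Lemma central_bin_le j : ('C(j.*2, j) ^ 2 * j.*2.+1 <= 16 ^ j)%N.
Proof.
elim: j => [//|j IH].
have e : (j.+1 * 'C(j.+1.*2, j.+1) = 2 * j.*2.+1 * 'C(j.*2, j))%N.
  apply/eqP; rewrite -(eqn_pmul2l (ltn0Sn j)); apply/eqP.
  rewrite doubleS; have /= := mul_bin_diag j.*2.+2 j.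
  have -> : 'C(j.*2.+1, j) = 'C(j.*2.+1, j.+1).
    by rewrite -bin_sub; [congr 'C(_, _); lia|lia].
  by have /= := mul_bin_diag j.*2.+1 j; nia.
rewrite -(leq_pmul2l (_ : 0 < j.+1 ^ 2)%N) ?expn_gt0 //.
rewrite mulnA -expnMn e [(16 ^ j.+1)%N]expnS; move: IH; move: ('C(j.*2, j)) (16 ^ j)%N => c p IH.
apply: (@leq_trans ((4 * j.*2.+1 * j.+1.*2.+1) * (c ^ 2 * j.*2.+1))).
  by rewrite leq_eqVlt; apply/orP; left; apply/eqP; rewrite !expnS !expn0; lia.
apply: leq_trans (leq_mul (leqnn _) IH) _; rewrite [leqRHS]mulnA leq_mul //.
by rewrite !expnS expn0 muln1; lia.
Qed.

(** The return probability, at most (2j+1)^(-1/2), is linearised as (c + 1/(c(2j+1)))/2 with c =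
    (2t)^(-1/2), the balance point because 2j concentrates near 2t. Extended from even to all n, the
    sum is explicit, and each half contributes at most c e^(2t)/2. *)
Lemma heat1_le t : 0 < t -> heat t (0 : Zd 1) <= (Num.sqrt (2 * t))^-1.
Proof.
move=> t0; have t2 : 0 < 2 * t by rewrite mulr_gt0.
set c := (_ ^-1); have c0 : 0 < c by rewrite invr_gt0 sqrtr_gt0.
have c2 : c ^+ 2 = (2 * t)^-1 by rewrite exprVn sqr_sqrtr // ltW.
pose g n := (2 * t) ^+ n / n`!%:R * (2^-1 * (c + (c * n.+1%:R)^-1)).
have g0 n : 0 <= g n.
  rewrite mulr_ge0 ?divr_ge0 ?exprn_ge0 ?(ltW t2) // mulr_ge0 ?invr_ge0 //.
  by rewrite addr_ge0 ?invr_ge0 ?mulr_ge0 // ltW.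
have bg j : bess t 0 j <= g j.*2.
  rewrite /bess addn0 addn0 /g.
  have h1 : 0 < j`!%:R :> R by rewrite ltr0n fact_gt0.
  have h2 : 0 < (j.*2)`!%:R :> R by rewrite ltr0n fact_gt0.
  have hb : ('C(j.*2, j) * (j`! * j`!) = (j.*2)`!)%N.
    by have := @bin_fact j.*2 j; rewrite -addnn addnK; apply; rewrite leq_addr.
  set y : R := 'C(j.*2, j)%:R / 4 ^+ j.
  have -> : t ^+ j.*2 / (j`!%:R * j`!%:R) = (2 * t) ^+ j.*2 / (j.*2)`!%:R * y.
    rewrite -hb !natrM exprMn /y -[in (2 ^+ j.*2)]muln2 mulnC exprM.
    have -> : (2 ^+ 2 : R) = 4 by rewrite expr2 -natrM.
    have h3 : 'C(j.*2, j)%:R != 0 :> R by rewrite pnatr_eq0 -lt0n bin_gt0 -addnn leq_addr.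
    have h4 : (4 : R) ^+ j != 0 by rewrite expf_neq0.
    by field; rewrite h3 h4 gt_eqF.
  apply: ler_wpM2l; first by rewrite divr_ge0 ?exprn_ge0 // ltW.
  have hy : y ^+ 2 * j.*2.+1%:R <= 1.
    rewrite /y expr_div_n mulrAC ler_pdivrMr ?exprn_gt0 // mul1r.
    rewrite -exprM mulnC exprM (_ : (4 ^+ 2 : R) = 16); last by rewrite expr2 -natrM.
    by rewrite -!natrX -natrM ler_nat central_bin_le.
  have n0 : 0 < j.*2.+1%:R :> R by [].
  have hy2 : y ^+ 2 <= j.*2.+1%:R^-1 by rewrite -[leRHS]mul1r ler_pdivlMr.
  rewrite invfM; move: (j.*2.+1%:R^-1) hy2 => z hz.
  have hc : c * (c + c^-1 * z) = c ^+ 2 + z by field; rewrite gt_eqF.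
  rewrite -(ler_pM2l c0) [leRHS]mulrCA hc.
  have := sqr_ge0 (c - y); rewrite sqrrB mulr2n; lra.
rewrite -lee_fin (heat_bess (k := 0) (ltW t0)); last by rewrite mxE.
have h1 : (tsum (fun j => (bess t 0 j)%:E) <= tsum (fun n => (g n)%:E))%E.
  apply: (@le_trans _ _ (tsum (fun j => (g j.*2)%:E))).
    by apply: le_tsum => j; rewrite lee_fin.
  exact: (@tsum_inj_le double (fun n => (g n)%:E) double_inj).
have h2 : (tsum (fun n => (g n)%:E) <= (c * expR (2 * t))%:E)%E.
  have e0 n : 0 <= (2 * t) ^+ n / n`!%:R by rewrite divr_ge0 ?exprn_ge0 // ltW.
  have e1 n : 0 <= (2 * t) ^+ n / n.+1`!%:R by rewrite divr_ge0 ?exprn_ge0 // ltW.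
  have -> : tsum (fun n => (g n)%:E) = ((2^-1 * c)%:E * tsum (fun n => ((2 * t) ^+ n / n`!%:R)%:E) +
      (2^-1 / c)%:E * tsum (fun n => ((2 * t) ^+ n / n.+1`!%:R)%:E))%E.
    rewrite -!tsumZ; last 4 first.
    - by rewrite divr_ge0 ?invr_ge0 // ltW.
    - by move=> n; rewrite lee_fin.
    - by rewrite mulr_ge0 ?invr_ge0 // ltW.
    - by move=> n; rewrite lee_fin.
    rewrite -tsumD; last 2 first.
    - by move=> n; rewrite -EFinM lee_fin mulr_ge0 // mulr_ge0 ?invr_ge0 // ltW.
    - by move=> n; rewrite -EFinM lee_fin mulr_ge0 // divr_ge0 ?invr_ge0 // ltW.
    apply: eq_tsum => n; rewrite -!EFinM -EFinD; congr EFin.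
    rewrite /g factS natrM.
    have n1 : n.+1%:R != 0 :> R by rewrite pnatr_eq0.
    have nf : n`!%:R != 0 :> R by rewrite pnatr_eq0 -lt0n fact_gt0.
    by move: (n.+1%:R) n1 (n`!%:R) nf => a ha b hb; field; rewrite ha hb gt_eqF.
  rewrite tsum_expR ?(ltW t2) //.
  have h3 : (tsum (fun n => ((2 * t) ^+ n / n.+1`!%:R)%:E) <= (c ^+ 2 * expR (2 * t))%:E)%E.
    have -> : tsum (fun n => ((2 * t) ^+ n / n.+1`!%:R)%:E) =
        ((c ^+ 2)%:E * tsum (fun n => ((2 * t) ^+ n.+1 / n.+1`!%:R)%:E))%E.
      rewrite -tsumZ ?sqr_ge0 //; last by move=> n; rewrite lee_fin divr_ge0 ?exprn_ge0 // ltW.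
      apply: eq_tsum => n; rewrite -EFinM c2 exprS; congr EFin.
      have nf : n.+1`!%:R != 0 :> R by rewrite pnatr_eq0 -lt0n fact_gt0.
      by field; rewrite nf gt_eqF.
    rewrite [leRHS]EFinM; apply: lee_wpmul2l; first by rewrite lee_fin sqr_ge0.
    rewrite -tsum_expR ?(ltW t2) //.
    by apply: (@tsum_inj_le S (fun n => ((2 * t) ^+ n / n`!%:R)%:E) succn_inj) => n; rewrite lee_fin.
  rewrite (_ : c * expR (2 * t) = 2^-1 * c * expR (2 * t) + 2^-1 / c * (c ^+ 2 * expR (2 * t))).
    rewrite [leRHS]EFinD [X in (_ <= X + _)%E]EFinM leeD2l // [leRHS]EFinM; apply: lee_wpmul2l => //.
    by rewrite lee_fin divr_ge0 ?invr_ge0 // ltW.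
  by field; rewrite gt_eqF.
apply: le_trans (lee_wpmul2l _ (le_trans h1 h2)) _; first by rewrite lee_fin expR_ge0.
by rewrite -EFinM lee_fin expRN mulrCA mulVf ?mulr1 // gt_eqF // expR_gt0.
Qed.

Lemma tsum_heat d t : (0 < d)%N -> 0 <= t -> tsum (fun x : Zd d => (heat t x)%:E) = 1%E.
Proof.
move=> d0 t0; have l0 := lam_gt0 R d0.
have lt0 : 0 <= @deg R d * t by rewrite mulr_ge0 // ltW.
transitivity (tsum (fun x : Zd d => tsum (fun n =>
    (expR (- (deg R d * t)) * ((deg R d * t) ^+ n / n`!%:R) * wk R n x)%:E))).
  apply: eq_tsum => x; rewrite heat_series //; apply: eq_tsum => n; congr EFin.
  by rewrite nwalksE // [(deg R d * t) ^+ n]exprMn; ring.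
have e0 n : 0 <= expR (- (deg R d * t)) * ((deg R d * t) ^+ n / n`!%:R).
  by rewrite mulr_ge0 ?expR_ge0 // divr_ge0 // exprn_ge0.
rewrite tsum_exchange; last by move=> x n; rewrite lee_fin mulr_ge0 // wk_ge0.
under eq_tsum => n.
  under eq_tsum do rewrite EFinM.
  rewrite tsumZ //; last by move=> x; exact: wk_ge0e.
  rewrite tsum_wk // mule1 EFinM.
  over.
rewrite tsumZ ?expR_ge0 //; last by move=> n; rewrite lee_fin divr_ge0 // exprn_ge0.
by rewrite tsum_expR // -EFinM -expRD addNr expR0.
Qed.

Definition coord x : R := (x ord0 ord0)%:~R.

Lemma coordD x : coord (x + unitv ord0) = coord x + 1.
Proof. by rewrite /coord !mxE eqxx intrD. Qed.

Lemma coordB x : coord (x - unitv ord0) = coord x - 1.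
Proof. by rewrite /coord !mxE eqxx intrB. Qed.

Lemma wk_second_moment n : tsum (fun x : Zd 1 => (wk R n x * coord x ^+ 2)%:E) = n%:R%:E.
Proof.
have t0 m y x : (0 <= (wk R m x * coord y ^+ 2)%:E)%E.
  by rewrite lee_fin mulr_ge0 ?wk_ge0 // sqr_ge0.
elim: n => [|n IH].
  rewrite tsum_eq0 // => x; rewrite wk0; case: eqP => [->|_]; last by rewrite mul0r.
  by rewrite /coord mxE expr0n mulr0.
rewrite tsum_wkS //; last by move=> x; exact: sqr_ge0.
rewrite big_ord1 -tsumD //.
transitivity ((deg R 1)^-1%:E * tsum (fun x : Zd 1 =>
   2%:E * ((wk R n x * coord x ^+ 2)%:E + (wk R n x)%:E)))%E.
  congr (_ * _)%E; apply: eq_tsum => x; rewrite coordD coordB -!EFinD -EFinM.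
  congr EFin; ring.
rewrite tsumZ //; last by move=> x; rewrite adde_ge0 // wk_ge0e.
rewrite tsumD //; last by move=> x; exact: wk_ge0e.
rewrite IH tsum_wk // -EFinD natr1 -!EFinM degE mulr1 mulrA mulVf ?mul1r //.
Qed.

Lemma heat1_second_moment t : 0 <= t ->
  tsum (fun x : Zd 1 => (heat t x * coord x ^+ 2)%:E) = (2 * t)%:E.
Proof.
move=> t0.
have lt0 : 0 <= deg R 1 * t by rewrite degE mulr1 mulr_ge0.
pose w n : R := expR (- (deg R 1 * t)) * ((deg R 1 * t) ^+ n / n`!%:R).
have w0 n : 0 <= w n by rewrite mulr_ge0 ?expR_ge0 // divr_ge0 // exprn_ge0.
transitivity (tsum (fun x : Zd 1 => tsum (fun n => (w n * (wk R n x * coord x ^+ 2))%:E))).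
  apply: eq_tsum => x; rewrite mulrC EFinM heat_series // -tsumZ ?sqr_ge0 //; last first.
    by move=> n; rewrite lee_fin mulr_ge0 ?expR_ge0 // mulr_ge0 // divr_ge0 // exprn_ge0.
  apply: eq_tsum => n; rewrite -EFinM; congr EFin.
  by rewrite nwalksE // /w [(deg R 1 * t) ^+ n]exprMn; ring.
have t1 n x : 0 <= wk R n x * coord x ^+ 2 by rewrite mulr_ge0 ?wk_ge0 // sqr_ge0.
rewrite tsum_exchange; last by move=> x n; rewrite lee_fin mulr_ge0.
under eq_tsum => n.
  under eq_tsum do rewrite EFinM.
  rewrite tsumZ //; last by move=> x; rewrite lee_fin.
  rewrite wk_second_moment -EFinM.
  over.
rewrite tsum_natS; last 2 first.
- by move=> n; rewrite lee_fin mulr_ge0.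
- by rewrite mulr0.
transitivity (tsum (fun n => (expR (- (deg R 1 * t)) * (deg R 1 * t))%:E *
    ((deg R 1 * t) ^+ n / n`!%:R)%:E)%E).
  apply: eq_tsum => n; rewrite -EFinM /w exprS factS natrM; congr EFin.
  have n1 : n.+1%:R != 0 :> R by rewrite pnatr_eq0.
  have nf : n`!%:R != 0 :> R by rewrite pnatr_eq0 -lt0n fact_gt0.
  by move: (n.+1%:R) n1 (n`!%:R) nf => a ha b hb; field; rewrite ha hb.
rewrite tsumZ; last 2 first.
- by rewrite mulr_ge0 ?expR_ge0.
- by move=> n; rewrite lee_fin divr_ge0 // exprn_ge0.
rewrite tsum_expR // -EFinM mulrAC -expRD addNr expR0 mul1r degE mulr1 //.
Qed.

Lemma tsum_interval m :
  (tsum (fun x : Zd 1 => if (`|x ord0 ord0| <= m%:Z)%R then 1 else 0 : \bar R) <= (2 * m + 1)%:R%:E)%E.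
Proof.
pose c (k : nat) : Zd 1 := const_mx (k%:Z - m%:Z).
rewrite (tsum_seq (s := [seq c k | k <- iota 0 (2 * m + 1)])); first last.
- move=> x hx; case: ifP => // h; case/negP: hx; apply/mapP.
  have hz : forall z : int, (`|z| <= m%:Z)%R -> (`|(z + m%:Z)%R| < 2 * m + 1)%N /\ (z = `|(z + m%:Z)%R|%N%:Z - m%:Z)%R.
    by move=> z hz; split; lia.
  have [e1 e2] := hz _ h.
  exists `|(x ord0 ord0 + m%:Z)%R|%N; first by rewrite mem_iota.
  by apply/rowP => i; rewrite (ord1 i) mxE.
- rewrite map_inj_uniq ?iota_uniq // => k l /rowP/(_ ord0); rewrite !mxE; lia.
- by move=> x; case: ifP.
rewrite big_map; apply: (@le_trans _ _ (\sum_(k <- iota 0 (2 * m + 1)) (1 : \bar R))%E).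
  by apply: lee_sum => k _; case: ifP.
rewrite sumEFin lee_fin big_const_seq count_predT size_iota iter_addr_0.
by rewrite -mulr_natl mulr1.
Qed.

(** The total mass 1 is split at distances m and L, with L about 2 sqrt t. By Chebyshev's inequality
    with variance 2t, at most 1/2 lies beyond L; by [heat1_le] and the hypothesis on t, at most 1/4
    lies within m. The rest, at least 1/4, sits on at most 5 sqrt t points, where by monotonicity
    the kernel is at most its value at m. *)
Lemma heat1_ge t m x : 8 * (2 * m + 1)%:R ^+ 2 <= t ->
  (`|x ord0 ord0| <= m%:Z)%R -> (20 * Num.sqrt t)^-1 <= heat t x.
Proof.
move=> tm xm.
have m1 : 1 <= (2 * m + 1)%:R :> R by rewrite ler1n addn1.
have t8 : 8 <= t by apply: le_trans tm; rewrite ler_peMr // expr_ge1 // (le_trans _ m1).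
have t0 : 0 < t by lra.
have st0 : 0 < Num.sqrt t by rewrite sqrtr_gt0.
have st1 : 1 <= Num.sqrt t by rewrite -sqrtr1 ler_wsqrtr; lra.
pose L := Num.truncn (2 * Num.sqrt t).
have L1 : L%:R <= 2 * Num.sqrt t by rewrite truncn_le // mulr_ge0 // ltW.
have L2 : 2 * Num.sqrt t < L.+1%:R by exact: truncnS_gt.
pose c : Zd 1 := const_mx m%:Z.
have cm : c ord0 ord0 = m%:Z by rewrite mxE.
have xc : heat t c <= heat t x by apply: heat1_nonincr => //; rewrite cm; lia.
apply: le_trans xc.
have q0 (y : Zd 1) : 0 <= heat t y by rewrite heat_ge0 // ltW.
pose i1 (y : Zd 1) : \bar R := if (`|y ord0 ord0| <= m%:Z)%R then 1%E else 0%E.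
pose i2 (y : Zd 1) : \bar R := if (`|y ord0 ord0| <= L%:Z)%R then 1%E else 0%E.
have i10 y : (0 <= i1 y)%E by rewrite /i1; case: ifP.
have i20 y : (0 <= i2 y)%E by rewrite /i2; case: ifP.
have key : (1 <= (4 * t)^-1%:E * tsum (fun y : Zd 1 => (heat t y * coord y ^+ 2)%:E) +
   ((heat t (0 : Zd 1))%:E * tsum i1 + (heat t c)%:E * tsum i2))%E.
  have tc y : (0 <= (heat t y * coord y ^+ 2)%:E)%E by rewrite lee_fin mulr_ge0 // sqr_ge0.
  have t40 : 0 <= (4 * t)^-1 by rewrite invr_ge0 mulr_ge0 // ltW.
  rewrite -(tsum_heat (d := 1) isT (ltW t0)) -!tsumZ // -!tsumD; last first.
  all: try by move=> y; rewrite ?adde_ge0 ?mule_ge0 // ?lee_fin.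
  apply: le_tsum => y; rewrite /i1 /i2 -EFinM.
  case: ifP => [ym|/negbT ym].
    rewrite mule1 -[X in (X <= _)%E]add0e; apply: leeD; first by rewrite lee_fin mulr_ge0 // mulr_ge0 // sqr_ge0.
    rewrite -[X in (X <= _)%E]adde0; apply: leeD; last by rewrite mule_ge0 ?lee_fin //; case: ifP.
    by rewrite lee_fin; apply: heat1_nonincr => //; rewrite mxE normr0.
  rewrite mule0 add0e; case: ifP => [yL|/negbT yL].
    rewrite mule1 -[X in (X <= _)%E]add0e; apply: leeD; first by rewrite lee_fin mulr_ge0 // mulr_ge0 // sqr_ge0.
    by rewrite lee_fin; apply: heat1_nonincr => //; rewrite cm; move: ym; lia.
  rewrite mule0 adde0 lee_fin mulrCA ler_peMr //.
  rewrite ler_pdivlMl ?mulr_gt0 // mulr1.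
  have hL : L.+1%:R <= `|coord y|.
    rewrite /coord -intr_norm -[L.+1%:R]/(L.+1%:Z%:~R) ler_int; lia.
  rewrite -real_normK ?num_real //.
  have -> : 4 * t = (2 * Num.sqrt t) ^+ 2.
    by rewrite exprMn sqr_sqrtr ?(ltW t0) // expr2 -natrM.
  rewrite lerXn2r ?nnegrE ?mulr_ge0 ?(ltW st0) //.
  by apply: le_trans hL; exact: ltW.
have s1 : (tsum i1 <= (2 * m + 1)%:R%:E)%E by exact: tsum_interval.
have s2 : (tsum i2 <= (2 * L + 1)%:R%:E)%E by exact: tsum_interval.
have hq := heat1_le t0.
have {key} : 1 <= (4 * t)^-1 * (2 * t) + ((Num.sqrt (2 * t))^-1 * (2 * m + 1)%:R + heat t c * (2 * L + 1)%:R).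
  rewrite -lee_fin; apply: le_trans key _.
  move: (heat t 0) (heat t c) s1 s2 hq (q0 0) (q0 c) => q q' s1 s2 hq q00 q10.
  rewrite heat1_second_moment ?(ltW t0) // [leRHS]EFinD [X in (_ <= X + _)%E]EFinM leeD2l //.
  rewrite [leRHS]EFinD [X in (_ <= X + _)%E]EFinM [X in (_ <= _ + X)%E]EFinM.
  apply: leeD.
    apply: le_trans (lee_wpmul2l _ s1) _; first by rewrite lee_fin.
    by apply: lee_wpmul2r; rewrite lee_fin.
  by apply: lee_wpmul2l; rewrite ?lee_fin.
have -> : (4 * t)^-1 * (2 * t) = 2^-1 by field; rewrite gt_eqF.
have h1 : (Num.sqrt (2 * t))^-1 * (2 * m + 1)%:R <= 4^-1.
  have s0 : 0 < Num.sqrt (2 * t) by rewrite sqrtr_gt0 mulr_gt0.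
  rewrite ler_pdivrMl // ler_pdivlMr //.
  rewrite -[leLHS]ger0_norm ?mulr_ge0 // -sqrtr_sqr ler_wsqrtr // exprMn.
  rewrite (_ : 4 ^+ 2 = 16 :> R); last by rewrite expr2 -natrM.
  by rewrite mulrC; lra.
have h2 : (2 * L + 1)%:R <= 5 * Num.sqrt t.
  by rewrite natrD natrM; lra.
move=> h3.
rewrite -[leLHS]mul1r ler_pdivrMr ?mulr_gt0 //.
have h4 : heat t c * (2 * L + 1)%:R <= heat t c * (5 * Num.sqrt t) by rewrite ler_wpM2l.
lra.
Qed.

End one_dimensional_heat.

Section heat_bounds.
Variable R : realType.
Implicit Types (t : R) (d m : nat).

Lemma heat_le d t : 0 < t -> heat t (0 : Zd d.+1) <= (Num.sqrt (2 * t))^-1 ^+ d.+1.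
Proof.
move=> t0; elim: d => [|d IH]; first by rewrite expr1; exact: heat1_le.
have -> : heat t (0 : Zd d.+2) = heat t (0 : Zd 1) * heat t (0 : Zd d.+1).
  by rewrite -(@heat_row R 1 d.+1 isT isT t) ?(ltW t0) // row_mx0.
rewrite exprS.
by apply: ler_pM => //; rewrite ?heat_ge0 ?(ltW t0) //; exact: heat1_le.
Qed.

Lemma heat_ge d t m (x : Zd d.+1) : 8 * (2 * m + 1)%:R ^+ 2 <= t ->
  (forall i, (`|x ord0 i| <= m%:Z)%R) -> (20 * Num.sqrt t)^-1 ^+ d.+1 <= heat t x.
Proof.
move=> tm; have t0 : 0 <= t by apply: le_trans tm; rewrite mulr_ge0 // exprn_ge0.
elim: d x => [|d IH] x xm; first by rewrite expr1; exact: (heat1_ge tm).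
have st0 : 0 <= (20 * Num.sqrt t)^-1 by rewrite invr_ge0 mulr_ge0 // sqrtr_ge0.
have -> : heat t x = heat t (@lsubmx _ 1 1 d.+1 x) * heat t (@rsubmx _ 1 1 d.+1 x).
  by rewrite -(@heat_row R 1 d.+1 isT isT t) // hsubmxK.
rewrite exprS; apply: ler_pM => //.
  by apply: (heat1_ge tm); rewrite mxE.
by apply: IH => i; rewrite mxE.
Qed.

End heat_bounds.

(** * From the heat kernel back to walk probabilities *)

Section walk_decay.
Variables (R : realType) (d : nat).
Hypothesis d0 : (0 < d)%N.
Implicit Types (x : Zd d) (s p : R) (n m : nat).
Local Notation lam := (@deg R d).
Local Notation wk := (@wk R d).

Lemma wk_even_nonincr j m : (j <= m)%N -> wk (m + m) 0 <= wk (j + j) 0.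
Proof.
elim: m => [|m IH]; first by rewrite leqn0 => /eqP ->.
rewrite leq_eqVlt => /predU1P[-> //|]; rewrite ltnS => /IH; apply: le_trans.
rewrite addSn addnS; apply: wkS_le => // y; exact: wk_le_double.
Qed.

(* Every odd term of the exponential series is at most the sum of its two even neighbours. *)
Lemma expR_even_ge (t : R) : 0 <= t ->
  ((expR t)%:E <= 3%:E * tsum (fun j => (t ^+ j.*2 / (j.*2)`!%:R)%:E))%E.
Proof.
move=> t0; pose f n := t ^+ n / n`!%:R.
have f0 n : 0 <= f n by rewrite divr_ge0 // exprn_ge0.
have fe n : (0 <= (f n)%:E)%E by rewrite lee_fin.
pose E := tsum (fun j => (f j.*2)%:E).
have -> : tsum (fun j => (t ^+ j.*2 / (j.*2)`!%:R)%:E) = E by [].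
have E0 : (0 <= E)%E by exact: tsum_ge0.
rewrite -tsum_expR //; apply: tsum_nat_le => // N.
apply: (@le_trans _ _ (\sum_(k < N.*2) (f k)%:E)%E).
  rewrite -(subnKC (_ : N <= N.*2)%N); last by rewrite -addnn leq_addr.
  by rewrite big_split_ord /= leeDl // sume_ge0.
have step k : f k.*2.+1 <= f k.*2 + f k.*2.+2.
  rewrite /f !factS !natrM !exprS; set T := t ^+ _; set u := (k.*2)`!%:R.
  have u0 : 0 < u :> R by rewrite ltr0n fact_gt0.
  have T0 : 0 <= T by rewrite exprn_ge0.
  have [a0 b0] : 0 < k.*2.+1%:R :> R /\ 0 < k.*2.+2%:R :> R by rewrite !ltr0n.
  have ab : k.*2.+2%:R <= 2 * k.*2.+1%:R :> R by rewrite -natrM ler_nat; lia.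
  move: (k.*2.+1%:R) (k.*2.+2%:R) a0 b0 ab => a b a0 b0 ab.
  rewrite -subr_ge0.
  have -> : T / u + t * (t * T) / (b * (a * u)) - t * T / (a * u) =
            T / u * (1 + t ^+ 2 / (b * a) - t / a) by field; rewrite !gt_eqF.
  rewrite mulr_ge0 // ?divr_ge0 // ?(ltW u0) //.
  have h : (t / a) ^+ 2 / 2 <= t ^+ 2 / (b * a).
    rewrite expr_div_n -mulrA; apply: ler_wpM2l; first exact: sqr_ge0.
    rewrite -invfM lef_pV2 ?posrE ?mulr_gt0 ?exprn_gt0 // expr2 mulrC [leRHS]mulrC mulrCA.
    by rewrite ler_pM2l // mulrC.
  have := sqr_ge0 (t / a - 1); rewrite sqrrB expr1n mulr1 mulr2n; lra.
have -> : (3%:E * E = E + (E + E))%E.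
  rewrite (_ : 3 = 1 + (1 + 1) :> R) // EFinD [(1 + 1)%:E]EFinD.
  by rewrite !ge0_muleDl ?mul1e // -EFinD lee_fin.
have dbl : (\sum_(k < N.*2) (f k)%:E = \sum_(k < N) (f k.*2)%:E + \sum_(k < N) (f k.*2.+1)%:E)%E.
  elim: N => [|N IH]; first by rewrite !big_ord0 adde0.
  by rewrite doubleS !big_ord_recr /= IH -addeA addeACA.
rewrite dbl; apply: leeD; first by apply: (@tsum_nat_ge _ (fun j => (f j.*2)%:E)).
apply: (@le_trans _ _ (\sum_(k < N) (f k.*2)%:E + \sum_(k < N) (f k.+1.*2)%:E)%E).
  by rewrite -big_split /=; apply: lee_sum => k _; rewrite -EFinD lee_fin doubleS.
apply: leeD; first by apply: (@tsum_nat_ge _ (fun j => (f j.*2)%:E)).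
apply: le_trans (@tsum_inj_le _ S (fun j => (f j.*2)%:E) succn_inj (fun _ => fe _)).
by apply: (@tsum_nat_ge _ (fun j => (f j.+1.*2)%:E)).
Qed.

(** At this time the number of jumps is Poisson with mean m/3. It is even with probability at least
    1/3; an even number up to 2m returns with probability at least a = p_2m(0); larger numbers cost
    at most a/6 by Markov's inequality. Hence a/3 <= h + a/6, with h the heat kernel. *)
Lemma wk_even_le_heat m : (0 < m)%N ->
  wk (m + m) 0 <= 6 * heat (m%:R / (3 * lam)) (0 : Zd d).
Proof.
move=> m0; have l0 := lam_gt0 R d0.
set t := m%:R / (3 * lam); have t0 : 0 < t by rewrite divr_gt0 ?ltr0n ?mulr_gt0.
pose mu := lam * t; have muE : mu = m%:R / 3 by rewrite /mu /t; field; rewrite gt_eqF.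
have mu0 : 0 <= mu by rewrite muE divr_ge0.
set a := wk (m + m) 0; have a0 : 0 <= a by exact: wk_ge0.
pose f n := mu ^+ n / n`!%:R; have f0 n : 0 <= f n by rewrite divr_ge0 // exprn_ge0.
have fe n : (0 <= (f n)%:E)%E by rewrite lee_fin.
have h1 : ((expR mu)^-1%:E * tsum (fun j => (f j.*2 * wk (j + j) 0)%:E) <= (heat t (0 : Zd d))%:E)%E.
  rewrite heat_series ?(ltW t0) // -/mu.
  rewrite -tsumZ ?invr_ge0 ?expR_ge0 //; last by move=> j; rewrite lee_fin mulr_ge0 // wk_ge0.
  pose g n := expR (- mu) * (t ^+ n / n`!%:R * (nwalks n (0 : Zd d))%:R).
  apply: le_trans (@tsum_inj_le _ double (fun n => (g n)%:E) double_inj _); last first.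
    by move=> n; rewrite lee_fin mulr_ge0 ?expR_ge0 // mulr_ge0 // divr_ge0 // exprn_ge0 // ltW.
  apply: le_tsum => j; rewrite -EFinM lee_fin /g nwalksE // expRN addnn /f /mu exprMn.
  by rewrite le_eqVlt; apply/orP; left; apply/eqP; ring.
have h2 : (a%:E * tsum (fun j => (f j.*2)%:E) <=
    tsum (fun j => (f j.*2 * wk (j + j) 0)%:E) +
    (a / (2 * m%:R))%:E * tsum (fun j => (j.*2%:R * f j.*2)%:E))%E.
  have am0 : 0 <= a / (2 * m%:R) by rewrite divr_ge0 // mulr_ge0.
  rewrite -!tsumZ //; last by move=> j; rewrite lee_fin mulr_ge0.
  rewrite -tsumD; last 2 first.
  - by move=> j; rewrite lee_fin mulr_ge0 // wk_ge0.
  - by move=> j; rewrite -EFinM lee_fin mulr_ge0 // mulr_ge0.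
  apply: le_tsum => j; rewrite -!EFinM -EFinD lee_fin.
  have -> : f j.*2 * wk (j + j) 0 + a / (2 * m%:R) * (j.*2%:R * f j.*2) =
            f j.*2 * (wk (j + j) 0 + a / (2 * m%:R) * j.*2%:R) by ring.
  rewrite mulrC ler_wpM2l //.
  have [jm|mj] := leqP j m.
    by apply: le_trans (wk_even_nonincr jm) _; rewrite lerDl mulr_ge0.
  rewrite -[leLHS]add0r; apply: lerD; first exact: wk_ge0.
  rewrite -mulrA ler_peMr // mulrC ler_pdivlMr ?mulr_gt0 ?ltr0n // mul1r -natrM ler_nat; lia.
have h3 : (tsum (fun j => (j.*2%:R * f j.*2)%:E) <= (mu * expR mu)%:E)%E.
  apply: (@le_trans _ _ (tsum (fun n => (n%:R * f n)%:E))).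
    by apply: (@tsum_inj_le _ double (fun n => (n%:R * f n)%:E) double_inj) => n; rewrite lee_fin mulr_ge0.
  rewrite tsum_natS ?mul0r //; last by move=> n; rewrite lee_fin mulr_ge0.
  rewrite EFinM -tsum_expR // -tsumZ //.
  apply: le_tsum => n; rewrite -EFinM lee_fin /f exprS factS natrM.
  have n1 : n.+1%:R != 0 :> R by rewrite pnatr_eq0.
  have nf : n`!%:R != 0 :> R by rewrite pnatr_eq0 -lt0n fact_gt0.
  rewrite le_eqVlt; apply/orP; left; apply/eqP.
  by move: (n.+1%:R) n1 (n`!%:R) nf => b hb c hc; field; rewrite hb hc.
have h4 := expR_even_ge mu0.
have eh : 0 < expR mu by exact: expR_gt0.
set h := heat t 0 in h1 *; move: h h1 => h.
set Y := tsum (fun j => (f j.*2 * wk (j + j) 0)%:E) in h2 *.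
have Y0 : (0 <= Y)%E by apply: tsum_ge0 => j; rewrite lee_fin mulr_ge0 // wk_ge0.
move=> h1.
have h5 : (Y <= (expR mu * h)%:E)%E.
  by move: h1; rewrite muleC lee_pdivrMr // muleC [(_ * h)%:E]EFinM muleC.
have h6 : ((a * expR mu)%:E <= 3%:E * (Y + (a / (2 * m%:R))%:E * (mu * expR mu)%:E))%E.
  rewrite [(a * _)%:E]EFinM; apply: (le_trans (lee_wpmul2l _ h4)); first by rewrite lee_fin.
  rewrite muleCA; apply: lee_wpmul2l => //; apply: (le_trans h2).
  by rewrite leeD2l // lee_wpmul2l // lee_fin divr_ge0 // mulr_ge0.
have h7 : ((a * expR mu)%:E <= 3%:E * ((expR mu * h)%:E + (a / (2 * m%:R))%:E * (mu * expR mu)%:E))%E.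
  by apply: (le_trans h6); apply: lee_wpmul2l => //; rewrite leeD2r.
move: h7; rewrite -[(_%:E * (mu * _)%:E)%E]EFinM -EFinD -EFinM lee_fin.
have -> : a / (2 * m%:R) * (mu * expR mu) = a * expR mu / 6.
  by rewrite muE; field; rewrite pnatr_eq0 -lt0n.
move=> h7; rewrite -(ler_pM2r eh); lra.
Qed.

(** The 6 in front is that of [wk_even_le_heat]; the quantity under the root bounds e^har(m)/(2t) at
    the time t = m/(3 lam) used there, by e^har(m) <= e (m+1). *)
Definition decay_const : R := 6 * Num.sqrt (6 * expR 1 * lam) ^+ d.

Lemma exp_har_even_le m : wk (m + m) 0 <= decay_const * expR (- (d%:R / 2 * har R m)).
Proof.
have l0 := lam_gt0 R d0.
have l1 : 1 <= lam by rewrite degE -natrM ler1n muln_gt0.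
have e1 : 1 <= expR 1 :> R by rewrite -[leLHS]expR0 ler_expR.
have e0 : 0 < expR 1 :> R by exact: expR_gt0.
have c1 : 1 <= 6 * expR 1 * lam by rewrite -[leLHS]mulr1 ler_pM // -[leLHS]mulr1 ler_pM // ler1n.
case: m => [|m].
  rewrite wk0 eqxx har0 mulr0 oppr0 expR0 mulr1 /decay_const.
  rewrite -[leLHS]mulr1 ler_pM ?ler1n // exprn_ege1 // -[leLHS]sqrtr1; exact: ler_wsqrtr.
apply: (le_trans (wk_even_le_heat (ltn0Sn m))).
rewrite /decay_const -[leRHS]mulrA ler_pM2l //.
set t := m.+1%:R / (3 * lam); have t0 : 0 < t by rewrite divr_gt0 ?ltr0n ?mulr_gt0.
have -> : expR (- (d%:R / 2 * har R m.+1)) = (Num.sqrt (expR (har R m.+1)))^-1 ^+ d.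
  rewrite exprVn expRN; congr (_ ^-1).
  rewrite (_ : Num.sqrt _ = expR (har R m.+1 / 2)).
    by rewrite -expRM_natl; congr expR; ring.
  rewrite -[RHS]ger0_norm ?expR_ge0 // -sqrtr_sqr -expRM_natl; by congr (Num.sqrt (expR _)); field.
rewrite -exprMn.
have h1 : heat t (0 : Zd d) <= (Num.sqrt (2 * t))^-1 ^+ d by case: d d0 => // k _ in t t0 *; exact: heat_le.
apply: (le_trans h1); apply: lerXn2r; rewrite ?nnegrE ?invr_ge0 ?mulr_ge0 ?invr_ge0 ?sqrtr_ge0 //.
rewrite -sqrtrV; last by rewrite mulr_ge0 // ltW.
rewrite -sqrtrV ?expR_ge0 // -sqrtrM ?mulr_ge0 ?expR_ge0 ?(ltW l0) //; apply: ler_wsqrtr.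
rewrite ler_pdivlMr ?expR_gt0 // /t.
apply: (le_trans (ler_wpM2l _ (expR_har_le R m.+1))).
  by rewrite invr_ge0 mulr_ge0 // divr_ge0 // mulr_ge0 // ltW.
have -> : (2 * (m.+1%:R / (3 * lam)))^-1 * (expR 1 * m.+2%:R) =
   (3 * expR 1 * lam) * (m.+2%:R / (2 * m.+1%:R)).
  by field; rewrite gt_eqF //= gt_eqF // ltr0n.
rewrite (_ : 6 * expR 1 * lam = 3 * expR 1 * lam * 2); last by ring.
rewrite ler_pM2l ?mulr_gt0 // ler_pdivrMr ?mulr_gt0 ?ltr0n // -!natrM ler_nat; lia.
Qed.

Lemma decay_const_gt0 : 0 < decay_const.
Proof.
by rewrite mulr_gt0 // exprn_gt0 // sqrtr_gt0 !mulr_gt0 ?expR_gt0 // lam_gt0.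
Qed.

Lemma har_nd m k : har R m <= har R (m + k).
Proof.
elim: k => [|k IH]; first by rewrite addn0.
by rewrite addnS harS (le_trans IH) // lerDl.
Qed.

(** An odd time is compared with the even time before it, and passing from n to half of it changes
    [har] by at most 1, hence the bound by a constant factor. *)
Lemma wk_decay n x :
  wk n x <= decay_const * expR (d%:R) * expR (- (d%:R / 2 * har R n)).
Proof.
have D0 := decay_const_gt0.
have hm m x' : wk (m + m) x' <= decay_const * expR (- (d%:R / 2 * har R m)).
  by apply: le_trans (exp_har_even_le m); exact: wk_double_le.
have har_add m k : har R (m + k) <= har R m + k%:R / m.+1%:R.
  elim: k => [|k IH]; first by rewrite addn0 mul0r addr0.
  rewrite addnS harS -[k.+1%:R]natr1 mulrDl mul1r addrA; apply: lerD => //.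
  by rewrite lef_pV2 ?posrE ?ltr0n // ler_nat ltnS leq_addr.
have [m [hw hn]] : exists m, wk n x <= wk (m + m) 0 /\ (n <= m + m.+1)%N.
  exists n./2; rewrite -[in wk n](odd_double_half n) -[X in (X <= _)%N](odd_double_half n) -addnn.
  case: (odd n) => /=; last by split; [exact: wk_double_le|lia].
  by rewrite add1n; split; [exact: wk_le_double|lia].
apply: (le_trans hw); apply: (le_trans (exp_har_even_le m)).
rewrite -[leRHS]mulrA ler_pM2l // -expRD ler_expR.
have h1 : har R n <= har R m + 1.
  have := har_add m m.+1; rewrite divff ?pnatr_eq0 //; apply: le_trans.
  by rewrite -(subnKC hn); exact: har_nd.
have d1 : 0 <= d%:R :> R by [].
have : d%:R / 2 * har R n <= d%:R / 2 * (har R m + 1) by rewrite ler_wpM2l // divr_ge0.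
lra.
Qed.

(** Telescoping: with r = [rc (s + 1)], the term of index m is at most (s+1)/s (1/r_m - 1/r_(m+1)).
    Writing the bound through 1/r_M, of order M^-s, lets it cancel exactly against the partial sums
    in [rc_sum]. *)
Lemma tail_har s M : 0 < s ->
  (tsum (fun k => (expR (- ((s + 1) * har R (M + k))))%:E) <=
   ((s + 1) / s / rc (s + 1) M)%:E)%E.
Proof.
move=> s0; have s1 : 0 < s + 1 by rewrite addr_gt0.
apply: tsum_nat_le => [k|N]; first by rewrite lee_fin expR_ge0.
rewrite sumEFin lee_fin.
have step m : expR (- ((s + 1) * har R m)) <=
    (s + 1) / s * ((rc (s + 1) m)^-1 - (rc (s + 1) m.+1)^-1).
  have r0 := rc_gt0 m s1; have m1 : 0 < m.+1%:R :> R by rewrite ltr0n.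
  have sm : 0 < s + 1 + m%:R by rewrite ltr_wpDr.
  have -> : (rc (s + 1) m)^-1 - (rc (s + 1) m.+1)^-1 = (rc (s + 1) m)^-1 * (s / (s + 1 + m%:R)).
    by rewrite rcS -natr1; field; rewrite natr1 !gt_eqF.
  have h1 : expR (- (s * har R m)) <= (rc (s + 1) m)^-1.
    rewrite expRN lef_pV2 ?posrE ?expR_gt0 //.
    by have := rc_le_exp m (ltW s1); rewrite addrK.
  have h2 : expR (- har R m) <= m.+1%:R^-1.
    by rewrite expRN lef_pV2 ?posrE ?expR_gt0 // expR_har_ge.
  rewrite mulrDl mul1r opprD expRD.
  apply: (@le_trans _ _ ((rc (s + 1) m)^-1 * m.+1%:R^-1)).
    by apply: ler_pM; rewrite ?expR_ge0.
  rewrite mulrCA ler_pM2l ?invr_gt0 //.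
  have -> : (s + 1) / s * (s / (s + 1 + m%:R)) = (s + 1) / (s + 1 + m%:R).
    by field; rewrite !gt_eqF.
  rewrite ler_pdivlMr // mulrC ler_pdivrMr // -natr1 mulrDr mulr1.
  by rewrite addrC lerD2r -[leLHS]mul1r ler_wpM2r // lerDr ltW.
apply: (@le_trans _ _ ((s + 1) / s * ((rc (s + 1) M)^-1 - (rc (s + 1) (M + N))^-1))).
  elim: N => [|N IH]; first by rewrite big_ord0 addn0 subrr mulr0.
  rewrite big_ord_recr /= addnS; apply: (le_trans (lerD IH (step _))).
  by rewrite -mulrDr addrA subrK.
rewrite ler_pM2l ?divr_gt0 // lerBlDr lerDl invr_ge0 rc_ge0 // ltW //.
Qed.

(** The terms are at most of order n^(p-1-d/2) = n^(-s-1). *)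
Lemma rc_tail p s M : 0 <= p -> 0 < s -> p + s = d%:R / 2 ->
  (tsum (fun k => (rc p (M + k) * expR (- (d%:R / 2 * har R (M + k))))%:E) <=
   ((s + 1) / s / rc (s + 1) M)%:E)%E.
Proof.
move=> p0 s0 ps; apply: le_trans (tail_har M s0).
apply: le_tsum => k; rewrite lee_fin.
apply: (@le_trans _ _ (expR ((p - 1) * har R (M + k)) * expR (- (d%:R / 2 * har R (M + k))))).
  by rewrite ler_wpM2r ?expR_ge0 // rc_le_exp.
by rewrite -expRD ler_expR -ps; lra.
Qed.

Definition walk_const : R := decay_const * expR d%:R.

Lemma walk_const_gt0 : 0 < walk_const.
Proof. by rewrite mulr_gt0 ?expR_gt0 ?decay_const_gt0. Qed.

Lemma Gser_fin s x : 0 < s -> s < d%:R / 2 -> Gser s x \is a fin_num.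
Proof.
move=> s0 sd; rewrite ge0_fin_numE; last first.
  by apply: tsum_ge0 => n; rewrite lee_fin mulr_ge0 ?rc_ge0 ?wk_ge0 // ltW.
have h : 0 < d%:R / 2 - s by rewrite subr_gt0.
have := @rc_tail s _ 0 (ltW s0) h; rewrite addrC subrK => /(_ erefl) ht.
have C0 := ltW walk_const_gt0.
apply: (@le_lt_trans _ _ (walk_const%:E * (((d%:R / 2 - s) + 1) / (d%:R / 2 - s) / rc (d%:R / 2 - s + 1) 0)%:E)%E); last by rewrite -EFinM ltry.
apply: le_trans (lee_wpmul2l _ ht); last by rewrite lee_fin.
rewrite -tsumZ //; last by move=> k; rewrite lee_fin mulr_ge0 ?rc_ge0 ?expR_ge0 // ltW.
apply: le_tsum => n; rewrite -EFinM lee_fin [leRHS]mulrCA ler_wpM2l ?rc_ge0 ?(ltW s0) //.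
exact: wk_decay.
Qed.

Lemma Gser_gt0 s x : 0 < s -> (0 < Gser s x)%E.
Proof.
move=> s0; have [n hn] := wk_gt0 R d0 x.
apply: (@lt_le_trans _ _ (rc s n * wk n x)%:E); first by rewrite lte_fin mulr_gt0 ?rc_gt0.
by apply: (@tsum_ge1 _ _ (fun n => (rc s n * wk n x)%:E)) => k; rewrite lee_fin mulr_ge0 ?rc_ge0 ?wk_ge0 // ltW.
Qed.

End walk_decay.

(** * Lower bounds on the kernels from dyadic time intervals *)

Section heat_integral_bounds.
Variables (R : realType) (d : nat).
Hypothesis d0 : (0 < d)%N.
Implicit Types (x : Zd d) (s t T c : R) (m : nat).
Local Notation lam := (@deg R d).
Local Notation mu := lebesgue_measure.

Lemma measurable_heat_powR x (p : R) :
  measurable_fun `](0 : R), +oo[ (fun t => (heat t x * t `^ p)%:E).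
Proof.
apply/measurable_EFinP; apply: measurable_funM.
  by apply/measurable_EFinP; exact: measurable_heat.
have -> : (fun t : R => t `^ p) = (@powR R)^~ p by [].
exact: measurable_funTS (measurable_powR p).
Qed.

Lemma heat_lower m x t : 8 * (2 * m + 1)%:R ^+ 2 <= t ->
  (forall i, (`|x ord0 i| <= m%:Z)%R) -> (20 * Num.sqrt t)^-1 ^+ d <= heat t x.
Proof. by case: d d0 x => // k _ x; exact: heat_ge. Qed.

Lemma powR_sub1 t (p : R) : 0 < t -> t `^ (p - 1) = t `^ p / t.
Proof.
by move=> t0; rewrite powRB ?(gt_eqF t0) ?implybT // powRr1 // ltW.
Qed.

Lemma sqrt_bound_nonincr t T : 0 < t -> t <= T ->
  (20 * Num.sqrt T)^-1 <= (20 * Num.sqrt t)^-1.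
Proof.
move=> t0 tT; have T0 := lt_le_trans t0 tT.
have [h1 h2] : 0 < Num.sqrt t /\ 0 < Num.sqrt T by rewrite !sqrtr_gt0.
by rewrite lef_pV2 ?posrE ?mulr_gt0 // ler_pM2l // ler_wsqrtr.
Qed.

Lemma integral_dyadic_ge x (p T c : R) : 0 < T -> 0 <= c ->
  (forall t, T <= t -> t <= 2 * T -> c <= heat t x * t `^ p) ->
  ((c * T)%:E <= \int[mu]_(t in `[T, (2 * T)%R[) (heat t x * t `^ p)%:E)%E.
Proof.
move=> T0 c0 hc.
have -> : (c * T)%:E = (\int[mu]_(t in `[T, (2 * T)%R[) (cst c%:E t))%E.
  rewrite integral_cst //= lebesgue_measure_itv /= lte_fin ifT; last by lra.
  by rewrite -EFinB -EFinM; congr EFin; ring.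
have sub : `[T, (2 * T)[ `<=` `](0 : R), +oo[.
  by move=> t /=; rewrite !in_itv /= andbT => /andP[Tt _]; exact: lt_le_trans Tt.
apply: ge0_le_integral => //.
- by apply: measurable_funS (measurable_heat_powR x p).
- by move=> t /=; rewrite in_itv /= lee_fin => /andP[t1 t2]; apply: hc => //; exact: ltW.
Qed.

Lemma integral_heat_ge x (p T c : R) : 0 < T -> 0 <= c ->
  (forall t, T <= t -> t <= 2 * T -> c <= heat t x * t `^ p) ->
  ((c * T)%:E <= \int[mu]_(t in `]0%R, +oo[) (heat t x * t `^ p)%:E)%E.
Proof.
move=> T0 c0 hc; apply: le_trans (integral_dyadic_ge T0 c0 hc) _.
apply: ge0_subset_integral => //.
- exact: measurable_heat_powR.
- move=> t /=; rewrite in_itv /= andbT => t0.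
  by rewrite lee_fin mulr_ge0 ?powR_ge0 // heat_ge0 // ltW.
- by move=> t /=; rewrite !in_itv /= andbT => /andP[Tt _]; exact: lt_le_trans Tt.
Qed.

Lemma sqrtr_powR t : 0 <= t -> Num.sqrt t = t `^ 2^-1.
Proof. by move=> t0; rewrite powR12_sqrt. Qed.

(* On the diagonal the integrand is at least a multiple of 1/t, whose integral
   over every dyadic interval is the same. *)
Lemma Gser_half_infty : Gser (d%:R / 2) (0 : Zd d) = (+oo%E : \bar R).
Proof.
have dh : 0 < d%:R / 2 :> R by rewrite divr_gt0 // ltr0n.
pose c : R := 20^-1 ^+ d / 2.
have c0 : 0 < c by rewrite divr_gt0 // exprn_gt0 // invr_gt0.
pose f t := (heat t (0 : Zd d) * t `^ (d%:R / 2 - 1))%:E.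
have step T : 8 <= T -> (c%:E <= \int[mu]_(t in `[T, (2 * T)%R[) f t)%E.
  move=> T8; have T0 : 0 < T by lra.
  have cT : 0 <= c / T by rewrite divr_ge0 // ltW.
  rewrite (_ : c = c / T * T); last by field; rewrite gt_eqF.
  apply: integral_dyadic_ge => // t t1 t2.
  have t0 : 0 < t by lra.
  have ht : (20 * Num.sqrt t)^-1 ^+ d <= heat t (0 : Zd d).
    by apply: (@heat_lower 0) => [|i]; [rewrite expr1n mulr1; lra|rewrite mxE].
  apply: (@le_trans _ _ ((20 * Num.sqrt t)^-1 ^+ d * t `^ (d%:R / 2 - 1))); last by rewrite ler_wpM2r ?powR_ge0.
  rewrite powR_sub1 //.
  have -> : t `^ (d%:R / 2) = Num.sqrt t ^+ d.
    by rewrite sqrtr_powR ?(ltW t0) // -powR_mulrn ?powR_ge0 // -powRrM mulrC.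
  rewrite invfM exprMn -!mulrA [X in _ <= _ * X]mulrA -exprMn mulVf ?gt_eqF ?sqrtr_gt0 // expr1n mul1r.
  by rewrite ler_wpM2l ?exprn_ge0 // -invfM lef_pV2 ?posrE ?mulr_gt0.
have mf T : 0 < T -> measurable_fun `[T, +oo[ f.
  move=> T0; apply: measurable_funS (measurable_heat_powR _ _) => // t /=.
  by rewrite !in_itv /= !andbT; exact: lt_le_trans.
have f0 t : 0 < t -> (0 <= f t)%E.
  by move=> t0; rewrite lee_fin mulr_ge0 ?powR_ge0 // heat_ge0 // ltW.
have grow N : forall T, 8 <= T -> ((N%:R * c)%:E <= \int[mu]_(t in `[T, +oo[) f t)%E.
  elim: N => [T T8|N IH T T8].
    by rewrite mul0r; apply: integral_ge0 => t /=; rewrite in_itv /= andbT => h; apply: f0; lra.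
  have -> : `[T, +oo[%classic = `[T, (2 * T)[ `|` `[(2 * T), +oo[.
    apply/seteqP; split=> t /=; rewrite !in_itv /= !andbT.
      by move=> ->; case: (ltP t (2 * T)) => h; [left|right].
    by case=> [/andP[]//|]; lra.
  rewrite ge0_integral_setU //; first last.
  - apply/disj_setPS => t [] /=; rewrite !in_itv /= andbT => /andP[_ h1] h2; lra.
  - by move=> t [] /=; rewrite !in_itv /= ?andbT => h; apply: f0; lra.
  - apply: measurable_funS (mf T _) => //; last by lra.
    by move=> t [] /=; rewrite !in_itv /= ?andbT => h; lra.
  rewrite -natr1 mulrDl mul1r addrC EFinD; apply: leeD; first exact: step.
  by apply: IH; lra.
have [//|fin] := eqVneq (Gser (d%:R / 2) (0 : Zd d)) (+oo%E : \bar R).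
have Gf : Gser (d%:R / 2) (0 : Zd d) \is a @fin_num R.
  rewrite ge0_fin_numE; first by rewrite ltey.
  by apply: tsum_ge0 => n; rewrite lee_fin mulr_ge0 ?rc_ge0 ?wk_ge0 // ltW.
have gf := gamma_int_fin (lam_gt0 R d0) dh.
pose r := fine (gamma_int lam (d%:R / 2)) * fine (Gser (d%:R / 2) (0 : Zd d)).
have hr N : N%:R * c <= r.
  rewrite -lee_fin [r%:E]EFinM !fineK // -integral_heat //.
  apply: le_trans (grow N 8 (lexx _)) _; apply: ge0_subset_integral => //.
  - exact: measurable_heat_powR.
  - by move=> t /=; rewrite in_itv /= andbT => /f0.
  - by move=> t /=; rewrite !in_itv /= !andbT; lra.
have := hr (Num.truncn (r / c)).+1; rewrite -ler_pdivlMr // leNgt truncnS_gt //.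
Qed.

(** Only the times in [T, 2T] are kept. For T of order m^2 the bound is of order m^(2s-d), the size
    of the kernel at distance m. *)
Lemma Gser_ge s T m x : 0 < s -> 8 * (2 * m + 1)%:R ^+ 2 <= T ->
  (forall i, (`|x ord0 i| <= m%:Z)%R) ->
  ((T `^ s * (20 * Num.sqrt (2 * T))^-1 ^+ d / 2)%:E <= gamma_int lam s * Gser s x)%E.
Proof.
move=> s0 Tm xm; have T0 : 0 < T.
  by apply: lt_le_trans Tm; rewrite mulr_gt0 // exprn_gt0 // ltr0n addn1.
set q := _^-1 ^+ d; have q0 : 0 <= q by rewrite exprn_ge0 // invr_ge0 mulr_ge0 // sqrtr_ge0.
rewrite -integral_heat // (_ : T `^ s * q / 2 = q * (T `^ s / (2 * T)) * T); last first.
  by field; rewrite gt_eqF.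
apply: integral_heat_ge => //.
  by rewrite mulr_ge0 // divr_ge0 ?powR_ge0 // mulr_ge0 // ltW.
move=> t t1 t2; have t0 : 0 < t by lra.
apply: ler_pM => //; first by rewrite divr_ge0 ?powR_ge0 // mulr_ge0 // ltW.
  apply: le_trans (heat_lower (le_trans Tm t1) xm).
  apply: lerXn2r; rewrite ?nnegrE ?invr_ge0 ?mulr_ge0 ?sqrtr_ge0 //.
  exact: sqrt_bound_nonincr.
rewrite powR_sub1 //.
apply: ler_pM; rewrite ?powR_ge0 ?invr_ge0 ?mulr_ge0 ?(ltW T0) //.
  by apply: ge0_ler_powR => //; rewrite ?nnegrE; lra.
by rewrite lef_pV2 ?posrE ?mulr_gt0.
Qed.

Lemma Kser_ge s T m x : 0 < s < 1 -> x != 0 -> 8 * (2 * m + 1)%:R ^+ 2 <= T ->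
  (forall i, (`|x ord0 i| <= m%:Z)%R) ->
  (((2 * T) `^ (- s) * (20 * Num.sqrt (2 * T))^-1 ^+ d / 2)%:E <=
   gamma_int lam (1 - s) * ((lam / s)%:E * Kser s x))%E.
Proof.
move=> s01 x0 Tm xm; have T0 : 0 < T.
  by apply: lt_le_trans Tm; rewrite mulr_gt0 // exprn_gt0 // ltr0n addn1.
have /andP[s0 _] := s01.
set q := _^-1 ^+ d; have q0 : 0 <= q by rewrite exprn_ge0 // invr_ge0 mulr_ge0 // sqrtr_ge0.
rewrite -integral_heat_neg // (_ : (2 * T) `^ (- s) * q / 2 = q * ((2 * T) `^ (- s) / (2 * T)) * T); last first.
  by field; rewrite gt_eqF.
apply: integral_heat_ge => //.
  by rewrite mulr_ge0 // divr_ge0 ?powR_ge0 // mulr_ge0 // ltW.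
move=> t t1 t2; have t0 : 0 < t by lra.
apply: ler_pM => //; first by rewrite divr_ge0 ?powR_ge0 // mulr_ge0 // ltW.
  apply: le_trans (heat_lower (le_trans Tm t1) xm).
  apply: lerXn2r; rewrite ?nnegrE ?invr_ge0 ?mulr_ge0 ?sqrtr_ge0 //.
  exact: sqrt_bound_nonincr.
rewrite [- 1 - s]addrC powR_sub1 //.
apply: ler_pM; rewrite ?powR_ge0 ?invr_ge0 ?mulr_ge0 ?(ltW T0) //.
  rewrite !powRN lef_pV2 ?posrE ?powR_gt0 ?mulr_gt0 //.
  by apply: ge0_ler_powR => //; rewrite ?nnegrE; lra.
by rewrite lef_pV2 ?posrE ?mulr_gt0.
Qed.

End heat_integral_bounds.

(** * The Hardy weights *)

Section walk_series.
Variables (R : realType) (d : nat).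
Hypothesis d0 : (0 < d)%N.
Implicit Types (x y : Zd d) (b c : nat -> R) (s : R).
Local Notation lam := (@deg R d).
Local Notation wk := (@wk R d).
Local Open Scope ereal_scope.

Definition ser c x : \bar R := tsum (fun n => (c n * wk n x)%:E).

Lemma ser_ge0e c x : (forall n, (0 <= c n)%R) -> 0 <= ser c x.
Proof. by move=> c0; apply: tsum_ge0 => n; rewrite lee_fin mulr_ge0 // wk_ge0. Qed.

Lemma serN c x : ser c (- x)%R = ser c x.
Proof. by apply: eq_tsum => n; rewrite wkN. Qed.

Lemma serD b c x : (forall n, (0 <= b n)%R) -> (forall n, (0 <= c n)%R) ->
  ser (fun n => b n + c n)%R x = ser b x + ser c x.
Proof.
move=> b0 c0; rewrite -tsumD.
- by apply: eq_tsum => n; rewrite mulrDl EFinD.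
- by move=> n; rewrite lee_fin mulr_ge0 // wk_ge0.
- by move=> n; rewrite lee_fin mulr_ge0 // wk_ge0.
Qed.

Lemma le_ser b c x : (forall n, (b n <= c n)%R) -> ser b x <= ser c x.
Proof. by move=> bc; apply: le_tsum => n; rewrite lee_fin ler_wpM2r // wk_ge0. Qed.

(** By the Chapman-Kolmogorov equation, convolving kernels multiplies their series; finiteness of
    the first factor allows it to be taken inside the sum of the second. *)
Lemma ser_conv b c x : (forall n, (0 <= b n)%R) -> (forall n, (0 <= c n)%R) ->
  (forall y, ser b y \is a fin_num) ->
  tsum (fun y => ser b (x - y)%R * ser c y) =
  tsum (fun m => tsum (fun n => (b m * c n * wk (m + n) x)%:E)).
Proof.
move=> b0 c0 bfin.
have t0 m n y z : 0 <= (b m * c n * (wk m z * wk n y))%:E.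
  by rewrite lee_fin; apply: mulr_ge0; apply: mulr_ge0 => //; exact: wk_ge0.
transitivity (tsum (fun y => tsum (fun m => tsum (fun n =>
    (b m * c n * (wk m (x - y) * wk n y))%:E)))).
  apply: eq_tsum => y.
  have cy n : 0 <= (c n * wk n y)%:E by rewrite lee_fin mulr_ge0 // wk_ge0.
  have by_ m : 0 <= (b m * wk m (x - y))%:E by rewrite lee_fin mulr_ge0 // wk_ge0.
  rewrite -(fineK (bfin (x - y)%R)) -tsumZ //; last by rewrite fine_ge0 // ser_ge0e.
  rewrite tsum_exchange //; apply: eq_tsum => n.
  rewrite (fineK (bfin _)) muleC -tsumZ //; last by rewrite -lee_fin.
  by apply: eq_tsum => m; rewrite -EFinM; congr EFin; ring.
rewrite [LHS]tsum_exchange; last by move=> y m; apply: tsum_ge0.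
apply: eq_tsum => m; rewrite tsum_exchange //; apply: eq_tsum => n.
rewrite [RHS]EFinM -wk_conv // -tsumZ ?mulr_ge0 //.
by move=> y; rewrite lee_fin; apply: mulr_ge0; exact: wk_ge0.
Qed.

Lemma ser_conv_diag b c x : (forall n, (0 <= b n)%R) -> (forall n, (0 <= c n)%R) ->
  (forall y, ser b y \is a fin_num) ->
  tsum (fun y => ser b (x - y)%R * ser c y) =
  ser (fun N => \sum_(k < N.+1) b k * c (N - k)%N)%R x.
Proof.
move=> b0 c0 bfin; rewrite ser_conv // tsum_diag; last first.
  by move=> m n; rewrite lee_fin; apply: mulr_ge0; [apply: mulr_ge0|exact: wk_ge0].
apply: eq_tsum => N; rewrite sumEFin mulr_suml; congr EFin.
by apply: eq_bigr => k _; rewrite subnKC // -ltnS.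
Qed.

Definition trunc c M n : R := if (n < M)%N then c n else 0%R.

Lemma trunc_ge0 c M n : (forall n, (0 <= c n)%R) -> (0 <= trunc c M n)%R.
Proof. by move=> c0; rewrite /trunc; case: ifP. Qed.

Lemma ser_trunc c M x : (forall n, (0 <= c n)%R) ->
  ser (trunc c M) x = (\sum_(n < M) c n * wk n x)%R%:E.
Proof.
move=> c0; rewrite /ser (tsum_seq (s := index_iota 0 M)).
- rewrite sumEFin big_mkord; congr EFin; apply: eq_bigr => n _.
  by rewrite /trunc ltn_ord.
- by move=> n; rewrite lee_fin mulr_ge0 ?wk_ge0 ?trunc_ge0.
- exact: iota_uniq.
- by move=> n; rewrite mem_index_iota /= /trunc => /negbTE ->; rewrite mul0r.
Qed.

Lemma fsupp_walk_sum c M : fsupp (fun x => \sum_(n < M) c n * wk n x)%R.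
Proof.
elim: M => [|M IH]; first by exists [::] => x; rewrite big_ord0 eqxx.
have [s hs] := @wk_finsupp R d M.
have hc : fsupp (fun x => c M * wk M x)%R.
  by exists s => x h; apply: hs; apply: contraNneq h => ->; rewrite mulr0.
have [s2 hs2] := fsuppD IH hc.
by exists s2 => x; rewrite big_ord_recr; exact: hs2.
Qed.

Lemma ser_cvg c x : (forall n, (0 <= c n)%R) -> ser c x \is a fin_num ->
  ((\sum_(n < M) c n * wk n x)%R @[M --> \oo] --> fine (ser c x))%R.
Proof.
move=> c0 cf.
have t0 n : 0 <= (c n * wk n x)%:E by rewrite lee_fin mulr_ge0 ?wk_ge0.
have h : \sum_(0 <= n < M) (c n * wk n x)%:E @[M --> \oo] --> ser c x.
  rewrite /ser -tsum_nat //; apply: is_cvg_ereal_nneg_natsum => n _; exact: t0.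
have := fine_cvg; move=> /(_ _ _ \oo _ _ (fine (ser c x))); rewrite fineK // => /(_ _ h).
apply: cvg_trans; apply: near_eq_cvg; near=> M.
by rewrite /= big_mkord sumEFin.
Unshelve. all: by end_near. Qed.

End walk_series.

(** * The abstract theory applied to the Riesz kernels *)

Section riesz_forms.
Variables (R : realType) (d : nat) (sigma alpha : R).
Hypothesis d0 : (0 < d)%N.
Hypothesis s0 : 0 < sigma.
Hypothesis s1 : sigma <= 1.
Hypothesis sa : sigma < alpha.
Hypothesis ad : alpha < d%:R / 2.
Implicit Types (x y : Zd d) (M n : nat).
Local Notation lam := (@deg R d).
Local Notation wk := (@wk R d).

(** Off the diagonal [Kr] is the Riesz kernel of order sigma; its diagonal, invisible to the
    quadratic form, is kept so that the rows sum to [Sr]. A common factor lam^-alpha is dropped: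
    [Gr] and [Hr] are lam^alpha times the kernels of order -alpha and sigma - alpha. *)
Definition Kr x y : R := lam `^ sigma * fine (Kser sigma (x - y)).
Definition Gr x : R := fine (Gser alpha x).
Definition Hr x : R := lam `^ sigma * fine (Gser (alpha - sigma) x).
Definition Sr : R := lam `^ sigma.
Definition ur M x : R := \sum_(n < M) rc alpha n * wk n x.
Definition Hur M x : R := lam `^ sigma * \sum_(n < M) rc (alpha - sigma) n * wk n x.

Lemma alpha_gt0 : 0 < alpha. Proof. exact: lt_trans sa. Qed.
Lemma alphaB_gt0 : 0 < alpha - sigma. Proof. by rewrite subr_gt0. Qed.
Lemma alphaB_lt : alpha - sigma < d%:R / 2. Proof. by rewrite (lt_trans _ ad) // ltrBlDr ltrDl. Qed.
Lemma sigma_itv : 0 <= sigma <= 1. Proof. by rewrite ltW. Qed.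
Lemma rc_alpha_ge0 n : 0 <= rc alpha n. Proof. by rewrite rc_ge0 // ltW // alpha_gt0. Qed.
Lemma rc_alphaB_ge0 n : 0 <= rc (alpha - sigma) n. Proof. by rewrite rc_ge0 // ltW // alphaB_gt0. Qed.
Lemma bc_sigma_ge0 n : 0 <= bc sigma n. Proof. by rewrite bc_ge0 // sigma_itv. Qed.
Lemma lams_gt0 : 0 < lam `^ sigma. Proof. by rewrite powR_gt0 // lam_gt0. Qed.
Hint Resolve rc_alpha_ge0 rc_alphaB_ge0 bc_sigma_ge0 : core.

(** The value of 1 - (1-z)^sigma at z = 1: the partial sums are [1 - rc (1 - sigma) n], whose last
    term tends to 0 because sigma > 0. *)
Lemma tsum_bc : tsum (fun n => (bc sigma n)%:E) = 1%E.
Proof.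
have le1 : (tsum (fun n => (bc sigma n)%:E) <= 1)%E.
  apply: tsum_nat_le => [n|[|N]]; first by rewrite lee_fin.
    by rewrite big_ord0.
  by rewrite sumEFin bc_sum lee_fin lerBlDr lerDl rc_ge0 // subr_ge0.
apply/eqP; rewrite eq_le le1 /=.
have ge0 : (0 <= tsum (fun n => (bc sigma n)%:E))%E by apply: tsum_ge0 => n; rewrite lee_fin.
have ge n : ((1 - rc (1 - sigma) n)%:E <= tsum (fun n => (bc sigma n)%:E))%E.
  by rewrite -bc_sum -sumEFin; apply: (@tsum_nat_ge _ (fun n => (bc sigma n)%:E)) => k; rewrite lee_fin.
move: (tsum _) ge ge0 le1 => [r| |] // ge _ _.
have hr : 0 < sigma <= 1 by rewrite s0.
rewrite lee_fin; apply/ler_addgt0Pr => e e0.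
have /cvgrPdist_lt /(_ _ e0) [N _ hN] := rc_cvg0 hr.
have := hN N (leqnn N); rewrite /= sub0r normrN ger0_norm ?rc_ge0 ?subr_ge0 // => h.
have := ge N; rewrite lee_fin => h2; lra.
Qed.

Lemma Kser_le1 x : (Kser sigma x <= 1)%E.
Proof.
rewrite -tsum_bc; apply: le_tsum => n; rewrite lee_fin ler_piMr //; exact: wk_le1.
Qed.

Lemma Kser_ge0 x : (0 <= Kser sigma x)%E.
Proof. exact: ser_ge0e. Qed.

Lemma Kser_fin x : Kser sigma x \is a fin_num.
Proof.
by rewrite ge0_fin_numE ?Kser_ge0 // (le_lt_trans (Kser_le1 x)) // ltry.
Qed.

Lemma Kr_ge0 x y : 0 <= Kr x y.
Proof. by rewrite mulr_ge0 ?(ltW lams_gt0) // fine_ge0 // Kser_ge0. Qed.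

Lemma KrC x y : Kr x y = Kr y x.
Proof. by rewrite /Kr -opprB; congr (_ * fine _); exact: serN. Qed.

Lemma Gr_fin x : Gser alpha x \is a fin_num.
Proof. by rewrite Gser_fin // alpha_gt0. Qed.

Lemma GrH_fin x : Gser (alpha - sigma) x \is a fin_num.
Proof. by rewrite Gser_fin ?alphaB_gt0 // alphaB_lt. Qed.

Lemma Gr_gt0 x : 0 < Gr x.
Proof. by rewrite -lte_fin fineK ?Gr_fin // Gser_gt0 // alpha_gt0. Qed.

Lemma Hr_gt0 x : 0 < Hr x.
Proof.
by rewrite mulr_gt0 ?lams_gt0 // -lte_fin fineK ?GrH_fin // Gser_gt0 // alphaB_gt0.
Qed.

Lemma Kr_sum x : tsum (fun y => (Kr x y)%:E) = Sr%:E.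
Proof.
under eq_tsum do rewrite EFinM (fineK (Kser_fin _)).
rewrite tsumZ ?(ltW lams_gt0) //; last by move=> y; exact: Kser_ge0.
rewrite (tsum_subl (fun y => Kser sigma y) x) tsum_exchange; last first.
  by move=> y n; rewrite lee_fin mulr_ge0 // wk_ge0.
rewrite -[RHS]mule1 -tsum_bc; congr (_ * _)%E; apply: eq_tsum => n.
under eq_tsum do rewrite EFinM.
by rewrite tsumZ //; [rewrite tsum_wk // mule1|move=> y; exact: wk_ge0e].
Qed.

(** The coefficient identity [bc_conv] transported to kernels by convolution. *)
Lemma Kr_Gr x : (tsum (fun y => (Kr x y * Gr y)%:E) + (Hr x)%:E = (Sr * Gr x)%:E)%E.
Proof.
have -> : tsum (fun y => (Kr x y * Gr y)%:E) =
    ((lam `^ sigma)%:E * tsum (fun y => Kser sigma (x - y)%R * Gser alpha y))%E.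
  rewrite -tsumZ ?(ltW lams_gt0) //; last first.
    by move=> y; rewrite mule_ge0 ?Kser_ge0 //; exact: ser_ge0e.
  apply: eq_tsum => y; rewrite /Kr /Gr -mulrA EFinM; congr (_ * _)%E.
  by rewrite EFinM !fineK ?Kser_fin ?Gr_fin.
rewrite /Hr /Sr /Gr !EFinM !fineK ?GrH_fin ?Gr_fin // -ge0_muleDr; last 2 first.
- by apply: tsum_ge0 => y; rewrite mule_ge0 ?Kser_ge0 //; exact: ser_ge0e.
- exact: ser_ge0e.
congr (_ * _)%E.
rewrite (@ser_conv_diag _ _ d0 (bc sigma) (rc alpha)) //; last exact: Kser_fin.
have cb n : 0 <= \sum_(k < n.+1) bc sigma k * rc alpha (n - k).
  by apply: sumr_ge0 => k _; rewrite mulr_ge0.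
rewrite -[Gser (alpha - sigma) x]/(ser (rc (alpha - sigma)) x) -serD //.
by apply: eq_tsum => n; rewrite bc_conv subrK.
Qed.

Lemma ur_ser M x : (ur M x)%:E = ser (trunc (rc alpha) M) x.
Proof. by rewrite ser_trunc. Qed.

Lemma Hur_ser M x : (Hur M x)%:E = ((lam `^ sigma)%:E * ser (trunc (rc (alpha - sigma)) M) x)%E.
Proof. by rewrite ser_trunc // -EFinM. Qed.

Lemma ur_ge0 M x : 0 <= ur M x.
Proof. by apply: sumr_ge0 => n _; rewrite mulr_ge0 ?wk_ge0. Qed.

Lemma Hur_ge0 M x : 0 <= Hur M x.
Proof. by rewrite mulr_ge0 ?(ltW lams_gt0) //; apply: sumr_ge0 => n _; rewrite mulr_ge0 ?wk_ge0. Qed.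

Lemma trunc_le c M n : (forall k, 0 <= c k) -> trunc c M n <= c n :> R.
Proof. by move=> c0; rewrite /trunc; case: ifP. Qed.

Lemma ur_le M x : ur M x <= Gr x.
Proof.
rewrite -lee_fin ur_ser fineK ?Gr_fin //; apply: le_ser => // n; exact: trunc_le.
Qed.

Lemma Hur_le M x : Hur M x <= Hr x.
Proof.
rewrite ler_pM2l ?lams_gt0 // -lee_fin fineK ?GrH_fin // -ser_trunc //.
by apply: le_ser => // n; exact: trunc_le.
Qed.

Lemma ur_fsupp M : fsupp (ur M). Proof. exact: fsupp_walk_sum. Qed.

Lemma ur_cvg x : ur M x @[M --> \oo] --> Gr x.
Proof. by apply: ser_cvg => //; exact: Gr_fin. Qed.

Lemma ur_nd m n x : (m <= n)%N -> ur m x <= ur n x.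
Proof.
move=> mn; rewrite -(subnKC mn) /ur big_split_ord /= lerDl.
by apply: sumr_ge0 => k _; rewrite mulr_ge0 ?wk_ge0.
Qed.

(** Compared coefficient by coefficient: below M the two sides agree by [bc_conv]; from M on the
    left one is 0 and the convolution is nonnegative. *)
Lemma Kr_ur M x :
  ((Sr * ur M x)%:E <= tsum (fun y => (Kr x y * ur M y)%:E) + (Hur M x)%:E)%E.
Proof.
have tr0 c : (forall n, 0 <= c n) -> forall n, 0 <= trunc c M n :> R.
  by move=> c0 n; exact: trunc_ge0.
have -> : tsum (fun y => (Kr x y * ur M y)%:E) =
    ((lam `^ sigma)%:E * tsum (fun y => Kser sigma (x - y)%R * ser (trunc (rc alpha) M) y))%E.
  rewrite -tsumZ ?(ltW lams_gt0) //; last first.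
    by move=> y; rewrite mule_ge0 ?Kser_ge0 // ser_ge0e // => n; exact: tr0.
  apply: eq_tsum => y; rewrite /Kr -mulrA EFinM; congr (_ * _)%E.
  by rewrite EFinM fineK ?Kser_fin // ur_ser.
rewrite Hur_ser EFinM ur_ser -ge0_muleDr; last 2 first.
- by apply: tsum_ge0 => y; rewrite mule_ge0 ?Kser_ge0 // ser_ge0e // => n; exact: tr0.
- by rewrite ser_ge0e // => n; exact: tr0.
apply: lee_wpmul2l; first by rewrite lee_fin ltW // lams_gt0.
rewrite (@ser_conv_diag _ _ d0 (bc sigma)) //; last 2 first.
- by move=> n; exact: tr0.
- exact: Kser_fin.
have cb n : 0 <= \sum_(k < n.+1) bc sigma k * trunc (rc alpha) M (n - k).
  by apply: sumr_ge0 => k _; rewrite mulr_ge0 // tr0.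
rewrite -serD //; last by move=> n; exact: tr0.
apply: le_ser => // n; rewrite {1 3}/trunc; case: ifP => nM; last by rewrite addr0.
rewrite -lerBlDr -bc_conv le_eqVlt; apply/orP; left; apply/eqP; apply: eq_bigr => k _.
by rewrite /trunc (leq_ltn_trans (leq_subr _ _) nM).
Qed.

Lemma Kr_unit_gt0 x i : 0 < Kr (x + unitv i) x.
Proof.
rewrite mulr_gt0 ?lams_gt0 // addrC addKr -lte_fin fineK ?Kser_fin //.
apply: (@lt_le_trans _ _ (bc sigma 1 * wk 1 (unitv i))%:E).
  rewrite lte_fin mulr_gt0 //; first by rewrite /bc rc0 mulr1 divr_gt0.
  by rewrite wkE nwalks1 divr_gt0 // exprn_gt0 // lam_gt0.
by apply: (@tsum_ge1 _ _ (fun n => (bc sigma n * wk n (unitv i))%:E)) => n; rewrite lee_fin mulr_ge0 // wk_ge0.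
Qed.

Lemma Hr_ge0 x : 0 <= Hr x. Proof. by rewrite ltW // Hr_gt0. Qed.
Lemma Sr_ge0 : 0 <= Sr. Proof. by rewrite ltW // lams_gt0. Qed.
Lemma ur_ge0e M x : (0 <= (ur M x)%:E)%E. Proof. by rewrite lee_fin ur_ge0. Qed.
(** Instantiates a result on abstract kernels with the Riesz data. *)
Local Notation base L :=
  (L R _ Kr Gr Hr Sr Kr_ge0 KrC Gr_gt0 Hr_ge0 Sr_ge0 Kr_sum Kr_Gr).
Local Notation Q := (Qen Kr).
Local Notation En := (Een Kr Gr).
Local Notation W := (Wen Gr Hr).

Lemma QformE (f : Zd d -> R) : Qform sigma f = Q f.
Proof.
rewrite /Qform /Qen; congr (_ * _)%E; apply: eq_tsum => -[x y] /=; congr EFin.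
(* The two kernels may differ on the diagonal, where the increment of f vanishes. *)
have [->|xy] := eqVneq x y; first by rewrite [f y - f y]subrr expr0n !mulr0.
by rewrite kappa_pos // ?s0 // subr_eq0.
Qed.

Lemma wHardyE x : wHardy sigma alpha x = Hr x / Gr x.
Proof.
rewrite /wHardy (_ : sigma - alpha = - (alpha - sigma)); last by rewrite opprB.
rewrite !kappa_neg ?alphaB_gt0 ?alpha_gt0 // /Hr /Gr.
have -> : lam `^ (- (alpha - sigma)) = lam `^ sigma * lam `^ (- alpha).
  by rewrite -powRD ?(gt_eqF (lam_gt0 R d0)) ?implybT //; congr (_ `^ _); ring.
have h1 : lam `^ (- alpha) != 0 by rewrite gt_eqF // powR_gt0 // lam_gt0.
have h2 : fine (Gser alpha x) != 0 by rewrite gt_eqF // Gr_gt0.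
by field; rewrite h1 h2.
Qed.

Lemma wsumE (f : Zd d -> R) : wsum (wHardy sigma alpha) f = W f.
Proof. by apply: eq_tsum => x; rewrite wHardyE. Qed.

Lemma hardy_wHardy : hardy sigma (wHardy (d := d) sigma alpha).
Proof.
split=> [x|phi hphi]; first by rewrite wHardyE divr_ge0 ?ltW ?Hr_gt0 ?Gr_gt0.
rewrite wsumE QformE; exact: (base (@hardy_l2) (fsupp_l2 (hphi : fsupp phi))).
Qed.

Local Notation trunc_base L := (base L _ _ ur_ge0e ur_le Hur_ge0 Hur_le ur_fsupp).

Lemma critical_wHardy (C : R) : (forall M, (En (ur M) <= C%:E)%E) ->
  critical sigma (wHardy (d := d) sigma alpha).
Proof.
move=> EC; split; first exact: hardy_wHardy.
move=> [_ [w' [[w'0 hw'] [le ne]]]]; apply: ne; apply/funext => x.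
rewrite wHardyE; apply: (trunc_base (@ground_state_critical) ur_cvg Kr_ur EC) => //.
- by move=> f hf; rewrite -QformE; exact: hw'.
- by move=> y; rewrite -wHardyE.
Qed.

(** The sum is a convolution at the origin, and Vandermonde's identity adds the exponents alpha -
    sigma and alpha. This is where the threshold 2 alpha - sigma = d/2 enters. *)
Lemma tsum_HG : tsum (fun x => (Hr x * Gr x)%:E) =
  ((lam `^ sigma)%:E * Gser (2 * alpha - sigma)%R (0%R : Zd d))%E.
Proof.
have -> : Gser (2 * alpha - sigma)%R (0%R : Zd d) =
    tsum (fun x : Zd d => Gser (alpha - sigma)%R (0 - x)%R * Gser alpha x)%E.
  rewrite (@ser_conv_diag _ _ d0 (rc (alpha - sigma)) (rc alpha)) //; last exact: GrH_fin.
  by apply: eq_tsum => n; rewrite rc_vandermonde; congr (rc _ _ * _)%:E; ring.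
rewrite -tsumZ ?(ltW lams_gt0) //; last by move=> x; rewrite mule_ge0 //; exact: ser_ge0e.
apply: eq_tsum => x; rewrite /Hr /Gr -mulrA EFinM; congr (_ * _)%E.
rewrite EFinM !fineK ?GrH_fin ?Gr_fin // sub0r; congr (_ * _)%E.
by apply: esym; exact: serN.
Qed.

Lemma positive_critical_wHardy : 2 * alpha - sigma < d%:R / 2 ->
  positive_critical sigma (wHardy (d := d) sigma alpha).
Proof.
move=> ha; have h0 : 0 < 2 * alpha - sigma.
  by rewrite subr_gt0 (lt_trans sa) // mulr_natl mulr2n ltrDl alpha_gt0.
have HGf : tsum (fun x => (Hr x * Gr x)%:E) \is a fin_num.
  by rewrite tsum_HG fin_numM // Gser_fin.
have HG : (tsum (fun x => (Hr x * Gr x)%:E) < +oo)%E by rewrite ltey_eq HGf.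
have cvg0 (e : R) : 0 < e -> \forall n \near \oo,
    (Q (fun x => (ur n x - Gr x)%R) <= e%:E)%E.
  exact: (trunc_base (@Qen_defect) ur_cvg ur_nd Kr_ur HG).
split.
  apply: (@critical_wHardy (fine (tsum (fun x => (Hr x * Gr x)%:E)))) => M.
  rewrite fineK //; apply: le_trans (trunc_base (@Een_truncation_HG) Kr_ur M) _.
  apply: le_tsum => x; rewrite lee_fin ler_wpM2l ?Hr_ge0 //.
  by rewrite lerBlDr lerDl ur_ge0.
exists Gr; split; last split.
- exists ur; split=> [n|e e0]; first exact: ur_fsupp.
  have e2 : 0 < e / 2 by rewrite divr_gt0.
  have [N1 _ h1] := cvg0 _ e2.
  have /cvgrPdist_lt /(_ (Num.sqrt (e / 2))) := @ur_cvg 0.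
  rewrite sqrtr_gt0 => /(_ e2) [N2 _ h2].
  exists (maxn N1 N2) => n; rewrite geq_max => /andP[n1 n2].
  rewrite QformE (_ : e%:E = (e / 2)%:E + (e / 2)%:E)%E; last by rewrite -EFinD -splitr.
  apply: leeD; first exact: h1.
  rewrite lee_fin -real_normK ?num_real // distrC -[leRHS](@sqr_sqrtr _ (e / 2)) ?(ltW e2) //.
  by rewrite lerXn2r ?nnegrE ?normr_ge0 ?sqrtr_ge0 // ltW // h2.
- move=> /(congr1 (fun f => f 0)) h; have := @Gr_gt0 0; rewrite h ltxx //.
- rewrite wsumE QformE; apply/eqP; rewrite eq_le; apply/andP; split.
    exact: (trunc_base (@Qen_G_le) ur_cvg Kr_ur HG).
  have := (base (@Qen_energy_space) ur_fsupp ur_cvg cvg0).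
  apply: le_trans; rewrite leeDr //; apply: Een_ge0 => //; [exact: Kr_ge0|exact: Gr_gt0].
Qed.

(* [rc s] sums to at most [rc (s + 1) M] over the indices below [M], and this is the
   reciprocal of the bound [rc_tail] on the indices from [M] on. *)
Lemma Een_ur_bound : 2 * alpha - sigma = d%:R / 2 ->
  exists C : R, forall M, (En (ur M) <= C%:E)%E.
Proof.
move=> ha; pose s := alpha - sigma.
have ps : alpha + s = d%:R / 2 by rewrite /s -ha; ring.
pose B := walk_const R d; have B0 : 0 <= B by rewrite ltW // walk_const_gt0.
pose tail M n : R := if (n < M)%N then 0 else rc alpha n.
have tail0 M n : 0 <= tail M n by rewrite /tail; case: ifP.
exists (lam `^ sigma * (B * ((s + 1) / s))) => M.
apply: le_trans (trunc_base (@Een_truncation) Kr_ur M) _.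
have Gu x : (Gr x - ur M x)%:E = ser (tail M) x.
  have : Gser alpha x = (ser (trunc (rc alpha) M) x + ser (tail M) x)%E.
    rewrite -serD //; last by move=> n; exact: trunc_ge0.
    by apply: eq_tsum => n; rewrite /trunc /tail; case: ifP; rewrite ?addr0 ?add0r.
  rewrite -ur_ser -[Gser alpha x]fineK ?Gr_fin // -/(Gr x).
  have : (0 <= ser (tail M) x)%E by exact: ser_ge0e.
  case: (ser _ _) => [r||] // _.
  by rewrite -EFinD => -[->]; rewrite addrC addKr.
have tr0 n : 0 <= trunc (rc s) M n by apply: trunc_ge0; exact: rc_alphaB_ge0.
have trfin x : ser (trunc (rc s) M) x \is a fin_num by rewrite ser_trunc // => n; exact: rc_alphaB_ge0.
have -> : tsum (fun x => ((Gr x - ur M x) * Hur M x)%:E) =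
   ((lam `^ sigma)%:E * tsum (fun x => ser (trunc (rc s) M) (0 - x)%R * ser (tail M) x))%E.
  rewrite -tsumZ ?(ltW lams_gt0) //; last by move=> x; rewrite mule_ge0 // ser_ge0e.
  by apply: eq_tsum => x; rewrite EFinM Gu Hur_ser sub0r serN // muleC muleA.
rewrite ser_conv // [leRHS]EFinM; apply: lee_wpmul2l; first by rewrite lee_fin ltW // lams_gt0.
have s0' : 0 < s by exact: alphaB_gt0.
have rs1 := rc_gt0 M (addr_gt0 s0' ltr01).
pose Tl := (s + 1) / s / rc (s + 1) M.
apply: (@le_trans _ _ (tsum (fun m => (trunc (rc s) M m)%:E * (B * Tl)%:E))%E).
  apply: le_tsum => m.
  apply: (@le_trans _ _ ((trunc (rc s) M m)%:E * (B%:E * tsum (fun k =>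
      (rc alpha (M + k) * expR (- (d%:R / 2 * har R (M + k))))%:E)))%E); last first.
    apply: lee_wpmul2l; first by rewrite lee_fin.
    rewrite [leRHS]EFinM; apply: lee_wpmul2l; first by rewrite lee_fin.
    by apply: rc_tail => //; rewrite ltW // alpha_gt0.
  have te k : (0 <= (rc alpha (M + k) * expR (- (d%:R / 2 * har R (M + k))))%:E)%E.
    by rewrite lee_fin mulr_ge0 ?expR_ge0.
  rewrite -tsumZ // -tsumZ //; last by move=> k; rewrite mule_ge0 ?te // lee_fin.
  rewrite (@tsum_inj _ (addn M)); first last.
  - move=> n hn; rewrite /tail; case: ltnP => [_|Mn]; first by rewrite mulr0 mul0r.
    by case: (hn (n - M)%N); rewrite subnKC.
  - by move=> n; rewrite lee_fin mulr_ge0 ?wk_ge0 // mulr_ge0.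
  - by move=> i j /addnI.
  apply: le_tsum => k; rewrite -!EFinM lee_fin /tail ltnNge leq_addr /= -mulrA ler_wpM2l //.
  rewrite [leRHS]mulrCA ler_wpM2l //.
  (* The m additional steps are dropped, the decay bound being nonincreasing in time. *)
  apply: (le_trans (@wk_decay R d d0 _ _)).
  rewrite ler_wpM2l // ler_expR lerN2 ler_wpM2l ?divr_ge0 // (addnC m); exact: har_nd.
have BT0 : 0 <= B * Tl by rewrite mulr_ge0 // /Tl !divr_ge0 // ltW // addr_gt0.
under eq_tsum do rewrite muleC.
rewrite tsumZ //.
have tb : (tsum (fun m => (trunc (rc s) M m)%:E) <= (rc (s + 1) M)%:E)%E.
  rewrite (tsum_seq (s := index_iota 0 M)).
  - rewrite sumEFin big_mkord lee_fin -rc_sum big_ord_recr /=.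
    apply: (@le_trans _ _ (\sum_(k < M) rc s k)); last by rewrite lerDl rc_alphaB_ge0.
    by apply: ler_sum => k _; apply: trunc_le; exact: rc_alphaB_ge0.
  - by move=> n; rewrite lee_fin.
  - exact: iota_uniq.
  - by move=> n; rewrite mem_index_iota /= /trunc => /negbTE ->.
apply: le_trans (lee_wpmul2l _ tb) _; first by rewrite lee_fin.
rewrite -EFinM lee_fin /Tl le_eqVlt; apply/orP; left; apply/eqP.
by field; rewrite !gt_eqF.
Qed.

Lemma Qen_sub_le f g : (Q (fun x => f x - g x)%R <= 2%:E * (Q f + Q g))%E.
Proof.
have t0 h p : (0 <= (Kr p.1 p.2 * (h p.1 - h p.2) ^+ 2)%:E)%E.
  by rewrite lee_fin mulr_ge0 ?Kr_ge0 // sqr_ge0.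
rewrite /Qen -ge0_muleDr ?tsum_ge0 //.
rewrite muleCA; apply: lee_wpmul2l; first by rewrite lee_fin invr_ge0.
rewrite -tsumD; last 2 first.
- by move=> p; exact: (t0 f).
- by move=> p; exact: (t0 g).
rewrite -tsumZ //; last by move=> p; rewrite adde_ge0 ?(t0 f) ?(t0 g).
apply: le_tsum => p; rewrite -EFinD -EFinM lee_fin -mulrDr [leRHS]mulrCA.
apply: ler_wpM2l; first exact: Kr_ge0.
set a := f p.1; set b := g p.1; set c := f p.2; set e := g p.2.
have := sqr_ge0 ((a - c) + (b - e))%R; nra.
Qed.

Lemma Kr_step_le f x i (e : R) : (Q f <= e%:E)%E ->
  Kr (x + unitv i) x * (f (x + unitv i) - f x) ^+ 2 <= 2 * e.
Proof.
move=> h; rewrite -lee_fin; pose p := (x + unitv i, x).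
have t0 q : (0 <= (Kr q.1 q.2 * (f q.1 - f q.2) ^+ 2)%:E)%E.
  by rewrite lee_fin mulr_ge0 ?Kr_ge0 // sqr_ge0.
apply: le_trans (@tsum_ge1 _ _ (fun q => (Kr q.1 q.2 * (f q.1 - f q.2) ^+ 2)%:E) p t0) _.
move: h; rewrite /Qen; set S := tsum _.
have : (0 <= S)%E by exact: tsum_ge0.
case: S => [r||] // _.
- by rewrite -EFinM !lee_fin; lra.
- by rewrite gt0_muley ?lte_fin ?invr_gt0.
Qed.

(** The norm controls the value at 0, and Q controls the increment over each edge since [Kr] is
    positive there; pointwise convergence spreads from 0 along edges by [Zd_ind]. *)
Lemma D0_cvg (phi : nat -> Zd d -> R) v :
  (forall e : R, 0 < e -> exists N, forall n, (N <= n)%N ->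
     (Q (fun x => (phi n x - v x)%R) + ((phi n 0 - v 0) ^+ 2)%R%:E <= e%:E)%E) ->
  (forall e : R, 0 < e -> \forall n \near \oo, (Q (fun x => (phi n x - v x)%R) <= e%:E)%E) /\
  forall x, phi n x @[n --> \oo] --> v x.
Proof.
move=> hD; have Q0 h : (0 <= Q h)%E by apply: Qen_ge0; exact: Kr_ge0.
have hQ (e : R) : 0 < e -> \forall n \near \oo, (Q (fun x => (phi n x - v x)%R) <= e%:E)%E.
  move=> e0; have [N hN] := hD e e0; exists N => // n /= /hN; apply: le_trans.
  by rewrite leeDl // lee_fin sqr_ge0.
split=> //.
have small (z : R) (e : R) : 0 < e -> z ^+ 2 <= e ^+ 2 -> `|z| <= e.
  by move=> e0; rewrite -[z ^+ 2]real_normK ?num_real // ler_pXn2r ?nnegrE ?normr_ge0 ?(ltW e0).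
have diff x i (e : R) : 0 < e -> \forall n \near \oo,
    `|(phi n (x + unitv i) - v (x + unitv i)) - (phi n x - v x)| <= e.
  move=> e0; have k0 := @Kr_unit_gt0 x i.
  have ke : 0 < Kr (x + unitv i) x * e ^+ 2 / 2 by rewrite divr_gt0 // mulr_gt0 // exprn_gt0.
  apply: filterS (hQ _ ke) => n hn; apply: small => //.
  have := Kr_step_le x i hn; rewrite (mulrC 2) divfK // ler_pM2l //.
apply: Zd_ind.
- apply/cvgrPdist_le => e e0; have e2 : 0 < e ^+ 2 by rewrite exprn_gt0.
  have [N hN] := hD _ e2; exists N => // n /= /hN h.
  rewrite distrC; apply: small => //; rewrite -lee_fin; apply: le_trans h.
  by rewrite leeDr.
- move=> x i /cvgrPdist_le hx; apply/cvgrPdist_le => e e0.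
  have e2 : 0 < e / 2 by rewrite divr_gt0.
  apply: filterS2 (hx _ e2) (diff x i _ e2) => n; rewrite distrC => h1 h2.
  rewrite distrC; set A := phi n (x + unitv i) - v (x + unitv i) in h2 *.
  rewrite -[A](subrK (phi n x - v x)) (splitr e); apply: le_trans (ler_normD _ _) _.
  exact: lerD.
- move=> x i /cvgrPdist_le hx; apply/cvgrPdist_le => e e0.
  have e2 : 0 < e / 2 by rewrite divr_gt0.
  apply: filterS2 (hx _ e2) (diff (x - unitv i) i _ e2) => n; rewrite subrK distrC => h1 h2.
  rewrite distrC; set A := phi n (x - unitv i) - v (x - unitv i) in h2 *.
  rewrite -[A](subKr (phi n x - v x)) (splitr e); apply: le_trans (ler_normB _ _) _.
  exact: lerD.
Qed.

Lemma Een_eq0_Gr v : En v = 0%E -> forall x, v x = v 0 / Gr 0 * Gr x.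
Proof.
move=> E0 x; have e0 y i : v (y + unitv i) / Gr (y + unitv i) = v y / Gr y.
  by apply: (Een_eq0 Kr_ge0 Gr_gt0 E0); exact: Kr_unit_gt0.
suff -> : v 0 / Gr 0 = v x / Gr x by rewrite divfK // gt_eqF // Gr_gt0.
elim/Zd_ind: x => [//|x i ->|x i ->]; first by rewrite e0.
by rewrite -[in LHS](subrK (unitv i) x) e0.
Qed.

Lemma null_critical_wHardy : 2 * alpha - sigma = d%:R / 2 ->
  null_critical sigma (wHardy (d := d) sigma alpha).
Proof.
move=> ha; split.
  by have [C hC] := Een_ur_bound ha; exact: critical_wHardy hC.
move=> [_ [v [[phi [phif hD]] [v0 QW]]]].
have Q0 h : (0 <= Q h)%E by apply: Qen_ge0; exact: Kr_ge0.
have [hQ hx] : (forall e : R, 0 < e -> \forall n \near \oo, (Q (fun x => (phi n x - v x)%R) <= e%:E)%E) /\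
  (forall x, phi n x @[n --> \oo] --> v x).
  apply: D0_cvg => e e0; have [N hN] := hD e e0; exists N => n /hN.
  by rewrite QformE.
have EWQ := (base (@Qen_energy_space) phif hx hQ).
move: QW; rewrite wsumE QformE => QW.
(* Finiteness of Q(v), from v = phi_N - (phi_N - v), allows W(v) = Q(v) to be cancelled, and in the
   end contradicts W(v) = +oo. *)
have Qf : Q v \is a fin_num.
  rewrite ge0_fin_numE //; have [N _ /(_ N (leqnn N)) /= hN] := hQ 1 ltr01.
  have -> : v = (fun x => phi N x - (phi N x - v x)) by apply/funext => x; rewrite subKr.
  apply: le_lt_trans (Qen_sub_le _ _) _.
  have := Qen_fin Kr_ge0 KrC Sr_ge0 Kr_sum (phif N : fsupp (phi N)).
  move: (Q (phi N)) (Q0 (phi N)) => [r||] // _ _.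
  apply: (@le_lt_trans _ _ (2%:E * (r%:E + 1%:E))%E); last by rewrite -EFinD -EFinM ltry.
  by apply: lee_wpmul2l => //; rewrite leeD2l.
have E0 : En v = 0%E.
  move: EWQ; rewrite -QW -[leRHS]add0e leeD2rE // => h.
  by apply/eqP; rewrite eq_le h Een_ge0 //; [exact: Kr_ge0|exact: Gr_gt0].
have vG := Een_eq0_Gr E0.
set c := v 0 / Gr 0 in vG.
have c0 : c != 0.
  by apply/negP => /eqP c0; apply: v0; apply/funext => x; rewrite vG c0 mul0r.
have Winf : W v = +oo%E.
  have -> : W v = ((c ^+ 2)%:E * tsum (fun x => (Hr x * Gr x)%:E))%E.
    rewrite -tsumZ ?sqr_ge0 //; last by move=> x; rewrite lee_fin mulr_ge0 ?ltW ?Hr_gt0 ?Gr_gt0.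
    apply: eq_tsum => x; rewrite -EFinM; congr EFin; rewrite vG.
    by field; rewrite gt_eqF // Gr_gt0.
  rewrite tsum_HG ha Gser_half_infty // gt0_muley ?lte_fin ?lams_gt0 //.
  by rewrite gt0_muley // lte_fin exprn_even_gt0.
by move: Qf; rewrite QW Winf.
Qed.

End riesz_forms.

(** * Subcriticality *)

Section dyadic_averages.
Variables (R : realType) (d : nat).
Hypothesis d0 : (0 < d)%N.
Implicit Types (x y : Zd d) (f g : Zd d -> R) (m n : nat).

(** Doubling number m is along axis m mod d, where the side is still 2^(m/d) with integer division;
    thus the sides stay within a factor 2 of each other. *)
Definition axis m : 'I_d := Ordinal (ltn_pmod m d0).
Definition side m : nat := 2 ^ (m %/ d).
Definition jump m : Zd d := unitv (axis m) *+ side m.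

(** The recursive form gives linearity, Jensen's inequality and the effect of one doubling by
    induction, with no count of points. *)
Fixpoint avg m f : R :=
  if m is n.+1 then (avg n f + avg n (fun x => f (x + jump n))) / 2 else f 0.

(* [avg m] is the mean over this box, whose sides double one after the other. *)
Definition in_box m x : bool :=
  [forall j : 'I_d, (0 <= x ord0 j) && (x ord0 j < (side m * 2 ^ (j < m %% d))%N%:Z)].

Lemma unitv_mulrn i n (j : 'I_d) : (unitv i *+ n) ord0 j = if j == i then n%:Z else 0.
Proof.
rewrite mulmxnE mxE [i == j]eq_sym; case: (j == i); first by rewrite [true%:R]mulr1n natz.
by rewrite [false%:R]mulr0n mul0rn.
Qed.

Lemma side_gt0 m : (0 < side m)%N. Proof. by rewrite expn_gt0. Qed.

Lemma box_sideS m (j : 'I_d) : (side m.+1 * 2 ^ (j < m.+1 %% d) =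
  side m * 2 ^ (j < m %% d) * 2 ^ (j == axis m))%N.
Proof.
have -> : (j == axis m) = (j == m %% d :> nat)%N by [].
have jd := ltn_ord j; have md := ltn_pmod m d0.
rewrite /side divnS // modnS -!expnD; congr (_ ^ _)%N.
(* At the end of a round, when d divides m+1, the last axis is doubled and all sides agree again. *)
have [dm|ndm] := boolP (d %| m.+1)%N; last by move: (m %/ d)%N (m %% d)%N md => a b md; lia.
have : (d %| (m %% d).+1)%N.
  by move: dm; rewrite {1}(divn_eq m d) -addnS dvdn_addr // dvdn_mull.
move/(dvdn_leq (ltn0Sn _)); move: (m %/ d)%N (m %% d)%N md => a b; lia.
Qed.

Lemma in_box0 x : in_box 0 x = (x == 0).
Proof.
apply/forallP/eqP => [h|-> j]; last by rewrite mxE /side div0n mod0n.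
by apply/rowP => j; have := h j; rewrite mxE /side div0n mod0n /= expn0; move: (x ord0 j) => z; lia.
Qed.

Lemma in_boxS_ax m x : in_box m x -> (x ord0 (axis m) < (side m)%:Z) /\
  forall k : nat, (k <= side m)%N -> in_box m.+1 (x + unitv (axis m) *+ k).
Proof.
move=> /forallP bx; have := bx (axis m); rewrite /= ltnn muln1 => /andP[x0 x1].
split=> // k ks; apply/forallP => j; rewrite mxE unitv_mulrn box_sideS.
have /andP[] := bx j; case: (altP (j =P axis m)) => [->|_].
  by rewrite /= ltnn muln1 expn1 => ? ?; lia.
by rewrite addr0 expn0 muln1 => -> ->.
Qed.

Lemma in_boxS m x : in_box m x -> in_box m.+1 x.
Proof. by move=> /in_boxS_ax[_ /(_ 0%N isT)]; rewrite mulr0n addr0. Qed.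

Lemma in_box_jump m x : in_box m x -> in_box m.+1 (x + jump m).
Proof. by move=> /in_boxS_ax[_ /(_ (side m) (leqnn _))]. Qed.

Lemma notin_box_jump m x : in_box m x -> ~~ in_box m (x + jump m).
Proof.
move=> bx; have := bx; move=> /forallP/(_ (axis m))/andP[x0 _].
apply/negP => /in_boxS_ax[]; rewrite mxE unitv_mulrn eqxx; move: (x ord0 _) x0 => z; lia.
Qed.

Lemma in_box_bound m x j : in_box m x -> `|x ord0 j| <= (2 * side m)%N%:Z.
Proof.
move=> /forallP/(_ j)/andP[x0 x1]; rewrite ger0_norm //.
have : (side m * 2 ^ (j < m %% d) <= 2 * side m)%N by rewrite mulnC leq_mul2r; case: (_ < _)%N; rewrite ?orbT.
by move: (x ord0 j) x0 x1 => u; lia.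
Qed.

Lemma in_box_diff m x y j : in_box m x -> in_box m y ->
  `|(x - y) ord0 j| <= (2 * side m)%N%:Z.
Proof.
move=> /forallP/(_ j)/andP[x0 x1] /forallP/(_ j)/andP[y0 y1]; rewrite !mxE.
have : (side m * 2 ^ (j < m %% d) <= 2 * side m)%N by rewrite mulnC leq_mul2r; case: (_ < _)%N; rewrite ?orbT.
by move: (x ord0 j) (y ord0 j) x0 x1 y0 y1 => u v; lia.
Qed.

Lemma sideS_le m : (side m.+1 <= 2 * side m)%N.
Proof. by rewrite /side divnS //; case: (d %| m.+1)%N; rewrite ?add0n ?expnS ?leq_pmull. Qed.

Lemma side_expn_le m : (side m ^ d <= 2 ^ m)%N.
Proof. by rewrite /side -expnM leq_exp2l // leq_divM. Qed.

Lemma avg_lin m (a b : R) f g : avg m (fun x => a * f x + b * g x) = a * avg m f + b * avg m g.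
Proof. by elim: m f g => [//|m IH] f g /=; rewrite !IH; ring. Qed.

Lemma avgB m f g : avg m (fun x => f x - g x) = avg m f - avg m g.
Proof.
rewrite -[avg m f]mul1r -[X in _ - X]mul1r -mulNr -avg_lin; congr (avg m _).
by apply/funext => x; rewrite mul1r mulN1r.
Qed.

Lemma avgZ m (a : R) f : avg m (fun x => a * f x) = a * avg m f.
Proof. by elim: m f => [//|m IH] f /=; rewrite !IH; ring. Qed.

Lemma avg_cst m (a : R) : avg m (fun=> a) = a.
Proof. by elim: m => [//|m /= ->]; field. Qed.

Lemma avg_sum m (I : Type) (r : seq I) (F : I -> Zd d -> R) :
  avg m (fun x => \sum_(i <- r) F i x) = \sum_(i <- r) avg m (F i).
Proof.
elim: r => [|i r IH].
  by rewrite big_nil -[RHS](avg_cst m); congr (avg m _); apply/funext => x; rewrite big_nil.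
rewrite big_cons -IH -[avg m (F i)]mul1r -[X in _ + X]mul1r -avg_lin; congr (avg m _).
by apply/funext => x; rewrite big_cons !mul1r.
Qed.

Lemma le_avg m f g : (forall x, f x <= g x) -> avg m f <= avg m g.
Proof.
elim: m f g => [|m IH] f g fg /=; first exact: fg.
by rewrite ler_wpM2r ?invr_ge0 // lerD // IH.
Qed.

Lemma avg_sqr m f : (avg m f) ^+ 2 <= avg m (fun x => f x ^+ 2).
Proof.
elim: m f => [//|m IH] f /=.
have h1 := IH f; have h2 := IH (fun x => f (x + jump m)).
move: (avg m f) (avg m (fun x => f (x + jump m))) h1 h2 => a b h1 h2.
have := sqr_ge0 (a - b); nra.
Qed.

(** Box m and its translate by [jump m] are disjoint, so that their indicators add up to at most
    that of box m+1. *)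
Lemma avg_le_tsum m f : (forall x, 0 <= f x) ->
  ((avg m f)%:E <= (2^-1 ^+ m)%:E * tsum (fun x => ((in_box m x)%:R * f x)%:E))%E.
Proof.
have b0 n g x : (forall y, 0 <= g y) -> (0 <= ((in_box n x)%:R * g x)%:E)%E.
  by move=> g0; rewrite lee_fin mulr_ge0.
elim: m f => [|m IH] f f0.
  rewrite expr0 mul1e /=; apply: le_trans (@tsum_ge1 _ _ _ 0 _) => [|x]; last exact: b0.
  by rewrite in_box0 eqxx mul1r.
have h1 := IH f f0; have h2 := IH (fun x => f (x + jump m)) (fun x => f0 _).
rewrite /= mulrC EFinM.
apply: (@le_trans _ _ (2^-1%:E * ((2^-1 ^+ m)%:E * (tsum (fun x => ((in_box m x)%:R * f x)%:E) +
    tsum (fun x => ((in_box m x)%:R * f (x + jump m))%:E))))%E).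
  apply: lee_wpmul2l; first by rewrite lee_fin invr_ge0.
  rewrite ge0_muleDr; last 2 first.
  - by apply: tsum_ge0 => x; exact: b0.
  - by apply: tsum_ge0 => x; apply: (b0 _ (fun y => f (y + jump m))) => y.
  by rewrite EFinD leeD.
rewrite muleA -EFinM -exprS; apply: lee_wpmul2l; first by rewrite lee_fin exprn_ge0 // invr_ge0.
rewrite -(tsum_shift (fun x => ((in_box m x)%:R * f (x + jump m))%:E) (- jump m)).
rewrite -tsumD; last 2 first.
- by move=> x; exact: b0.
- by move=> x; rewrite lee_fin mulr_ge0.
apply: le_tsum => x; rewrite -EFinD lee_fin subrK -mulrDl ler_wpM2r //.
rewrite -natrD ler_nat.
have [h|h] := boolP (in_box m (x - jump m)).
  have := notin_box_jump h; have := in_box_jump h; rewrite subrK => -> /negbTE -> //.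
by rewrite addn0; have [/in_boxS ->|] := boolP (in_box m x).
Qed.

Lemma avg_fsupp_le m f (S : R) : (forall x, 0 <= f x) ->
  (tsum (fun x => (f x)%:E) <= S%:E)%E -> avg m f <= 2^-1 ^+ m * S.
Proof.
move=> f0 fS; rewrite -lee_fin; apply: le_trans (avg_le_tsum m f0) _.
rewrite [leRHS]EFinM; apply: lee_wpmul2l; first by rewrite lee_fin exprn_ge0 // invr_ge0.
apply: le_trans fS; apply: le_tsum => x; rewrite lee_fin ler_piMl //.
by rewrite lern1 leq_b1.
Qed.

Lemma avg2_le_tsum m (F : Zd d -> Zd d -> R) : (forall x y, 0 <= F x y) ->
  ((avg m (fun x => avg m (F x)))%:E <= (2^-1 ^+ m * 2^-1 ^+ m)%:E *
     tsum (fun p => ((in_box m p.1)%:R * (in_box m p.2)%:R * F p.1 p.2)%:E))%E.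
Proof.
move=> F0; have c0 : 0 <= 2^-1 ^+ m :> R by rewrite exprn_ge0 // invr_ge0.
have a0 x : 0 <= avg m (F x) by rewrite -(avg_cst m 0); exact: le_avg.
apply: le_trans (avg_le_tsum m a0) _.
rewrite EFinM -muleA; apply: lee_wpmul2l; first by rewrite lee_fin.
have t0 x y : (0 <= ((in_box m x)%:R * (in_box m y)%:R * F x y)%:E)%E.
  by rewrite lee_fin !mulr_ge0.
rewrite -(tsum_pair t0) -tsumZ //; last by move=> x; exact: tsum_ge0.
apply: le_tsum => x; rewrite EFinM.
apply: (le_trans (lee_wpmul2l _ (avg_le_tsum m (F0 x)))); first by rewrite lee_fin.
rewrite muleCA; apply: lee_wpmul2l; first by rewrite lee_fin.
rewrite -tsumZ //; last by move=> y; rewrite lee_fin mulr_ge0.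
by apply: le_tsum => y; rewrite -EFinM mulrA.
Qed.

Lemma avgS_sub m f : avg m.+1 f - avg m f = avg m (fun x => f (x + jump m) - f x) / 2.
Proof. by rewrite avgB /=; field. Qed.

Lemma sum_side_geom (r : R) n : \sum_(m < d * n) r ^+ (m %/ d) = d%:R * \sum_(q < n) r ^+ q.
Proof.
elim: n => [|n IH]; first by rewrite muln0 !big_ord0 mulr0.
rewrite mulnS addnC big_split_ord /= IH big_ord_recr /= mulrDr; congr (_ + _).
rewrite (eq_bigr (fun=> r ^+ n)) => [|j _]; first by rewrite sumr_const card_ord mulr_natl.
by rewrite mulnC divnMDl // divn_small // addn0.
Qed.

(* If the successive averages move by at most a geometric amount, the value at
   the origin, which is [avg 0], is controlled since the averages tend to 0. *)
Lemma avg_telescope f (S E r : R) : 0 <= r < 1 -> 0 <= E ->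
  (tsum (fun x => `|f x|%:E) <= S%:E)%E ->
  (forall m, (avg m.+1 f - avg m f) ^+ 2 <= E ^+ 2 * (r ^+ (m %/ d)) ^+ 2) ->
  `|f 0| <= E * (d%:R / (1 - r)).
Proof.
move=> /andP[r0 r1] E0 fS step.
have S0 : 0 <= S by rewrite -lee_fin (le_trans _ fS) // tsum_ge0.
have st m : `|avg m.+1 f - avg m f| <= E * r ^+ (m %/ d).
  rewrite -(@ler_pXn2r _ 2) ?nnegrE ?normr_ge0 ?mulr_ge0 ?exprn_ge0 //.
  by rewrite real_normK ?num_real // exprMn.
have tele m : `|f 0| <= `|avg m f| + E * \sum_(k < m) r ^+ (k %/ d).
  elim: m => [|m IH]; first by rewrite big_ord0 mulr0 addr0.
  rewrite big_ord_recr mulrDr; move: (st m) IH; rewrite /=.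
  move: (avg m f) (\sum_(_ < m) _) => b t.
  set a := (_ + _) / 2 => hb /le_trans; apply; rewrite addrA (addrAC _ (E * t)) lerD2r.
  have -> : b = a - (a - b) by rewrite subKr.
  by apply: le_trans (ler_normB _ _) _; rewrite lerD2l.
have geom n : \sum_(q < n) r ^+ q <= (1 - r)^-1.
  have r1' : 0 < 1 - r by rewrite subr_gt0.
  rewrite -[leRHS]mul1r ler_pdivlMr //.
  suff -> : (\sum_(q < n) r ^+ q) * (1 - r) = 1 - r ^+ n by rewrite lerBlDr lerDl exprn_ge0.
  elim: n => [|n IH]; first by rewrite big_ord0 mul0r subrr.
  by rewrite big_ord_recr mulrDl IH exprS; ring.
have sum_le m : \sum_(k < m) r ^+ (k %/ d) <= d%:R / (1 - r).
  apply: (@le_trans _ _ (\sum_(k < d * m) r ^+ (k %/ d))).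
    rewrite -(subnKC (leq_pmull m d0)) big_split_ord /= lerDl.
    by apply: sumr_ge0 => k _; rewrite exprn_ge0.
  by rewrite sum_side_geom ler_wpM2l.
(* As 2^M exceeds S/e, the average over box M, at most 2^-M S in absolute value, is at most e. *)
apply/ler_addgt0Pl => e e0; pose M := (Num.truncn (S / e)).+1.
apply: le_trans (tele M) _; apply: lerD; last by rewrite ler_wpM2l.
have := @avg_fsupp_le M (fun x => `|f x|) S (fun x => normr_ge0 _) fS.
have h : 2^-1 ^+ M * S <= e.
  rewrite exprVn ler_pdivrMl ?exprn_gt0 // mulrC -ler_pdivrMl // mulrC.
  apply: ltW; apply: lt_le_trans (truncnS_gt _) _.
  by rewrite -natrX ler_nat ltnW // ltn_expl.
move=> h2; apply: le_trans (le_trans h2 h).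
rewrite ler_norml; apply/andP; split.
  rewrite lerNl -mulN1r -avgZ; apply: le_avg => x; rewrite mulN1r; by rewrite -normrN ler_norm.
by apply: le_avg => x; exact: ler_norm.
Qed.

End dyadic_averages.

(** * Control of the value at the origin by the energy *)

Section subcritical_range.
Variables (R : realType) (d : nat) (sigma alpha : R).
Hypothesis d0 : (0 < d)%N.
Hypothesis s0 : 0 < sigma.
Hypothesis s1 : sigma <= 1.
Hypothesis sa : sigma < alpha.
Hypothesis ad : alpha < d%:R / 2.
Hypothesis a0d : d%:R + 2 * sigma < 4 * alpha.
Implicit Types (x y : Zd d) (m n N : nat).
Local Notation lam := (@deg R d).
Local Notation Kr := (@Kr R d sigma).
Local Notation Gr := (@Gr R d alpha).
Local Notation Hr := (@Hr R d sigma alpha).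
Local Notation Q := (Qen Kr).
Local Notation En := (Een Kr Gr).
Local Notation W := (Wen Gr Hr).
Local Notation side := (side d).
Local Notation jump := (jump d0).

Let alpha0 : 0 < alpha. Proof. exact: lt_trans sa. Qed.
Let Gr0 x : 0 < Gr x. Proof. exact: (Gr_gt0 d0 s0 sa ad). Qed.
Let Kr0 x y : 0 <= Kr x y. Proof. exact: (Kr_ge0 d0 s0 s1). Qed.

(** [T] is the time that [heat_lower] requires for coordinates up to 2N, comparable to N^2: as 4N+1
    <= 5N, 2T is at most 16 * 25 N^2 = (20 N)^2. *)
Lemma time_scale : exists2 q : R, 0 < q & forall N, (0 < N)%N ->
  let T : R := 8 * (2 * (2 * N) + 1)%:R ^+ 2 in
  [/\ 0 < T, N%:R ^+ 2 <= T, 2 * T <= (q * N%:R) ^+ 2 &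
      (20 * q * N%:R)^-1 ^+ d <= (20 * Num.sqrt (2 * T))^-1 ^+ d].
Proof.
exists 20 => // N N0 T.
have n0 : 0 < N%:R :> R by rewrite ltr0n.
have v0 : 0 < (2 * (2 * N) + 1)%:R :> R by rewrite ltr0n addn1.
have h5 : (2 * (2 * N) + 1)%:R <= 5 * N%:R :> R.
  by rewrite -natrM ler_nat; clear -N0; lia.
have h1 : N%:R <= (2 * (2 * N) + 1)%:R :> R by rewrite ler_nat; clear; lia.
have T0 : 0 < T by rewrite mulr_gt0 // exprn_gt0.
have T2 : 2 * T <= (20 * N%:R) ^+ 2.
  rewrite /T; move: ((2 * (2 * N) + 1)%:R) v0 (N%:R) n0 h5 => v v0 z z0 h5.
  by nra.
split=> //.
  rewrite /T; move: ((2 * (2 * N) + 1)%:R) v0 (N%:R) n0 h1 => v v0 z z0 h1.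
  by nra.
have sT : Num.sqrt (2 * T) <= 20 * N%:R.
  by rewrite -[leRHS]ger0_norm ?mulr_ge0 // -sqrtr_sqr ler_wsqrtr.
have sT0 : 0 < Num.sqrt (2 * T) by rewrite sqrtr_gt0 mulr_gt0.
apply: lerXn2r; rewrite ?nnegrE ?invr_ge0 ?mulr_ge0 ?sqrtr_ge0 //.
by rewrite lef_pV2 ?posrE ?mulr_gt0 // -mulrA ler_pM2l.
Qed.

(** At times of order N^2 the power of t contributes N^(2 alpha) and the heat kernel N^-d. *)
Lemma Gr_lower : exists2 c : R, 0 < c & forall N x, (0 < N)%N ->
  (forall i, (`|x ord0 i| <= (2 * N)%N%:Z)%R) -> c * N%:R `^ (2 * alpha - d%:R) <= Gr x.
Proof.
have [q q0 hN] := time_scale.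
have g0 := gamma_int_gt0 (lam_gt0 R d0) alpha0.
have gf := gamma_int_fin (lam_gt0 R d0) alpha0.
have fg0 : 0 < fine (gamma_int lam alpha) by rewrite -lte_fin fineK.
exists (((20 * q) ^+ d * 2 * fine (gamma_int lam alpha))^-1) => [|N x N0 xN].
  by rewrite invr_gt0 !mulr_gt0 // exprn_gt0 // mulr_gt0.
have n0 : 0 < N%:R :> R by rewrite ltr0n.
have := hN N N0; set T := 8 * _ => -[T0 TN _ hq].
have := Gser_ge d0 alpha0 (lexx T) xN.
have GE : Gser alpha x = (Gr x)%:E by rewrite fineK // (Gr_fin d0 s0 sa ad).
rewrite GE -(fineK gf) -EFinM lee_fin => h.
rewrite invfM mulrAC ler_pdivrMr // mulrC [leRHS]mulrC; apply: le_trans h.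
have hT : N%:R `^ (2 * alpha) <= T `^ alpha.
  rewrite powRrM -[2]/(2%:R) powR_mulrn ?(ltW n0) //.
  by apply: ge0_ler_powR; rewrite ?nnegrE ?exprn_ge0 // ltW.
apply: (@le_trans _ _ (N%:R `^ (2 * alpha) * (20 * q * N%:R)^-1 ^+ d / 2)); last first.
  rewrite ler_wpM2r ?invr_ge0 //; apply: ler_pM; rewrite ?powR_ge0 ?exprn_ge0 ?invr_ge0 //.
  by rewrite !mulr_ge0 // ltW.
rewrite powRB ?(gt_eqF n0) ?implybT // powR_mulrn ?(ltW n0) //.
rewrite le_eqVlt; apply/orP; left; apply/eqP; rewrite exprVn [(20 * q * _) ^+ d]exprMn.
have h1 : N%:R ^+ d != 0 :> R by rewrite expf_neq0 // gt_eqF.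
have h2 : (20 * q) ^+ d != 0 by rewrite expf_neq0 // gt_eqF // mulr_gt0.
by move: (N%:R ^+ d) ((20 * q) ^+ d) h1 h2 => a b ha hb; field; rewrite ha hb.
Qed.

(** At times of order N^2, t^-sigma contributes N^(-2 sigma) and the heat kernel N^-d. At sigma = 1
    distant points are not joined by the kernel, which forces a separate argument along paths. *)
Lemma Kr_lower : sigma < 1 -> exists2 c : R, 0 < c & forall N x y, (0 < N)%N -> x != y ->
  (forall i, (`|(x - y) ord0 i| <= (2 * N)%N%:Z)%R) ->
  c * N%:R `^ (- (2 * sigma) - d%:R) <= Kr x y.
Proof.
move=> ls1; have ls : 0 < 1 - sigma by rewrite subr_gt0.
have [q q0 hN] := time_scale.
have g0 := gamma_int_gt0 (lam_gt0 R d0) ls.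
have gf := gamma_int_fin (lam_gt0 R d0) ls.
have fg0 : 0 < fine (gamma_int lam (1 - sigma)) by rewrite -lte_fin fineK.
have l0 := lam_gt0 R d0; have ls0 := lams_gt0 sigma d0.
pose b : R := q `^ (- (2 * sigma)).
exists (lam `^ sigma * (b / ((20 * q) ^+ d * 2 * (fine (gamma_int lam (1 - sigma)) * (lam / sigma))))) => [|N x y N0 xy xN].
  by rewrite mulr_gt0 // divr_gt0 ?powR_gt0 // !mulr_gt0 ?invr_gt0 // exprn_gt0 // mulr_gt0.
have n0 : 0 < N%:R :> R by rewrite ltr0n.
have := hN N N0; set T := 8 * _ => -[T0 _ T2 hq].
have s01 : 0 < sigma < 1 by rewrite s0.
have xy0 : x - y != 0 by rewrite subr_eq0.
have := Kser_ge d0 s01 xy0 (lexx T) xN.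
have KE : Kser sigma (x - y) = (fine (Kser sigma (x - y)))%:E.
  by rewrite fineK // (Kser_fin d0 s0 s1).
rewrite KE -[gamma_int _ _](fineK gf) -!EFinM lee_fin mulrA => h.
have hT : b * N%:R `^ (- (2 * sigma)) <= (2 * T) `^ (- sigma).
  have qn : 0 < q * N%:R by rewrite mulr_gt0.
  have -> : b * N%:R `^ (- (2 * sigma)) = (((q * N%:R) ^+ 2) `^ sigma)^-1.
    by rewrite /b -powRM ?(ltW q0) ?(ltW n0) // powRN powRrM -[2]/(2%:R) powR_mulrn // ltW.
  rewrite powRN lef_pV2 ?posrE ?powR_gt0 ?exprn_gt0 ?mulr_gt0 //.
  by apply: ge0_ler_powR => //; rewrite ?nnegrE ?exprn_ge0 ?mulr_ge0 // ltW.
have gl0 : 0 < fine (gamma_int lam (1 - sigma)) * (lam / sigma) by rewrite mulr_gt0 // divr_gt0.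
move: (fine (gamma_int lam (1 - sigma)) * (lam / sigma)) gl0 h => g gl0 h.
rewrite /Kr -mulrA ler_pM2l // -(ler_pM2l gl0).
apply: le_trans h.
apply: (@le_trans _ _ (b * N%:R `^ (- (2 * sigma)) * (20 * q * N%:R)^-1 ^+ d / 2)); last first.
  rewrite ler_wpM2r ?invr_ge0 //; apply: ler_pM; rewrite ?mulr_ge0 ?powR_ge0 ?exprn_ge0 ?invr_ge0 //.
  by rewrite !mulr_ge0 // ltW.
rewrite powRB ?(gt_eqF n0) ?implybT // powR_mulrn ?(ltW n0) //.
rewrite le_eqVlt; apply/orP; left; apply/eqP; rewrite exprVn [(20 * q * _) ^+ d]exprMn.
have h1 : N%:R ^+ d != 0 :> R by rewrite expf_neq0 // gt_eqF.
have h2 : (20 * q) ^+ d != 0 by rewrite expf_neq0 // gt_eqF // mulr_gt0.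
move: (N%:R ^+ d) ((20 * q) ^+ d) h1 h2 => a e ha he.
by field; rewrite ha he !gt_eqF.
Qed.

Let KG x y : R := Kr x y * (Gr x * Gr y).
Let KG0 x y : 0 <= KG x y. Proof. by rewrite mulr_ge0 // mulr_ge0 // ltW. Qed.

Lemma tsum_KG phi : tsum (fun p => (KG p.1 p.2 * (phi p.1 / Gr p.1 - phi p.2 / Gr p.2) ^+ 2)%:E)
  = (2%:E * En phi)%E.
Proof. by rewrite /Een muleA -EFinM divff // mul1e. Qed.

(** A box of side N has about N^(2d) pairs of points, with K at least of order N^(-2 sigma - d) and
    each G at least of order N^(2 alpha - d): [delta] is the resulting exponent of the total weight,
    positive iff alpha > alpha_0. *)
Let delta : R := 4 * alpha - 2 * sigma - d%:R.

(** Box m has 2^m points and smallest side [side m]; the factor 2^d pays for the passage to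
    [side m.+1]. *)
Lemma half_pow_side m : 2^-1 ^+ m <= 2 ^+ d * (side m.+1)%:R `^ (- d%:R) :> R.
Proof.
have n0 : 0 < (side m.+1)%:R :> R by rewrite ltr0n side_gt0.
rewrite exprVn powRN powR_mulrn ?(ltW n0) // ler_pdivlMr ?exprn_gt0 // mulrC ler_pdivrMr ?exprn_gt0 //.
apply: (@le_trans _ _ ((2 * side m)%:R ^+ d)).
  by apply: lerXn2r; rewrite ?nnegrE // ler_nat sideS_le.
rewrite natrM exprMn ler_pM2l ?exprn_gt0 // -!natrX ler_nat; exact: side_expn_le.
Qed.

(* For sigma < 1 both averages are compared by summing over all pairs of points,
   which the jump kernel joins directly. *)
Lemma avg_step_jumps : sigma < 1 -> exists2 C : R, 0 <= C & forall phi m (E : R),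
  (En phi <= E%:E)%E ->
  (avg d0 m.+1 (fun x => phi x / Gr x) - avg d0 m (fun x => phi x / Gr x)) ^+ 2 <=
  C * E * (side m.+1)%:R `^ (- delta).
Proof.
move=> ls1; have [cK cK0 hK] := Kr_lower ls1; have [cG cG0 hG] := Gr_lower.
exists (2^-1 * (2 ^+ d) ^+ 2 / (cK * cG ^+ 2)) => [|phi m E hE].
  by rewrite divr_ge0 ?mulr_ge0 ?invr_ge0 ?exprn_ge0 // ltW.
set u := fun x => phi x / Gr x; set N := side m.+1.
have Npos : (0 < N)%N by exact: side_gt0.
have n0 : 0 < N%:R :> R by rewrite ltr0n.
pose J := jump m.
pose F x y := (u (y + J) - u x) ^+ 2.
have F0 x y : 0 <= F x y by exact: sqr_ge0.
have h1 : (avg d0 m.+1 u - avg d0 m u) ^+ 2 <= 4^-1 * avg d0 m (fun x => avg d0 m (F x)).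
  rewrite avgS_sub avgB.
  have -> : avg d0 m (fun x => u (x + jump m)) - avg d0 m u =
            avg d0 m (fun x => avg d0 m (fun y => u (y + J) - u x)).
    under [in RHS]eq_fun do rewrite avgB avg_cst.
    by rewrite avgB avg_cst.
  rewrite expr_div_n mulrC (_ : 2 ^+ 2 = 4); last by rewrite expr2 -natrM.
  rewrite ler_wpM2l ?invr_ge0 //; apply: le_trans (avg_sqr _ _ _) _.
  by apply: le_avg => x; exact: avg_sqr.
pose k : R := cK * cG ^+ 2 * N%:R `^ (2 * (2 * alpha - d%:R) - 2 * sigma - d%:R).
have k0 : 0 < k by rewrite mulr_gt0 ?powR_gt0 // mulr_gt0 // exprn_gt0.
have lowKG x y : x != y -> in_box m.+1 x -> in_box m.+1 y -> k <= KG x y.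
  move=> xy bx by_.
  have kx := hG N x Npos (fun i => in_box_bound d0 i bx).
  have ky := hG N y Npos (fun i => in_box_bound d0 i by_).
  have kk := hK N x y Npos xy (fun i => in_box_diff d0 i bx by_).
  have -> : k = cK * N%:R `^ (- (2 * sigma) - d%:R) *
     ((cG * N%:R `^ (2 * alpha - d%:R)) * (cG * N%:R `^ (2 * alpha - d%:R))).
    rewrite /k (_ : 2 * (2 * alpha - d%:R) - 2 * sigma - d%:R =
      (- (2 * sigma) - d%:R) + ((2 * alpha - d%:R) + (2 * alpha - d%:R))); last by ring.
    by rewrite !powRD ?(gt_eqF n0) ?implybT //; ring.
  have z0 a c : 0 < c -> 0 <= c * N%:R `^ a by move=> c0; rewrite mulr_ge0 ?powR_ge0 // ltW.
  apply: ler_pM; rewrite ?z0 //; first by rewrite mulr_ge0 ?z0.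
  by apply: ler_pM; rewrite ?z0.
have h2 : ((avg d0 m (fun x => avg d0 m (F x)))%:E <= (2^-1 ^+ m * 2^-1 ^+ m * (k^-1 * (2 * E)))%:E)%E.
  apply: le_trans (avg2_le_tsum d0 m F0) _.
  rewrite [leRHS]EFinM; apply: lee_wpmul2l; first by rewrite lee_fin mulr_ge0 ?exprn_ge0 // invr_ge0.
  have t0 x y : (0 <= (KG x y * (u x - u y) ^+ 2)%:E)%E.
    by rewrite lee_fin mulr_ge0 // sqr_ge0.
  apply: (@le_trans _ _ ((k^-1)%:E * tsum (fun p => (KG p.1 (p.2 + J)%R * (u p.1 - u (p.2 + J)%R) ^+ 2)%:E))%E).
    rewrite -tsumZ ?invr_ge0 ?(ltW k0) //; apply: le_tsum => -[x y] /=.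
    rewrite -EFinM lee_fin.
    have [bx|] := boolP (in_box m x); last by rewrite mul0r mul0r mulr_ge0 ?invr_ge0 ?(ltW k0) // mulr_ge0 // sqr_ge0.
    have [by_|] := boolP (in_box m y); last by rewrite mulr0 mul0r mulr_ge0 ?invr_ge0 ?(ltW k0) // mulr_ge0 // sqr_ge0.
    rewrite mulr1 mul1r /F -(sqrrN (_ - u x)) opprB mulrA ler_peMl ?sqr_ge0 //.
    rewrite ler_pdivlMl // mulr1; apply: lowKG; last 2 first.
    - exact: (in_boxS d0).
    - exact: (in_box_jump d0).
    (* The translated point has left box m, so the pair is off the diagonal, as the lower bound on
       the kernel requires. *)
    by apply: contraTneq bx => ->; exact: (notin_box_jump d0).
  rewrite [leRHS]EFinM; apply: lee_wpmul2l; first by rewrite lee_fin invr_ge0 ltW.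
  rewrite -(tsum_pair (f := fun x y => (KG x (y + J) * (u x - u (y + J)) ^+ 2)%:E)) => [|x y]; last exact: t0.
  under eq_tsum do rewrite (tsum_shift (fun y => (KG _ y * (u _ - u y) ^+ 2)%:E) J).
  rewrite (tsum_pair t0) tsum_KG EFinM; apply: lee_wpmul2l => //.
move: h2; rewrite lee_fin => h2.
apply: (le_trans h1); apply: (le_trans (ler_wpM2l _ h2)); first by rewrite invr_ge0.
have E0 : 0 <= E by rewrite -lee_fin (le_trans _ hE) // Een_ge0.
have ph := half_pow_side m; rewrite -/N in ph.
have p0 : 0 <= 2^-1 ^+ m :> R by rewrite exprn_ge0 // invr_ge0.
apply: (@le_trans _ _ (4^-1 * ((2 ^+ d * N%:R `^ (- d%:R)) * (2 ^+ d * N%:R `^ (- d%:R)) * (k^-1 * (2 * E))))).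
  rewrite ler_wpM2l ?invr_ge0 // ler_wpM2r //; last by apply: ler_pM.
  by rewrite mulr_ge0 ?invr_ge0 ?(ltW k0) // mulr_ge0.
rewrite le_eqVlt; apply/orP; left; apply/eqP.
have -> : k^-1 = (cK * cG ^+ 2)^-1 * N%:R `^ (- (2 * (2 * alpha - d%:R) - 2 * sigma - d%:R)).
  by rewrite /k invfM powRN.
have -> : - delta = - d%:R + (- d%:R - (2 * (2 * alpha - d%:R) - 2 * sigma - d%:R)).
  by rewrite /delta; ring.
rewrite !powRD ?(gt_eqF n0) ?implybT //.
by field; rewrite !gt_eqF.
Qed.

Lemma sum_sqr_le (n : nat) (a : nat -> R) :
  (\sum_(i < n) a i) ^+ 2 <= n%:R * \sum_(i < n) a i ^+ 2.
Proof.
elim: n => [|n IH]; first by rewrite !big_ord0 mul0r expr0n.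
rewrite !big_ord_recr /=; move: (a n) IH => b IH.
have h : 2 * b * \sum_(i < n) a i <= n%:R * b ^+ 2 + \sum_(i < n) a i ^+ 2.
  have -> : n%:R * b ^+ 2 + \sum_(i < n) a i ^+ 2 = \sum_(i < n) (b ^+ 2 + a i ^+ 2).
    by rewrite big_split /= sumr_const card_ord mulr_natl.
  rewrite mulr_sumr; apply: ler_sum => i _.
  by have := sqr_ge0 (b - a i); rewrite sqrrB mulr2n; lra.
rewrite -[n.+1%:R]natr1; move: (\sum_(i < n) a i) (\sum_(i < n) a i ^+ 2) (n%:R) IH h => s t z IH h.
lra.
Qed.

(* For sigma = 1 the two averages are joined by straight nearest-neighbour paths. *)
Lemma avg_step_paths : sigma = 1 -> exists2 C : R, 0 <= C & forall phi m (E : R),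
  (En phi <= E%:E)%E ->
  (avg d0 m.+1 (fun x => phi x / Gr x) - avg d0 m (fun x => phi x / Gr x)) ^+ 2 <=
  C * E * (side m.+1)%:R `^ (- delta).
Proof.
move=> sE; have [cG cG0 hG] := Gr_lower.
(* The term n = 1 of the series alone gives every edge a weight bounded below. *)
have [cK cK0 hK] : exists2 c : R, 0 < c & forall x i, c <= Kr (x + unitv i) x.
  have l0 := lam_gt0 R d0.
  exists (lam `^ sigma * (sigma / lam)) => [|x i]; first by rewrite mulr_gt0 ?powR_gt0 ?divr_gt0.
  rewrite /Kr addrC addKr ler_pM2l ?powR_gt0 // -lee_fin fineK ?(Kser_fin d0 s0 s1) //.
  apply: (@le_trans _ _ (bc sigma 1 * wk R 1 (unitv i))%:E).
    by rewrite lee_fin /bc rc0 mulr1 divr1 wkE nwalks1 expr1 mul1r.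
  apply: (@tsum_ge1 _ _ (fun n => (bc sigma n * wk R n (unitv i))%:E)) => n.
  by rewrite lee_fin mulr_ge0 ?wk_ge0 // bc_ge0 // s1 ltW.
exists (2^-1 * 2 ^+ d / (cK * cG ^+ 2)) => [|phi m E hE].
  by rewrite divr_ge0 ?mulr_ge0 ?invr_ge0 ?exprn_ge0 // ltW.
set u := fun x => phi x / Gr x; set N := side m.+1.
have Npos : (0 < N)%N by exact: side_gt0.
have n0 : 0 < N%:R :> R by rewrite ltr0n.
have E0 : 0 <= E by rewrite -lee_fin (le_trans _ hE) // Een_ge0.
pose L := side m; pose e := unitv (axis d0 m).
have LN : L%:R <= N%:R :> R.
  by rewrite ler_nat /N /L /side divnS // leq_exp2l // leq_addl.
pose D k x := (u (x + e *+ k.+1) - u (x + e *+ k)) ^+ 2.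
have D0 k x : 0 <= D k x by exact: sqr_ge0.
(* One factor [L] comes from Cauchy-Schwarz along the path; the sum over k will give another, since
   for each k every edge is used at most once. Together they are bounded by N^2, which is N^(2
   sigma) at sigma = 1. *)
have h1 : (avg d0 m.+1 u - avg d0 m u) ^+ 2 <= 4^-1 * (L%:R * \sum_(k < L) avg d0 m (D k)).
  rewrite avgS_sub expr_div_n mulrC (_ : 2 ^+ 2 = 4); last by rewrite expr2 -natrM.
  rewrite ler_wpM2l ?invr_ge0 //; apply: le_trans (avg_sqr _ _ _) _.
  rewrite -avg_sum -avgZ; apply: le_avg => x.
  have -> : u (x + jump m) - u x = \sum_(k < L) (u (x + e *+ k.+1) - u (x + e *+ k)).
    rewrite -(big_mkord xpredT (fun k => u (x + e *+ k.+1) - u (x + e *+ k))).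
    by rewrite telescope_sumr // mulr0n addr0.
  exact: (@sum_sqr_le L (fun k => u (x + e *+ k.+1) - u (x + e *+ k))).
pose k0 : R := cK * cG ^+ 2 * N%:R `^ (2 * (2 * alpha - d%:R)).
have kpos : 0 < k0 by rewrite mulr_gt0 ?powR_gt0 // mulr_gt0 // exprn_gt0.
have h2 k : (k < L)%N -> avg d0 m (D k) <= 2^-1 ^+ m * (k0^-1 * (2 * E)).
  move=> kL; rewrite -lee_fin; apply: le_trans (avg_le_tsum d0 m (D0 k)) _.
  rewrite [leRHS]EFinM; apply: lee_wpmul2l; first by rewrite lee_fin exprn_ge0 // invr_ge0.
  pose P x := (KG (x + e) x * (u (x + e) - u x) ^+ 2)%:E.
  have P0 x : (0 <= P x)%E by rewrite lee_fin mulr_ge0 // sqr_ge0.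
  apply: (@le_trans _ _ ((k0^-1)%:E * tsum (fun x => P (x + e *+ k)%R))%E).
    rewrite -tsumZ ?invr_ge0 ?(ltW kpos) //; apply: le_tsum => x.
    rewrite -EFinM lee_fin.
    have [bx|] := boolP (in_box m x); last by rewrite mul0r mulr_ge0 ?invr_ge0 ?(ltW kpos) // mulr_ge0 // sqr_ge0.
    have [_ hb] := in_boxS_ax d0 bx.
    rewrite mul1r /D (mulrSr e k) [x + (_ + e)]addrA mulrA ler_peMl ?sqr_ge0 //.
    rewrite ler_pdivlMl // mulr1.
    have kx := hG N _ Npos (fun i => in_box_bound d0 i (hb k (ltnW kL))).
    have := hG N _ Npos (fun i => in_box_bound d0 i (hb k.+1 kL)).
    rewrite -/e (mulrSr e k) addrA => kx'.
    have -> : k0 = cK * ((cG * N%:R `^ (2 * alpha - d%:R)) * (cG * N%:R `^ (2 * alpha - d%:R))).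
      rewrite /k0 (_ : 2 * (2 * alpha - d%:R) = (2 * alpha - d%:R) + (2 * alpha - d%:R)); last by ring.
      by rewrite powRD ?(gt_eqF n0) ?implybT //; ring.
    have z0 : 0 <= cG * N%:R `^ (2 * alpha - d%:R) by rewrite mulr_ge0 ?powR_ge0 // ltW.
    apply: ler_pM; rewrite ?(ltW cK0) ?(mulr_ge0 z0 z0) //; first exact: hK.
    by apply: ler_pM.
  rewrite [leRHS]EFinM; apply: lee_wpmul2l; first by rewrite lee_fin invr_ge0 ltW.
  rewrite tsum_shift; apply: (@le_trans _ _ (2%:E * En phi)%E); last by rewrite EFinM lee_wpmul2l.
  have t0 x y : (0 <= (KG x y * (u x - u y) ^+ 2)%:E)%E.
    by rewrite lee_fin mulr_ge0 // sqr_ge0.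
  rewrite -tsum_KG -(tsum_pair t0) tsum_exchange //; apply: le_tsum => x.
  by apply: (@tsum_ge1 _ _ (fun y => (KG y x * (u y - u x) ^+ 2)%:E)).
apply: (le_trans h1).
apply: (@le_trans _ _ (4^-1 * (L%:R * \sum_(k < L) (2^-1 ^+ m * (k0^-1 * (2 * E)))))).
  by rewrite ler_wpM2l ?invr_ge0 // ler_wpM2l //; apply: ler_sum => k _; exact: h2.
rewrite sumr_const card_ord -[(_ * _) *+ L]mulr_natl.
have ph := half_pow_side m; rewrite -/N in ph.
apply: (@le_trans _ _ (4^-1 * (N%:R * (N%:R * (2 ^+ d * N%:R `^ (- d%:R) * (k0^-1 * (2 * E))))))).
  have kE : 0 <= k0^-1 * (2 * E) by rewrite mulr_ge0 ?invr_ge0 ?(ltW kpos) // mulr_ge0.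
  have p0 : 0 <= 2^-1 ^+ m :> R by rewrite exprn_ge0 // invr_ge0.
  rewrite ler_wpM2l ?invr_ge0 //; have X0 := mulr_ge0 p0 kE.
  apply: ler_pM; rewrite ?(mulr_ge0 (ler0n _ _) X0) //.
  by apply: ler_pM => //; rewrite ler_wpM2r.
rewrite le_eqVlt; apply/orP; left; apply/eqP.
have -> : k0^-1 = (cK * cG ^+ 2)^-1 * N%:R `^ (- (2 * (2 * alpha - d%:R))).
  by rewrite /k0 invfM powRN.
have -> : - delta = 1 + (1 + (- d%:R - 2 * (2 * alpha - d%:R))).
  by rewrite /delta sE; ring.
rewrite !powRD ?(gt_eqF n0) ?implybT // powRr1 ?(ltW n0) //.
by field; rewrite !gt_eqF.
Qed.

Lemma avg_step : exists2 C : R, 0 <= C & forall phi m (E : R), (En phi <= E%:E)%E ->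
  (avg d0 m.+1 (fun x => phi x / Gr x) - avg d0 m (fun x => phi x / Gr x)) ^+ 2 <=
  C * E * (side m.+1)%:R `^ (- delta).
Proof.
have [ls1|] := ltP sigma 1; first exact: avg_step_jumps.
by move=> h; apply: avg_step_paths; apply/eqP; rewrite eq_le s1.
Qed.

Lemma origin_bound : exists2 c : R, 0 < c & forall phi, fsupp phi ->
  ((c * phi 0 ^+ 2)%:E <= En phi)%E.
Proof.
have [C C0 hC] := avg_step.
have dl0 : 0 < delta by have := a0d; rewrite /delta; lra.
(* The factor by which the square root of side^-delta shrinks when the side doubles. *)
pose r : R := 2 `^ (- delta / 2).
have r0 : 0 < r by rewrite powR_gt0.
have r1 : r < 1.
  rewrite /r /powR pnatr_eq0 /= -[ltRHS]expR0 ltr_expR nmulr_rlt0 ?ln_gt0 ?ltr1n //.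
  by rewrite mulNr oppr_lt0 divr_gt0.
have q0 : 0 <= d%:R / (1 - r) by rewrite divr_ge0 // subr_ge0 ltW.
(* The added 1 keeps [B] positive, as [C] may be 0. *)
pose B := Gr 0 ^+ 2 * (C * (d%:R / (1 - r)) ^+ 2) + 1.
have B0 : 0 < B by rewrite ltr_wpDl // mulr_ge0 ?sqr_ge0 // mulr_ge0 // sqr_ge0.
exists B^-1 => [|phi hphi]; first by rewrite invr_gt0.
have Ef : En phi \is a fin_num.
  exact: (Een_fin (Kr_ge0 d0 s0 s1) (@KrC R d sigma) Gr0 (Hr_ge0 d0 s0 sa ad) (Sr_ge0 _ d0)
    (Kr_sum d0 s0 s1) (Kr_Gr d0 s0 s1 sa ad) hphi).
pose E := fine (En phi); have EE : En phi = E%:E by rewrite fineK.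
have E0 : 0 <= E by rewrite fine_ge0 // Een_ge0.
have Su : tsum (fun x => `|phi x / Gr x|%:E) \is a fin_num.
  have [s hs] := hphi; apply: (@tsum_seq_fin _ _ s) => [x|x|//]; first by rewrite lee_fin.
  by move=> xs; have [->|/hs] := eqVneq (phi x) 0; [rewrite mul0r normr0|rewrite (negbTE xs)].
have key : `|phi 0 / Gr 0| <= Num.sqrt (C * E) * (d%:R / (1 - r)).
  apply: (@avg_telescope R d d0 (fun x => phi x / Gr x) (fine (tsum (fun x => `|phi x / Gr x|%:E)))).
  - by rewrite (ltW r0).
  - exact: sqrtr_ge0.
  - by rewrite fineK.
  - move=> m; rewrite sqr_sqrtr ?mulr_ge0 //.
    apply: (le_trans (hC phi m E _)); first by rewrite EE.
    rewrite ler_wpM2l ?mulr_ge0 //.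
    have s2 : (side m)%:R <= (side m.+1)%:R :> R.
      by rewrite ler_nat /side divnS // leq_exp2l // leq_addl.
    have sp : 0 < (side m)%:R :> R by rewrite ltr0n side_gt0.
    apply: (@le_trans _ _ ((side m)%:R `^ (- delta))).
      rewrite !powRN lef_pV2 ?posrE ?powR_gt0 //; last exact: lt_le_trans s2.
      by apply: ge0_ler_powR; rewrite ?nnegrE // ltW.
    rewrite /r /side natrX -exprM -powR_mulrn ?powR_ge0 // -powRrM -powR_mulrn // -powRrM.
    by rewrite natrM [leRHS](_ : _ = 2 `^ ((m %/ d)%:R * - delta)) //; congr (_ `^ _); field.
have {key} : (phi 0 / Gr 0) ^+ 2 <= C * E * (d%:R / (1 - r)) ^+ 2.
  rewrite -real_normK ?num_real // -[C * E](@sqr_sqrtr _ (C * E)) ?mulr_ge0 // -exprMn.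
  by rewrite lerXn2r ?nnegrE ?(mulr_ge0 (sqrtr_ge0 _) q0) ?normr_ge0.
have g0 := Gr0 0.
rewrite EE lee_fin ler_pdivrMl // expr_div_n ler_pdivrMr ?exprn_gt0 // => h.
apply: (le_trans h); rewrite /B mulrDl mul1r -[leLHS]addr0; apply: lerD => //.
by rewrite le_eqVlt; apply/orP; left; apply/eqP; ring.
Qed.

Lemma subcritical_wHardy : subcritical sigma (wHardy (d := d) sigma alpha).
Proof.
have hH := hardy_wHardy d0 s0 s1 sa ad; split=> //.
have [c c0 hc] := origin_bound.
(* By [origin_bound] the energy left over in the representation pays for the extra mass [c] at the
   origin. *)
pose w' x := wHardy (d := d) sigma alpha x + (if x == 0 then c else 0).
exists w'; split; last split.
- split=> [x|phi hphi].
    by rewrite addr_ge0 //; [case: hH|case: ifP => // _; exact: ltW].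
  have W0 x : (0 <= (wHardy sigma alpha x * phi x ^+ 2)%:E)%E.
    by rewrite lee_fin mulr_ge0 ?sqr_ge0 //; case: hH.
  have -> : wsum w' phi = (wsum (wHardy sigma alpha) phi + (c * phi 0 ^+ 2)%:E)%E.
    have <- : tsum (fun x => ((if x == 0 then c else 0) * phi x ^+ 2)%:E) = (c * phi 0 ^+ 2)%:E.
      rewrite (tsum_single (x := 0)) ?eqxx // => y; last by move=> /negbTE ->; rewrite mul0r.
      by rewrite lee_fin mulr_ge0 ?sqr_ge0 //; case: ifP => // _; exact: ltW.
    rewrite -tsumD //; first by apply: eq_tsum => x; rewrite -EFinD -mulrDl.
    by move=> x; rewrite lee_fin mulr_ge0 ?sqr_ge0 //; case: ifP => // _; exact: ltW.
  rewrite (QformE d0 s0 s1) (wsumE d0 s0 sa ad).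
  rewrite (ground_state_representation (Kr_ge0 d0 s0 s1) (@KrC R d sigma) Gr0 (Hr_ge0 d0 s0 sa ad)
    (Sr_ge0 _ d0) (Kr_sum d0 s0 s1) (Kr_Gr d0 s0 s1 sa ad) (fsupp_l2 (hphi : fsupp phi))).
  by rewrite addeC leeD2r // hc.
- by move=> x; rewrite lerDl; case: ifP => // _; exact: ltW.
- move/(congr1 (fun f => f 0)); rewrite /w' eqxx => /eqP.
  by rewrite addrC -subr_eq0 addrK gt_eqF.
Qed.

End subcritical_range.

Theorem theorem3p5 (R : realType) (d : nat) (sigma : R) :
  (0 < d)%N -> 0 < sigma -> sigma <= 1 ->
  ((d <= 2)%N -> sigma < d%:R / 2) ->
  let alpha0 := (d%:R / 2 + sigma) / 2 in
  (forall alpha : R, sigma < alpha -> alpha < d%:R / 2 ->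
     hardy sigma (wHardy (d := d) sigma alpha)) /\
  (forall alpha : R, sigma < alpha -> alpha < alpha0 ->
     positive_critical sigma (wHardy (d := d) sigma alpha)) /\
  null_critical sigma (wHardy (d := d) sigma alpha0) /\
  (forall alpha : R, alpha0 < alpha -> alpha < d%:R / 2 ->
     subcritical sigma (wHardy (d := d) sigma alpha)).
Proof.
move=> d0 s0 s1 sd alpha0.
have sd2 : sigma < d%:R / 2.
  have [/sd//|d3] := leqP d 2; apply: (le_lt_trans s1).
  by rewrite ltr_pdivlMr // mul1r ltr_nat.
have [a0E sa0 a0d] : [/\ 2 * alpha0 - sigma = d%:R / 2, sigma < alpha0 & alpha0 < d%:R / 2].
  by split; rewrite /alpha0; [field|lra|lra].
split=> [alpha sa ad|]; first exact: hardy_wHardy.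
split=> [alpha sa aa0|]; last split=> [|alpha a0a ad].
- have ad := lt_trans aa0 a0d; apply: positive_critical_wHardy => //.
  by rewrite -a0E ltrD2r ltr_pM2l.
- exact: null_critical_wHardy.
- have sa := lt_trans sa0 a0a; apply: subcritical_wHardy => //.
  by move: a0a; rewrite /alpha0; lra.
Qed.
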